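(* Let $n\ge2$, let $\Omega \subset \mathbb{R}^n$ be a bounded Lipschitz domain and $\sigma \in \mathcal{M}(\partial \Omega)$. Then there exists a vector field $\mathbf{F}$ on $\mathbb{R}^n$ such that $\mathbf{F} \in L^p(\mathbb{R}^n; \mathbb{R}^n)$ with $\operatorname{div} \mathbf{F} \in L^p(\mathbb{R}^n)$ for all $1 \leq p < \frac{n}{n-1}$, $$\limsup_{\varepsilon \downarrow 0} \frac1{2\varepsilon} \int_{B_\varepsilon(\partial \Omega)} |\mathbf{F}| \,\mathrm{d} x \leq C |\sigma|(\partial \Omega)<\infty,$$ where $C$ is a constant depending only on $n$ and $\Omega$, and $$\langle \mathbf{F} \cdot \nu, \cdot \rangle_{\partial\Omega} = \sigma.$$ Moreover, if $\int_{\partial\Omega} \mathrm{d}\sigma=0$, then $\mathbf{F}$ can be chosen to be divergence-free in a neighbourhood of $\overline\Omega$.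
   Context: $\mathcal{M}(\partial\Omega)$ denotes the finite signed Radon measures on $\partial\Omega$ and $|\sigma|$ the total variation measure. $B_\varepsilon(\partial\Omega)=\{x\in\mathbb{R}^n:\operatorname{dist}(x,\partial\Omega)<\varepsilon\}$. $\operatorname{div}\mathbf{F}$ is the distributional divergence on $\mathbb{R}^n$. Normal trace: for $\mathbf{F}\in L^1(\mathbb{R}^n;\mathbb{R}^n)$ whose distributional divergence is a finite signed Radon measure and a Borel set $E\subset\mathbb{R}^n$, the (weak) normal trace is the functional on bounded Lipschitz functions $\phi$ on $\mathbb{R}^n$ $$\langle \mathbf{F}\cdot\nu,\phi\rangle_{\partial E}:=\int_E\phi\,\mathrm{d}(\operatorname{div}\mathbf{F})+\int_E\mathbf{F}\cdot\nabla\phi\,\mathrm{d}x .$$ The identity $\langle \mathbf{F}\cdot\nu,\cdot\rangle_{\partial\Omega}=\sigma$ means $\langle \mathbf{F}\cdot\nu,\phi\rangle_{\partial\Omega}=\int_{\partial\Omega}\phi\,\mathrm{d}\sigma$ for all bounded Lipschitz $\phi$ on $\mathbb{R}^n$. *)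

(* Defs.v *)
From HB Require Import structures.
From mathcomp Require Import all_boot all_order all_algebra.
From mathcomp Require Import all_classical all_reals all_analysis.
From mathcomp Require Import measurable_realfun.

Set Implicit Arguments.
Unset Strict Implicit.
Unset Printing Implicit Defensive.

Import Order.TTheory GRing.Theory Num.Theory.
Import numFieldNormedType.Exports.

Local Open Scope classical_set_scope.
Local Open Scope ring_scope.

(* The Borel sigma-algebra of R^n, generated by the open sets. *)
HB.instance Definition _ (R : realType) (n : nat) :=
  Measurable.copy 'rV[R]_n (g_sigma_algebraType (@open 'rV[R]_n)).

Section LebesgueMeasure.
Context {R : realType}.

Lemma open_measurable_rV n (U : set 'rV[R]_n) : open U -> measurable U.
Proof. exact: sub_sigma_algebra. Qed.

Definition cons_rV n (p : R * 'rV[R]_n) : 'rV[R]_n.+1 := row_mx p.1%:M p.2.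

Let lshift00 n : lshift n (0 : 'I_1) = (0 : 'I_n.+1).
Proof. by apply: ord_inj. Qed.

Lemma cons_rV_head n (p : R * 'rV[R]_n) : cons_rV p 0 0 = p.1.
Proof.
rewrite /cons_rV -(lshift00 n).
by rewrite (row_mxEl (p.1%:M : 'M[R]_1)) mxE mulr1n.
Qed.

Lemma cons_rV_tail n (p : R * 'rV[R]_n) j :
  cons_rV p 0 (lift ord0 j) = p.2 0 j.
Proof. by rewrite /cons_rV -rshift1 (row_mxEr (p.1%:M : 'M[R]_1)). Qed.

Lemma ball_cons_rV n (c : 'rV[R]_n.+1) (e : R) (p : R * 'rV[R]_n) :
  ball c e (cons_rV p) <->
  ball (c 0 0) e p.1 /\ ball (rsubmx (c : 'rV_(1 + n))) e p.2.
Proof.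
split=> [[e0 H]|[H1 [e0 H2]]].
- split; first by have := H 0 0; rewrite cons_rV_head.
  by split=> // i j; have := H i (lift ord0 j);
    rewrite ord1 cons_rV_tail mxE rshift1.
- split=> // i j; rewrite ord1 {i}; case: (unliftP 0 j) => [k ->|->].
    by rewrite cons_rV_tail; have := H2 0 k; rewrite mxE rshift1.
  by rewrite cons_rV_head.
Qed.

Lemma measurable_cons_rV n : measurable_fun [set: R * 'rV[R]_n] (@cons_rV n).
Proof.
apply: (@measurability _ _ _ _ _ _ (@open 'rV[R]_n.+1)) => //.
move=> _ [U oU <-]; rewrite setTI.
pose c (q : 'rV[rat]_n.+1) : 'rV[R]_n.+1 := map_mx ratr q.
pose r (k : nat) : R := k.+1%:R^-1.
pose B (q : 'rV[rat]_n.+1 * nat) := ball (c q.1) (r q.2).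
have -> : @cons_rV n @^-1` U =
    \bigcup_(q in [set q | B q `<=` U]) (@cons_rV n @^-1` B q).
  apply/seteqP; split=> [p Up|p [q /= qU Bq]]; last exact: qU.
  have := oU; rewrite openE => /(_ _ Up)/nbhs_ballP[e /= e0 eU].
  have e20 : 0 < e / 2 by rewrite divr_gt0.
  have [k _ /(_ k (leqnn k)) rk] := near_infty_natSinv_lt (PosNum e20).
  have r0 : 0 < r k by rewrite invr_gt0.
  set x := cons_rV p in Up eU *.
  have : forall j, exists q : rat, ball (x 0 j) (r k) (ratr q).
    move=> j; have [q] := @rat_in_itvoo R (x 0 j - r k)
      (x 0 j + r k) ltac:(by rewrite ltrD2l gt0_cp).
    by move=> qr; exists q; rewrite -ball_normE/=; move: qr;
       rewrite in_itv/= ltr_distlC.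
  move=> /choice[f fP].
  have cE j : c (\row_j f j) 0 j = ratr (f j) by rewrite /c !mxE.
  exists (\row_j f j, k) => /=; last first.
    apply: ball_sym; split => // i j; rewrite ord1 cE; exact: fP.
  move=> y By; apply: eU; rewrite [e]splitr.
  apply: (@ball_triangle _ _ (c (\row_j f j))).
    apply: (@le_ball _ _ _ (r k)); first exact: ltW.
    by split => // i j; rewrite ord1 cE; exact: fP.
  by apply: le_ball By; exact: ltW.
rewrite bigcup_mkcond.
apply: countable_bigcupT_measurable => [|q]; first exact: countableP.
case: ifP => // _.
rewrite (_ : _ @^-1` _ =
  ball (c q.1 0 0) (r q.2) `*` ball (rsubmx (c q.1 : 'rV_(1 + n))) (r q.2)).
  by apply: measurableX; [apply: open_measurable|apply: open_measurable_rV];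
    apply: ball_open; rewrite invr_gt0.
by apply/seteqP; split=> p /ball_cons_rV.
Qed.

Lemma continuous_measurable_fun n (f : 'rV[R]_n -> R) :
  continuous f -> measurable_fun [set: 'rV[R]_n] f.
Proof.
move=> /continuousP cf; apply: (measurability _ (RGenOpens.measurableE R)) => //.
move=> _ [_ [a [b ->] <-]]; rewrite setTI.
by apply: open_measurable_rV; apply: cf; exact: interval_open.
Qed.

Lemma continuous_measurable_fun_rV m n (f : 'rV[R]_m -> 'rV[R]_n) :
  continuous f -> measurable_fun [set: 'rV[R]_m] f.
Proof.
move=> /continuousP cf.
apply: (@measurability _ _ _ _ _ _ (@open 'rV[R]_n)) => //.
by move=> _ [U oU <-]; rewrite setTI; apply: open_measurable_rV; exact: cf.
Qed.

Section cons_measure.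
Local Open Scope ereal_scope.
Variables (n : nat) (mu : {sigma_finite_measure set 'rV[R]_n -> \bar R}).

Definition cons_measure : set 'rV[R]_n.+1 -> \bar R :=
  pushforward (@lebesgue_measure R \x mu) (@cons_rV n).

Let measurable_preimage (A : set 'rV[R]_n.+1) :
  measurable A -> measurable (@cons_rV n @^-1` A).
Proof.
by move=> mA; rewrite -[X in measurable X]setTI; exact: measurable_cons_rV.
Qed.

Let cons_measure0 : cons_measure set0 = 0.
Proof.
rewrite /cons_measure /pushforward preimage_set0.
exact: (measure0 (@lebesgue_measure R \x mu)).
Qed.

Let cons_measure_ge0 A : 0 <= cons_measure A.
Proof. exact: (measure_ge0 (@lebesgue_measure R \x mu)). Qed.

Let cons_measure_sigma_additive : semi_sigma_additive cons_measure.
Proof.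
move=> F mF tF mUF; rewrite /cons_measure /pushforward preimage_bigcup.
apply: measure_semi_sigma_additive.
- by move=> i; exact: measurable_preimage.
- apply/trivIsetP => /= i j _ _ ij; rewrite -preimage_setI.
  by move/trivIsetP : tF => /(_ _ _ _ _ ij) ->//; rewrite preimage_set0.
- by rewrite -preimage_bigcup; exact: measurable_preimage.
Qed.

HB.instance Definition _ := isMeasure.Build _ _ _ cons_measure
  cons_measure0 cons_measure_ge0 cons_measure_sigma_additive.

Let cons_measure_sigma_finite : sigma_finite setT cons_measure.
Proof.
have /sigma_finiteP[F [FT ndF mF]] := sigma_finiteT (@lebesgue_measure R).
have /sigma_finiteP[G [GT ndG mG]] := sigma_finiteT mu.
pose h (v : 'rV[R]_n.+1) : R := v 0%R 0%R.
pose t (v : 'rV[R]_(1 + n)) : 'rV[R]_n := rsubmx v.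
have mh : measurable_fun setT h.
  by apply: continuous_measurable_fun; exact: coord_continuous.
have mt : measurable_fun setT t.
  by apply: continuous_measurable_fun_rV; exact: continuous_rsubmx.
have hE p : h (@cons_rV n p) = p.1.
  by rewrite /h cons_rV_head.
have tE p : t (@cons_rV n p) = p.2 by rewrite /t /cons_rV row_mxKr.
exists (fun i => h @^-1` F i `&` t @^-1` G i).
  apply/seteqP; split=> // v _.
  have [i _ Fi] : (\bigcup_i F i) (h v) by rewrite -FT.
  have [j _ Gj] : (\bigcup_i G i) (t v) by rewrite -GT.
  exists (maxn i j) => //; split => /=.
    by have /subsetPset := ndF _ _ (leq_maxl i j); apply.
  by have /subsetPset := ndG _ _ (leq_maxr i j); apply.
move=> i; have [mFi Fioo] := mF i; have [mGi Gioo] := mG i; split.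
  apply: measurableI; first by rewrite -[X in measurable X]setTI; exact: mh.
  by rewrite -[X in measurable X]setTI; exact: mt.
rewrite /cons_measure /pushforward.
rewrite (_ : _ @^-1` _ = F i `*` G i); last first.
  by apply/seteqP; split => p /=; rewrite hE tE.
by rewrite product_measure1E// lte_mul_pinfty// ge0_fin_numE.
Qed.

HB.instance Definition _ := @Measure_isSigmaFinite.Build _ _ _ cons_measure
  cons_measure_sigma_finite.

End cons_measure.

(* Lebesgue measure on (the Borel sets of) R^n, as an iterated product. *)
Fixpoint lebesgueN n : {sigma_finite_measure set 'rV[R]_n -> \bar R} :=
  match n return {sigma_finite_measure set 'rV[R]_n -> \bar R} with
  | 0 => \d_(0 : 'rV[R]_0)
  | n'.+1 => cons_measure (lebesgueN n')
  end.

Lemma lebesgueN_box n (A : 'I_n -> set R) : (forall i, measurable (A i)) ->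
  lebesgueN n [set v | forall i, A i (v 0 i)] =
  (\prod_(i < n) lebesgue_measure (A i))%E.
Proof.
elim: n A => [A _|n IH A mA].
  by rewrite big_ord0 /= diracE mem_set// => -[].
pose B := [set v : 'rV[R]_n | forall i, A (lift ord0 i) (v 0 i)].
have mB : measurable B.
  rewrite (_ : B = \bigcap_(i in [set: 'I_n])
      ((fun v : 'rV[R]_n => v 0 i) @^-1` A (lift ord0 i))).
    apply: fin_bigcap_measurable => // i _.
    rewrite -[X in measurable X]setTI.
    by apply: continuous_measurable_fun => //; exact: coord_continuous.
  by apply/seteqP; split => v /= H i; [move=> _; exact: H|exact: H].
rewrite big_ord_recl /= -(IH (fun i => A (lift ord0 i)))// -/B.
rewrite -(product_measure1E (@lebesgue_measure R) (lebesgueN n) _ mB)//; last exact: mA.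
rewrite /cons_measure /pushforward; congr (_ _).
apply/seteqP; split => p /= H.
- split => [|i]; first by have := H 0; rewrite cons_rV_head.
  by have := H (lift ord0 i); rewrite cons_rV_tail.
- move=> i; case: (unliftP 0 i) => [j ->|->].
    by rewrite cons_rV_tail; exact: (H.2 j).
  by rewrite cons_rV_head; exact: H.1.
Qed.

End LebesgueMeasure.

Section SignedMeasure.
Context d (T : measurableType d) (R : realType).
Variable nu : {charge set T -> \bar R}.

Definition hahn_pos : set T := projT1 (cid (Hahn_decomposition nu)).

Definition hahn_neg : set T :=
  projT1 (cid (projT2 (cid (Hahn_decomposition nu)))).

Lemma hahnP : hahn_decomposition nu hahn_pos hahn_neg.
Proof. exact: projT2 (cid (projT2 (cid (Hahn_decomposition nu)))). Qed.

(* nu^+, nu^- and |nu| do not depend on the chosen Hahn decomposition. *)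
Definition total_variation : set T -> \bar R := charge_variation hahnP.

Definition charge_integral (D : set T) (f : T -> R) : R :=
  \int[jordan_pos hahnP]_(x in D) f x - \int[jordan_neg hahnP]_(x in D) f x.

End SignedMeasure.

Section EuclideanSpace.
Context {R : realType} {n : nat}.
Implicit Types (x y : 'rV[R]_n) (A U : set 'rV[R]_n).

(* The library norm on 'rV[R]_n is the sup norm, hence the explicit Euclidean
   norm. *)
Definition dotv x y : R := \sum_(i < n) x 0 i * y 0 i.

Definition enorm x : R := Num.sqrt (dotv x x).

Definition dist_to A x : \bar R := ereal_inf [set (enorm (x - y))%:E | y in A].

Definition tube (e : R) A : set 'rV[R]_n := [set x | (dist_to A x < e%:E)%E].

Definition boundary A : set 'rV[R]_n := closure A `\` interior A.

(* Near each boundary point, after an orthogonal change of coordinates,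
   Omega is the strict epigraph of a Lipschitz function of n - 1 variables. *)
Definition lipschitz_boundary (Omega : set 'rV[R]_n) :=
  forall x0, boundary Omega x0 ->
    exists (r : R) (Q : 'M[R]_n) (i : 'I_n) (g : 'rV[R]_n.-1 -> R),
      [/\ 0 < r, Q *m Q^T = 1%:M, lipschitz g &
          forall x, enorm (x - x0) < r ->
            (Omega x <-> g (col' i (x *m Q)) < (x *m Q) 0 i)].

Definition bounded_lipschitz_domain (Omega : set 'rV[R]_n) :=
  [/\ Omega !=set0, open Omega, connected Omega, bounded_set Omega &
      lipschitz_boundary Omega].

Definition partial (i : 'I_n) (f : 'rV[R]_n -> R) : 'rV[R]_n -> R :=
  fun x => 'D_(delta_mx 0 i) f x.

(* For Lipschitz f the partial derivatives exist almost everywhere; on the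
   remaining null set the value is a dummy one. *)
Definition grad (f : 'rV[R]_n -> R) x : 'rV[R]_n := \row_i partial i f x.

Definition bounded_lipschitz (f : 'rV[R]_n -> R) :=
  [bounded f x | x in [set: 'rV[R]_n]] /\ lipschitz f.

Definition smooth (f : 'rV[R]_n -> R) :=
  forall s : seq 'I_n, let h := foldr partial f s in
    continuous h /\ forall i x, derivable h x (delta_mx 0 i).

(* C_c^oo(U) *)
Definition test_function U (f : 'rV[R]_n -> R) :=
  let supp := closure [set x | f x != 0] in
  [/\ smooth f, compact supp & supp `<=` U].

Definition vector_Lp (p : R) (F : 'rV[R]_n -> 'rV[R]_n) :=
  measurable_fun setT F /\ finite_norm (@lebesgueN R n) p%:E (enorm \o F).

Definition is_divergence (F : 'rV[R]_n -> 'rV[R]_n)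
    (nu : {charge set 'rV[R]_n -> \bar R}) :=
  forall f, test_function setT f ->
    charge_integral nu setT f = - \int[@lebesgueN R n]_x dotv (F x) (grad f x).

Definition divergence_free_on U (F : 'rV[R]_n -> 'rV[R]_n) :=
  forall f, test_function U f ->
    \int[@lebesgueN R n]_x dotv (F x) (grad f x) = 0.

Definition charge_in_Lp (p : R) (nu : {charge set 'rV[R]_n -> \bar R}) :=
  exists2 g : 'rV[R]_n -> R, g \in Lfun (@lebesgueN R n) p%:E &
    forall A, measurable A ->
      nu A = (\int[@lebesgueN R n]_(x in A) (g x)%:E)%E.

(* To be used with divF such that is_divergence F divF. *)
Definition normal_trace (F : 'rV[R]_n -> 'rV[R]_n)
    (divF : {charge set 'rV[R]_n -> \bar R}) (E : set 'rV[R]_n)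
    (f : 'rV[R]_n -> R) : R :=
  charge_integral divF E f +
  \int[@lebesgueN R n]_(x in E) dotv (F x) (grad f x).

(* The finite signed Radon measures on a compact set K are the finite signed
   Borel measures on R^n that vanish off K. *)
Definition concentrated_on (K : set 'rV[R]_n)
    (nu : {charge set 'rV[R]_n -> \bar R}) :=
  forall A, measurable A -> A `&` K = set0 -> nu A = 0%E.

Definition realises_normal_trace (Omega : set 'rV[R]_n)
    (sigma : {charge set 'rV[R]_n -> \bar R}) (C : R)
    (F : 'rV[R]_n -> 'rV[R]_n) :=
  exists divF : {charge set 'rV[R]_n -> \bar R},
    [/\ is_divergence F divF,
        forall p : R, 1 <= p -> p < n%:R / (n%:R - 1) ->
          vector_Lp p F /\ charge_in_Lp p divF,
        (limf_esup (fun e : R => ((2 * e)^-1)%:E *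
             \int[@lebesgueN R n]_(x in tube e (boundary Omega))
               (enorm (F x))%:E) 0^'+
           <= C%:E * total_variation sigma (boundary Omega))%E,
        (C%:E * total_variation sigma (boundary Omega) < +oo)%E &
        forall f, bounded_lipschitz f ->
          normal_trace F divF Omega f =
          charge_integral sigma (boundary Omega) f].

End EuclideanSpace.

(* Main.v *)
From HB Require Import structures.
Require Import Defs.
From mathcomp Require Import all_boot all_order all_algebra.
From mathcomp Require Import all_classical all_reals all_analysis.
From mathcomp Require Import measurable_realfun.
From mathcomp Require Import ring lra.

(** The field is a finite sum of explicit fields that carry mass along
    straight lines, in the spirit of the Bogovskii integral.

    Transport.  Let psi be a bump of integral 1 that moves so that at time t
    its centre is c0 + t v and its radius is l0 + t l1.  Its density then obeys
    a continuity equation with the flux (v + l1 z) psi, z being the rescaled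
    position, so the time integral F of this flux satisfies, for every bounded
    Lipschitz f,
      int F . grad f = (average of f over the last bump)
                       - (average of f over the first bump)
    (line_transport).  When l0 = 0 the first bump is a point mass.  Letting
    the starting point y be distributed according to a finite measure m on the
    boundary, with all bumps ending at the same ball (focus_pairing), gives a
    field whose divergence is m minus m(boundary) times a bump.
    At time t the bump is at most a multiple of t^-n; Hoelder's inequality with
    a suitable power of t puts F in L^p for every p < n / (n - 1) (flow_Lp).

    Trace.  Near a boundary point a Lipschitz domain satisfies a two-sided cone
    condition (boundary_cone): the bumps sent from y to a fixed point b inside
    stay in Omega, and those sent from y to a fixed point outside avoid the
    closure of Omega, at a distance from the boundary comparable to t.  Bring
    the mass from b to the boundary by the first family and take it away
    outside by the second.  The singular parts of the two divergences cancel,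
    so the sum has a bounded divergence, whereas on Omega alone only the first
    family is seen and its singular part m is the normal trace
    (chart_carries).  Only the bumps of times t <= K e meet the e-neighbourhood
    of the boundary, whence the integral of |F| over it is O(e m(boundary))
    (stream_tube).

    Globalisation.  Since Omega is connected, the masses left at the inner
    points b can be moved inside Omega to one common ball
    (linked_connected); since the boundary is compact, finitely many charts
    suffice (channel_boundary).  Applied to the two Jordan parts of sigma this
    leaves, on a neighbourhood of the closure of Omega, the divergence
    sigma(boundary) times a fixed bump, which vanishes when sigma has total
    mass zero.

    Test functions are only Lipschitz, hence differentiable almost everywhere
    in each coordinate (lip_partial_null); this is what makes the integration
    by parts lip_ibp and all the pairings above legitimate. *)

Set Implicit Arguments.
Unset Strict Implicit.
Unset Printing Implicit Defensive.

Import Order.TTheory GRing.Theory Num.Theory.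
Import numFieldNormedType.Exports.

Local Open Scope classical_set_scope.
Local Open Scope ring_scope.

(** * Affine changes of variables *)

(** The image measure, bundled so that it can be scaled and integrated against. *)
Definition push_measure d1 d2 (T1 : measurableType d1) (T2 : measurableType d2)
    (R : realType) (m : {measure set T1 -> \bar R}) (f : T1 -> T2)
    (mf : measurable_fun setT f) : {measure set T2 -> \bar R} :=
  measure_function_pushforward__canonical__measure_function_Measure m mf.

Lemma ae_sub d (T : measurableType d) (R : realType)
    (m : {measure set T -> \bar R}) (P Q : T -> Prop) :
  (forall x, P x -> Q x) -> {ae m, forall x, P x} -> {ae m, forall x, Q x}.
Proof. by move=> PQ; apply: negligibleS => x /=; apply: contra_not; exact: PQ. Qed.

Section AffineChange.
Context {R : realType}.
Local Notation leb := (@lebesgue_measure R).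

Lemma measurable_affine1 (a r : R) : measurable_fun setT (fun x : R => a + r * x).
Proof. by apply: measurable_funD => //; exact: measurable_funM. Qed.

(** Lebesgue measure is r times its image under the affine map: the two agree on
    half-open intervals. *)
Lemma ge0_lebesgue_affine (a r : R) (g : R -> \bar R) : 0 < r ->
  measurable_fun setT g -> (forall x, 0 <= g x)%E ->
  (\int[leb]_x g (a + r * x)%R = (r^-1)%:E * \int[leb]_x g x)%E.
Proof.
move=> r0 mg g0.
pose phi : measurableTypeR R -> measurableTypeR R := fun x => a + r * x.
have mphi : measurable_fun setT phi by exact: measurable_affine1.
pose m1 : {measure set (measurableTypeR R) -> \bar R} :=
  mscale (NngNum (ltW r0)) (push_measure leb mphi).
have E : forall A, measurable A -> leb A = m1 A.
  apply: lebesgue_measure_unique => _ [[x y] _ <-] /=.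
  rewrite [RHS](_ : _ = (r%:E * leb (phi @^-1` `]x, y]))%E)//.
  have -> : (phi @^-1` `]x, y] = `](x - a) / r, (y - a) / r])%classic.
    apply/seteqP; split => z /=; rewrite /phi !in_itv/= ltr_pdivrMr// ler_pdivlMr//;
      by rewrite ltrBlDr lerBrDr [z * r]mulrC ![_ + a]addrC.
  rewrite !lebesgue_measure_itv/= !lte_fin ltr_pM2r ?invr_gt0// ltrD2r.
  case: ifP => _; last by rewrite mule0.
  rewrite -!EFinB -EFinM; congr EFin; rewrite -mulrBl opprB addrA subrK.
  by rewrite mulrC divfK// gt_eqF.
rewrite [in RHS](eq_measure_integral m1); last by move=> A mA _; exact: E.
have mg' : @measurable_fun _ _ (measurableTypeR R) _ setT g by exact: mg.
transitivity (\int[pushforward leb phi]_x g x)%E.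
  rewrite (ge0_integral_pushforward mphi)//.
transitivity ((r^-1)%:E * (r%:E * \int[push_measure leb mphi]_x g x))%E.
  by rewrite muleA -EFinM mulVf ?gt_eqF// mul1e.
by congr (_ * _)%E; rewrite /m1 ge0_integral_mscale.
Qed.

Lemma ge0_integral_cons n (g : 'rV[R]_n.+1 -> \bar R) :
  measurable_fun setT g -> (forall x, 0 <= g x)%E ->
  (\int[lebesgueN n.+1]_x g x =
   \int[leb]_s \int[lebesgueN n]_v g (cons_rV (s, v)))%E.
Proof.
move=> mg g0.
have mc : measurable_fun [set: measurableTypeR R * 'rV[R]_n] (@cons_rV R n).
  exact: measurable_cons_rV.
transitivity (\int[pushforward (leb \x lebesgueN n) (@cons_rV R n)]_x g x)%E.
  by apply: eq_measure_integral.
rewrite (ge0_integral_pushforward mc)//.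
rewrite preimage_setT fubini_tonelli1//; first exact: measurableT_comp.
by move=> x; exact: g0.
Qed.

End AffineChange.

Section AffineN.
Context {R : realType}.
Local Notation leb := (@lebesgue_measure R).

Lemma rV_consP n (x y : 'rV[R]_n.+1) : x 0 0 = y 0 0 ->
  (forall j, x 0 (lift ord0 j) = y 0 (lift ord0 j)) -> x = y.
Proof.
move=> h t; apply/rowP => i; case: (unliftP 0 i) => [j ->|->]; first exact: t.
exact: h.
Qed.

Lemma lip_continuous (V W : normedModType R) (f : V -> W) (k : R) :
  (forall x y, `|f x - f y| <= k * `|x - y|) -> continuous f.
Proof.
move=> fk x; apply/(@cvgrPdist_lt _ W) => e e0.
have k1 : 0 < `|k| + 1 by rewrite ltr_wpDl.
near=> y.
rewrite (le_lt_trans (fk _ _))// (@le_lt_trans _ _ ((`|k| + 1) * `|x - y|))//.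
  by rewrite ler_wpM2r// (le_trans (ler_norm _))// lerDl.
rewrite -ltr_pdivlMl// mulrC.
near: y; apply: (@cvgr_dist_lt _ V); first exact: cvg_id.
by rewrite divr_gt0.
Unshelve. all: by end_near. Qed.

Lemma continuous_affine_rV n (c : 'rV[R]_n) (r : R) :
  continuous (fun x : 'rV[R]_n => c + r *: x).
Proof.
apply: (@lip_continuous _ _ _ `|r|) => x y.
by rewrite opprD addrACA subrr add0r -scalerBr normrZ.
Qed.

Lemma measurable_affine_rV n (c : 'rV[R]_n) (r : R) :
  measurable_fun setT (fun x : 'rV[R]_n => c + r *: x).
Proof. by apply: continuous_measurable_fun_rV; exact: continuous_affine_rV. Qed.

Lemma ge0_lebesgue_affineZ (a r k : R) (G : R -> \bar R) : 0 < r -> 0 <= k ->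
  measurable_fun setT G -> (forall x, 0 <= G x)%E ->
  (\int[leb]_x (k%:E * G (a + r * x)%R) = (r^-1 * k)%:E * \int[leb]_x G x)%E.
Proof.
move=> r0 k0 mG G0; rewrite ge0_integralZl//.
  by rewrite ge0_lebesgue_affine// muleA -EFinM mulrC.
by apply: (measurableT_comp mG); exact: measurable_affine1.
Qed.

(** Induction on the dimension: one coordinate contributes one factor 1 / r. *)
Lemma ge0_lebesgueN_affine n (c : 'rV[R]_n) (r : R) (g : 'rV[R]_n -> \bar R) :
  0 < r -> measurable_fun setT g -> (forall x, 0 <= g x)%E ->
  (\int[lebesgueN n]_x g (c + r *: x)%R =
   ((r ^+ n)^-1)%:E * \int[lebesgueN n]_x g x)%E.
Proof.
move=> r0; elim: n c g => [|n IH] c g mg g0.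
  rewrite expr0 invr1 mul1e; apply: eq_integral => x _; congr g.
  by apply/rowP => -[].
have maff := measurable_affine_rV c r.
rewrite !ge0_integral_cons//; last exact: measurableT_comp.
pose c' := \row_j c 0 (lift ord0 j).
have E s v : c + r *: cons_rV (s, v) = cons_rV (c 0 0 + r * s, c' + r *: v).
  by apply: rV_consP => [|j]; rewrite !(cons_rV_head, cons_rV_tail, mxE).
under eq_integral do under eq_integral do rewrite E.
have mg2 s : measurable_fun setT (fun v : 'rV[R]_n => g (cons_rV (s, v))).
  apply: (@measurableT_comp _ _ _ _ _ _ g) => //.
  apply: (measurableT_comp (@measurable_cons_rV R n)).
  exact: measurable_pair1.
under eq_integral do rewrite (IH c' (fun v => g (cons_rV (_, v))))//.
pose G s := (\int[lebesgueN n]_v g (cons_rV (s, v)))%E.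
have G0 s : (0 <= G s)%E by apply: integral_ge0.
have mG : measurable_fun setT G.
  apply: (@measurable_fun_fubini_tonelli_F _ _ _ _ R (lebesgueN n)
    (g \o @cons_rV R n)) => //.
    by apply: measurableT_comp => //; exact: measurable_cons_rV.
  by move=> x; exact: g0.
transitivity (\int[leb]_s ((r ^- n)%:E * G (c 0 0 + r * s)%R))%E; first by [].
rewrite ge0_lebesgue_affineZ//; last by rewrite invr_ge0 exprn_ge0// ltW.
by rewrite exprS invfM.
Qed.

End AffineN.

(** * Lipschitz functions on the line *)

Section Lip1.
Context {R : realType}.
Local Notation leb := (@lebesgue_measure R).

Lemma lebesgue_stieltjes_oc (f : cumulative R R) (a b : R) : a <= b ->
  lebesgue_stieltjes_measure f `]a, b]%classic = (f b - f a)%:E.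
Proof.
move=> ab; rewrite /lebesgue_stieltjes_measure /measure_extension/=.
rewrite measurable_mu_extE//; first exact: wlength_itv_bnd.
exact: is_ocitv.
Qed.

(** Both L x + f x and L x - f x are nondecreasing, and the sum of their
    Stieltjes measures is 2 L times Lebesgue measure.  Each of them is therefore
    absolutely continuous, and Radon-Nikodym yields the density of f. *)
Lemma lip1_density (f : R -> R) (L a b : R) : a < b ->
  (forall x y, `|f x - f y| <= L * `|x - y|) ->
  exists2 g : R -> R, leb.-integrable setT (EFin \o g) &
    forall x, a <= x <= b -> f x - f a = \int[leb]_(t in `]a, x]) g t.
Proof.
move=> ab fL0.
wlog L0 : L fL0 / 0 < L.
  move=> /(_ (`|L| + 1)); apply; last by rewrite ltr_wpDl.
  move=> x y; rewrite (le_trans (fL0 _ _))// ler_wpM2r//.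
  by rewrite (le_trans (ler_norm _))// lerDl.
have cf : continuous f := lip_continuous fL0.
have cL : continuous (fun x : R => L * x) by move=> x; exact: mulrl_continuous.
pose F1 x := L * x + f x; pose F2 x := L * x - f x.
have nd1 : nondecreasing F1.
  move=> x y xy; rewrite /F1 -subr_ge0.
  have := fL0 x y; rewrite distrC [`|x - y|]distrC [`|y - x|]ger0_norm ?subr_ge0//.
  by rewrite ler_norml => /andP[? ?]; lra.
have nd2 : nondecreasing F2.
  move=> x y xy; rewrite /F2 -subr_ge0.
  have := fL0 x y; rewrite distrC [`|x - y|]distrC [`|y - x|]ger0_norm ?subr_ge0//.
  by rewrite ler_norml => /andP[? ?]; lra.
have rc1 : right_continuous F1.
  by apply: right_continuousW => x; apply: cvgD; [exact: cL|exact: cf].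
have rc2 : right_continuous F2.
  by apply: right_continuousW => x; apply: cvgB; [exact: cL|exact: cf].
(* Stieltjes measures with m1 + m2 = 2 L times Lebesgue measure. *)
pose C1 : cumulative R R := HB.pack F1 (isCumulative.Build R _ R F1 nd1 rc1).
pose C2 : cumulative R R := HB.pack F2 (isCumulative.Build R _ R F2 nd2 rc2).
pose m1 := lebesgue_stieltjes_measure C1.
pose m2 := lebesgue_stieltjes_measure C2.
have L2 : 0 <= (2 * L)^-1 by rewrite invr_ge0 mulr_ge0// ltW.
pose m : {measure set (measurableTypeR R) -> \bar R} :=
  mscale (NngNum L2) (measure_add m1 m2).
have mvE A : m A = ((2 * L)^-1%:E * (m1 A + m2 A))%E.
  transitivity ((2 * L)^-1%:E * measure_add m1 m2 A)%E; first by [].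
  by rewrite measure_addE.
have mE A : measurable A -> leb A = m A.
  move: A; apply: lebesgue_measure_unique => _ [[x y] _ <-] /=.
  rewrite mvE.
  have [xy|yx] := leP x y.
    rewrite /m1 /m2 !lebesgue_stieltjes_oc// lebesgue_measure_itv/= lte_fin.
    rewrite /F1 /F2 -EFinD -EFinM; case: ltgtP xy => // [xy _|-> _]; last first.
      by congr EFin; rewrite !subrr addr0 mulr0.
    by congr EFin; field; rewrite gt_eqF.
  rewrite set_itv_ge ?bnd_simp -?leNgt ?(ltW yx)//.
  have -> : m1 set0 = 0%E by exact: measure0.
  have -> : m2 set0 = 0%E by exact: measure0.
  by rewrite adde0 mule0 measure0.
have mab : measurable (`]a, b]%classic : set (measurableTypeR R)) by exact: measurable_itv.
have m1ab : (m1 `]a, b]%classic < +oo)%E.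
  by rewrite /m1 lebesgue_stieltjes_oc ?ltry// ltW.
pose nu : {finite_measure set (measurableTypeR R) -> \bar R} := mfrestr mab m1ab.
have nuleb : charge_of_finite_measure nu `<< leb.
  apply/null_content_dominatesP => A mA.
  move=> lA0; have : leb A = 0%E by [].
  rewrite mE// mvE => /eqP; rewrite mule_eq0 => /orP[].
    by rewrite eqe invr_eq0 mulf_eq0 gt_eqF// gt_eqF.
  rewrite padde_eq0// => /andP[/eqP A0 _].
  have : (m1 (A `&` `]a, b]%classic) <= m1 A)%E.
    by apply: le_measure; rewrite ?inE//; exact: measurableI.
  rewrite A0 => le0; apply/eqP; rewrite eq_le [X in _ && X]measure_ge0 andbT.
  exact: le0.
have intRN := Radon_Nikodym_integrable nuleb.
pose g := Radon_Nikodym (charge_of_finite_measure nu) leb.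
pose g0 : R -> R := fine \o g.
have gE x : g x = (g0 x)%:E by rewrite /g0/= fineK// Radon_Nikodym_fin_num.
have ig0 : leb.-integrable setT (EFin \o g0).
  by apply: eq_integrable intRN => // x _; rewrite /= -gE.
(* F1 has density g0 on ]a, b], hence f has density g0 - L. *)
pose g1 : R -> R := (fun x => g0 x - L) \_ (`]a, b]%classic : set R).
have iab (h : R -> R) x : leb.-integrable setT (EFin \o h) ->
    leb.-integrable `]a, x] (EFin \o h).
  by move=> ih; apply: integrableS ih.
have icst x : leb.-integrable `]a, x] (EFin \o cst L).
  apply: measurable_bounded_integrable => //=; last exact: bounded_cst.
  rewrite lebesgue_measure_itv/=; case: ifP => _; by rewrite ?ltry// -EFinB ltry.
have ig1 : leb.-integrable setT (EFin \o g1).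
  rewrite /g1 -restrict_EFin; apply/(integrable_mkcond _ _).1 => //.
  rewrite (_ : _ \o _ = (EFin \o g0) \- (EFin \o cst L))%E//.
  by apply: integrableB => //; exact: iab.
exists g1 => // x /andP[ax xb].
transitivity (\int[leb]_(t in `]a, x]) (g0 t - L)).
  rewrite RintegralB//; do ?[exact: iab|exact: icst].
  rewrite Rintegral_cst//= lebesgue_measure_itv/=.
  have -> : \int[leb]_(t in `]a, x]) g0 t = F1 x - F1 a.
    rewrite /Rintegral.
    under eq_integral do rewrite -gE.
    rewrite -Radon_Nikodym_integral//=.
    rewrite /charge_of_finite_measure /nu/= /mfrestr/= /mrestr setIidl.
      by rewrite /m1 lebesgue_stieltjes_oc.
    by apply: subset_itvl; rewrite bnd_simp.
  rewrite lte_fin; case: ltgtP ax => // [ax _|<- _]; last by rewrite !subrr mulr0 subrr.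
  by rewrite -EFinB/= /F1; ring.
apply: eq_Rintegral => t; rewrite inE/= in_itv/= => /andP[ta tx].
by rewrite /g1 patchE mem_set//= in_itv/= ta (le_trans tx).
Qed.

(** Lebesgue differentiation applied to the density of f. *)
Lemma lip1_ae_density (f : R -> R) (L a b : R) : a < b ->
  (forall x y, `|f x - f y| <= L * `|x - y|) ->
  exists g : R -> R, [/\ leb.-integrable setT (EFin \o g),
    f b - f a = \int[leb]_(t in `]a, b]) g t &
    {ae leb, forall x, x \in `]a, b[ -> derivable f x 1 /\ 'D_1 f x = g x}].
Proof.
move=> ab fL; have [g ig fg] := lip1_density ab fL.
exists g; split => //; first by apply: fg; rewrite (ltW ab) lexx.
have locg : locally_integrable setT g.
  by apply: open_integrable_locally => //; exact: openT.
have := lebesgue_differentiation locg.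
apply: ae_sub.
move=> x gx; rewrite in_itv/= => /andP[ax xb].
have ig' : leb.-integrable [set` Interval (BRight a) (BRight b)] (EFin \o g).
  by apply: integrableS ig.
have [dF F'] := FTC1_lebesgue_pt xb ig' (ax : (BRight a < BRight x)%O) gx.
set F := (fun y => _) in dF F'.
have nfF : \forall y \near x, f a + F y = f y.
  have := near_in_itvoo (x := x) (a := a) (b := b).
  rewrite in_itv/= ax xb => /(_ isT); apply: filterS => y.
  rewrite in_itv/= => /andP[ay yb].
  by rewrite /F -fg ?(ltW ay) ?(ltW yb)// addrC subrK.
have dF' : is_derive x 1 (fun y => f a + F y) (g x).
  rewrite -F' derive1E -[X in is_derive _ _ _ X]add0r.
  exact: is_deriveD.
have dff : is_derive x 1 f (g x) by apply: near_eq_is_derive dF'; rewrite ?oner_eq0.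
by split; [exact: ex_derive|rewrite derive_val].
Qed.

Lemma lip1_ae_derivable (f : R -> R) (L : R) :
  (forall x y, `|f x - f y| <= L * `|x - y|) ->
  {ae leb, forall x, derivable f x 1}.
Proof.
move=> fL.
have H (N : nat) : {ae leb, forall x, x \in `](- N.+1%:R : R), N.+1%:R[ -> derivable f x 1}.
  have N0 : - N.+1%:R < N.+1%:R :> R by rewrite gtrN.
  have [g [_ _]] := lip1_ae_density N0 fL.
  by apply: ae_sub => x /[apply] -[].
have := negligible_bigcup H; apply: negligibleS => x /= fx.
near \oo => N; exists N => // xN; apply: fx; apply: xN.
rewrite in_itv/= -ltr_norml.
near: N.
exists (Num.truncn `|x|) => // k /= kx; rewrite (lt_le_trans (truncnS_gt _))//.
by rewrite ler_nat.
Unshelve. all: by end_near. Qed.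

(** A derivative given at every point of the open interval coincides almost
    everywhere with the density of f. *)
Lemma lip1_FTC (f h : R -> R) (L : R) :
  (forall x y, `|f x - f y| <= L * `|x - y|) ->
  (forall x : R, 0 < x < 1 -> is_derive x 1 f (h x)) ->
  f 1 - f 0 = \int[leb]_(t in `]0, 1[) h t.
Proof.
move=> fL fh.
have cf : continuous f := lip_continuous fL.
have mh : measurable_fun (`]0, 1[%classic : set R) h.
  apply: (@measurable_fun_cvg _ _ _ _ (fun (k : nat) (x : R) => k.+1%:R * (f (k.+1%:R^-1 + x) - f x))).
    move=> k; apply: measurable_funM => //; apply: measurable_funTS.
    apply: measurable_funB.
      by apply: (measurableT_comp (continuous_measurable_fun cf)); exact: measurable_funD.
    exact: continuous_measurable_fun.
  move=> x /=; rewrite in_itv/= => /fh dfx.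
  have /cvgr_dnbhsP/(_ (fun k => k.+1%:R^-1)) := @ex_derive _ _ _ _ _ _ _ dfx.
  rewrite -/('D_1 f x) derive_val => /(_ (conj _ (@cvg_harmonic R))) H.
  have {}H := H (fun k => invr_neq0 (lt0r_neq0 (ltr0Sn R k))).
  move: H; under eq_fun do rewrite invrK [_ *: 1]mulr1.
  by [].
have [g [ig -> gae]] := lip1_ae_density ltr01 fL.
rewrite -Rintegral_itv_bndo_bndc; last by apply: integrableS ig.
rewrite /Rintegral; congr fine; apply: ae_eq_integral => //.
- by have /integrableP[mg _] := ig; apply: measurable_funS mg.
- exact/measurable_EFinP.
- apply: ae_sub gae => x gx /= x01; congr EFin.
  have [_ <-] := gx x01.
  by have /fh ? : 0 < x < 1 by []; rewrite derive_val.
Qed.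

End Lip1.

(** * Partial derivatives of Lipschitz functions *)

Section Norms.
Context {R : realType}.

Lemma norm_rV_le n (x : 'rV[R]_n) (e : R) : 0 <= e ->
  (`|x| <= e) = [forall i, `|x 0 i| <= e].
Proof.
move=> e0; apply/idP/forallP => [xe i|H].
  apply: le_trans xe; rewrite [`|x|]mx_normrE.
  by rewrite (le_bigmax _ (fun i : 'I_1 * 'I_n => `|x i.1 i.2|) (0, i)).
rewrite [`|x|]mx_normrE; apply: bigmax_le => // -[i j] _ /=; rewrite ord1; exact: H.
Qed.

Lemma norm_coord_rV n (x : 'rV[R]_n) i : `|x 0 i| <= `|x|.
Proof.
by have := lexx `|x|; rewrite norm_rV_le// => /forallP.
Qed.

Lemma norm_delta_rV n (i : 'I_n) : `|delta_mx 0 i : 'rV[R]_n| <= 1.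
Proof.
rewrite norm_rV_le//; apply/forallP => j; rewrite mxE eqxx/=.
by case: (j == i); rewrite ?normr1 ?normr0.
Qed.

End Norms.

Section Dyadic.
Context {R : realType}.

(** Off the origin phi is continuous, so the Cauchy criterion for its limit at 0
    needs to be tested at rational steps only.  The countability of these tests
    is what makes the set of differentiability points measurable. *)
Lemma cvg_dnbhs0_ratP (phi : R -> R) :
  (forall h, h != 0 -> {for h, continuous phi}) ->
  cvg (phi @ 0^') <-> forall m : nat, exists k : nat, forall p q : rat,
    0 < `|ratr p : R| < k.+1%:R^-1 -> 0 < `|ratr q : R| < k.+1%:R^-1 ->
    `|phi (ratr p) - phi (ratr q)| <= m.+1%:R^-1.
Proof.
move=> cphi; split=> [/cvg_ex[l phil] m|H].
  have m0 : 0 < (m.+1%:R^-1 / 2 : R) by rewrite divr_gt0// invr_gt0.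
  move/cvgrPdist_le : phil => /(_ _ m0).
  rewrite near_withinE => /nbhs_ballP[e /= e0 He].
  have [k _ /(_ k (leqnn k)) ke] := near_infty_natSinv_lt (PosNum e0).
  exists k => p q /andP[p0 pk] /andP[q0 qk].
  have A r : 0 < `|r| -> `|r| < k.+1%:R^-1 -> `|l - phi r| <= m.+1%:R^-1 / 2.
    move=> r0 rk; apply: He; last by rewrite -normr_gt0.
    by rewrite /ball/= sub0r normrN (lt_trans rk).
  rewrite (le_trans (ler_distD l _ _))// [leRHS]splitr lerD ?A//.
  by rewrite distrC A.
apply/cauchy_cvgP/cauchy_exP => e e0.
have [m _ /(_ m (leqnn m)) me] := near_infty_natSinv_lt (PosNum e0).
have [k Hk] := H m.
have k0 : 0 < k.+1%:R^-1 :> R by rewrite invr_gt0.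
have [p] := @rat_in_itvoo R _ _ k0.
rewrite in_itv/= => /andP[p0 pk].
exists (phi (ratr p)).
suff: \forall h \near 0^', `|phi (ratr p) - phi h| < e by [].
rewrite near_withinE; apply/nbhs_ballP; exists k.+1%:R^-1 => //= h hk h0.
rewrite /ball/= sub0r normrN in hk.
apply: (@le_lt_trans _ _ m.+1%:R^-1) => //.
apply/ler_addgt0Pr => d d0.
have := cphi h h0 => /cvgrPdist_lt/(_ _ d0).
have hpos : \forall r \near h, 0 < `|r| < k.+1%:R^-1.
  near=> r; apply/andP; split.
    near: r; apply: (@cvgr_norm_gt _ _ _ (nbhs h) _ id h cvg_id).
    by rewrite normr_gt0.
  near: r; exact: (@cvgr_norm_lt _ _ _ (nbhs h) _ id h cvg_id).
move=> /(filterI hpos) /nbhs_ballP[r /= r0 Hr].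
have [q] := @rat_in_itvoo R (h - r) (h + r) ltac:(by rewrite ltrD2l gt0_cp).
rewrite in_itv/= => qr.
have [q0 hq] := Hr (ratr q) ltac:(by rewrite /ball/= ltr_distlC).
rewrite (le_trans (ler_distD (phi (ratr q)) _ _))// lerD//.
  by apply: Hk => //; rewrite gtr0_norm// p0.
by rewrite distrC ltW.
Unshelve. all: by end_near. Qed.

End Dyadic.

Section Partial.
Context {R : realType}.

(** The increment is written on the left of x so that the limit of these
    quotients is convertible to the directional derivative. *)
Definition diff_quot n (i : 'I_n) (f : 'rV[R]_n -> R) (h : R) (x : 'rV[R]_n) : R :=
  h^-1 * (f (h *: delta_mx 0 i + x) - f x).

Lemma diff_quot_lip n (i : 'I_n) (f : 'rV[R]_n -> R) (L h : R) (x : 'rV[R]_n) :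
  0 <= L -> (forall x y, `|f x - f y| <= L * `|x - y|) -> `|diff_quot i f h x| <= L.
Proof.
move=> L0 fL; rewrite /diff_quot normrM normfV.
have [->|h0] := eqVneq h 0; first by rewrite normr0 invr0 mul0r.
rewrite ler_pdivrMl ?normr_gt0// (le_trans (fL _ _))// addrK normrZ mulrCA.
by rewrite ler_wpM2l// -[leRHS]mulr1 ler_wpM2l// norm_delta_rV.
Qed.

Lemma diff_quot_cvgE n (i : 'I_n) (f : 'rV[R]_n -> R) x :
  derivable f x (delta_mx 0 i) = cvg ((diff_quot i f)^~ x @ 0^').
Proof. by []. Qed.

Lemma partialE n (i : 'I_n) (f : 'rV[R]_n -> R) x :
  partial i f x = lim ((diff_quot i f)^~ x @ 0^').
Proof. by []. Qed.

Section meas.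
Variables (n : nat) (i : 'I_n) (f : 'rV[R]_n -> R).
Hypothesis cf : continuous f.

Lemma continuous_diff_quotl h : continuous (diff_quot i f h).
Proof.
rewrite /diff_quot => x; have H := (@continuousM R 'rV[R]_n (cst h^-1) (fun x => f (h *: delta_mx 0 i + x) - f x) x); apply: H; first exact: cst_continuous.
apply: continuousB; last exact: cf.
apply: (@continuous_comp _ _ _ (fun x => h *: delta_mx 0 i + x) f); last exact: cf.
apply: (@lip_continuous _ _ _ _ 1) => y z.
by rewrite opprD addrACA subrr add0r mul1r.
Qed.

Lemma measurable_diff_quot h : measurable_fun setT (diff_quot i f h).
Proof. exact: (Defs.continuous_measurable_fun (@continuous_diff_quotl h)). Qed.

Lemma continuous_diff_quotr x h : h != 0 -> {for h, continuous ((diff_quot i f)^~ x)}.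
Proof.
rewrite /diff_quot => h0; have H := (@continuousM R R (fun h => h^-1)
  (fun h => f (h *: delta_mx 0 i + x) - f x) h).
apply: H; first exact: (@inv_continuous R h).
apply: continuousB; last exact: cst_continuous.
have H' := (@continuous_comp R 'rV[R]_n R (fun h => h *: delta_mx 0 i + x) f h).
apply: H'; last exact: cf.
apply: (@lip_continuous _ _ _ _ `|delta_mx 0 i : 'rV[R]_n|) => y z.
by rewrite opprD addrACA subrr addr0 -scalerBl normrZ mulrC.
Qed.

Definition diff_set := [set x | derivable f x (delta_mx 0 i)].

Lemma measurable_diff_set : measurable diff_set.
Proof.
pose P k (p : rat) := 0 < `|ratr p : R| < k.+1%:R^-1.
pose S m (k : nat) (p q : rat) : set 'rV[R]_n :=
  [set x | P k p -> P k q -> `|diff_quot i f (ratr p) x - diff_quot i f (ratr q) x| <= m.+1%:R^-1].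
have -> : diff_set = \bigcap_m \bigcup_k \bigcap_p \bigcap_q S m k p q.
  apply/seteqP; split => x.
    rewrite /diff_set/= diff_quot_cvgE cvg_dnbhs0_ratP; last exact: continuous_diff_quotr.
    by move=> H m _; have [k Hk] := H m; exists k => // p _ q _; exact: Hk.
  move=> H; rewrite /diff_set/= diff_quot_cvgE cvg_dnbhs0_ratP; last exact: continuous_diff_quotr.
  by move=> m; have [k _ Hk] := H m I; exists k => p q; exact: Hk.
have mS m k p q : measurable (S m k p q).
  case: (pselect (P k p /\ P k q)) => [[Pp Pq]|nP]; last first.
    rewrite (_ : S m k p q = setT)//; apply/seteqP; split => // x _ Pp Pq.
    by exfalso; apply: nP.
  rewrite (_ : S m k p q = (fun x => diff_quot i f (ratr p) x - diff_quot i f (ratr q) x) @^-1`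
      [set y | `|y| <= m.+1%:R^-1]); last first.
    by apply/seteqP; split => x /=; [apply|move=> H _ _].
  rewrite -[X in measurable X]setTI.
  have : measurable_fun setT (fun x => diff_quot i f (ratr p) x - diff_quot i f (ratr q) x).
    by apply: measurable_funB; exact: measurable_diff_quot.
  apply => //.
  rewrite (_ : [set _ | _] = `[- m.+1%:R^-1, m.+1%:R^-1]%classic); last first.
    by apply/seteqP; split => y /=; rewrite in_itv/= ler_norml.
  exact: measurable_itv.
apply: bigcapT_measurable => m; apply: bigcupT_measurable => k.
have mcap (F : rat -> set 'rV[R]_n) :
    (forall p, measurable (F p)) -> measurable (\bigcap_p F p).
  move=> mF; rewrite -[X in measurable X]setCK setC_bigcap.
  apply: measurableC; apply: countable_bigcupT_measurable => [|p].
    exact: countableP.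
  exact: measurableC.
by apply: (mcap) => p; apply: (mcap).
Qed.

(** Where the limit exists it is a limit of continuous difference quotients;
    elsewhere the value is the constant default of lim. *)
Lemma measurable_partial : measurable_fun setT (partial i f).
Proof.
pose u (k : nat) x := diff_quot i f k.+1%:R^-1 x * \1_diff_set x + (point : R) * (1 - \1_diff_set x).
apply: (@measurable_fun_cvg _ _ _ _ u).
  move=> k; apply: measurable_funD; apply: measurable_funM => //.
  - exact: measurable_diff_quot.
  - by apply: measurable_indic; exact: measurable_diff_set.
  - by apply: measurable_funB => //; apply: measurable_indic; exact: measurable_diff_set.
move=> x _; rewrite /u indicE; case: (boolP (x \in diff_set)) => [|nx].
  rewrite inE /diff_set/= => dx.
  under eq_fun do rewrite mulr1 subrr mulr0 addr0.
  move: dx; rewrite diff_quot_cvgE => /cvgr_dnbhsP; rewrite -/(partial i f x).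
  by apply; split => [k|]; [rewrite invr_eq0|exact: cvg_harmonic].
under eq_fun do rewrite mulr0 add0r subr0 mulr1.
have -> : partial i f x = (point : R).
  by rewrite partialE; apply: dvgP => c; move: nx; rewrite notin_setE; apply.
exact: cvg_cst.
Qed.

End meas.
End Partial.

Section AePartial.
Context {R : realType}.
Local Notation leb := (@lebesgue_measure R).

(** Tonelli: the head coordinate may also be integrated first. *)
Lemma ge0_integral_cons_swap n (g : 'rV[R]_n.+1 -> \bar R) :
  measurable_fun setT g -> (forall x, 0 <= g x)%E ->
  (\int[lebesgueN n.+1]_x g x =
   \int[lebesgueN n]_v \int[leb]_s g (cons_rV (s, v)))%E.
Proof.
move=> mg g0; rewrite ge0_integral_cons//.
have mc : measurable_fun [set: measurableTypeR R * 'rV[R]_n] (@cons_rV R n).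
  exact: measurable_cons_rV.
pose G : measurableTypeR R * 'rV[R]_n -> \bar R := g \o @cons_rV R n.
have mG : measurable_fun setT G by exact: measurableT_comp.
have G0 x : (0 <= G x)%E by exact: g0.
exact: (@fubini_tonelli _ _ _ _ R leb (lebesgueN n) G mG G0).
Qed.

Lemma shift_tail n (j : 'I_n) (h s : R) (v : 'rV[R]_n) :
  h *: delta_mx 0 (lift ord0 j) + cons_rV (s, v) =
  cons_rV (s, h *: delta_mx 0 j + v).
Proof.
apply: rV_consP => [|k].
  by rewrite mxE !cons_rV_head !mxE/= mulr0 add0r.
by rewrite mxE !cons_rV_tail !mxE/= (inj_eq lift_inj).
Qed.

Lemma shift_head n (h s : R) (v : 'rV[R]_n) :
  h *: delta_mx 0 0 + cons_rV (s, v) = cons_rV (h + s, v).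
Proof.
apply: rV_consP => [|k].
  by rewrite mxE !cons_rV_head !mxE/= mulr1.
by rewrite mxE !cons_rV_tail !mxE/= mulr0 add0r.
Qed.

Lemma norm_cons_tail n (s : R) (v w : 'rV[R]_n) :
  `|cons_rV (s, v) - cons_rV (s, w)| <= `|v - w|.
Proof.
rewrite norm_rV_le//; apply/forallP => i; case: (unliftP 0 i) => [j ->|->].
  by rewrite mxE [X in _ + X]mxE !cons_rV_tail; have := norm_coord_rV (v - w) j; rewrite mxE [X in _ + X]mxE.
by rewrite mxE [X in _ + X]mxE !cons_rV_head subrr normr0.
Qed.

Lemma norm_cons_head n (s t : R) (v : 'rV[R]_n) :
  `|cons_rV (s, v) - cons_rV (t, v)| <= `|s - t|.
Proof.
rewrite norm_rV_le//; apply/forallP => i; case: (unliftP 0 i) => [j ->|->].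
  by rewrite mxE [X in _ + X]mxE !cons_rV_tail subrr normr0.
by rewrite mxE [X in _ + X]mxE !cons_rV_head.
Qed.

Lemma measurable_cons2 n (s : R) : measurable_fun setT (fun v : 'rV[R]_n => cons_rV (s, v)).
Proof.
by apply: (measurableT_comp (@measurable_cons_rV R n)); exact: measurable_pair1.
Qed.

Lemma measurable_cons1 n (v : 'rV[R]_n) : measurable_fun setT (fun s : R => cons_rV (s, v)).
Proof.
by apply: (measurableT_comp (@measurable_cons_rV R n)); exact: measurable_pair2.
Qed.

Lemma lebesgueN_null_tail n (A : set 'rV[R]_n.+1) : measurable A ->
  (forall s, lebesgueN n [set v | A (cons_rV (s, v))] = 0%E) ->
  lebesgueN n.+1 A = 0%E.
Proof.
move=> mA A0; rewrite -[A]setIT -integral_indic// ge0_integral_cons; last 2 first.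
- by apply/measurable_EFinP; exact: measurable_indic.
- by move=> x; rewrite lee_fin.
apply: integral0_eq => s _.
rewrite -[RHS](A0 s) -[X in _ = lebesgueN n X]setIT -integral_indic//.
  by rewrite -[X in measurable X]setTI; exact: measurable_cons2.
Qed.

Lemma lebesgueN_null_head n (A : set 'rV[R]_n.+1) : measurable A ->
  (forall v, leb [set s | A (cons_rV (s, v))] = 0%E) ->
  lebesgueN n.+1 A = 0%E.
Proof.
move=> mA A0; rewrite -[A]setIT -integral_indic// ge0_integral_cons_swap; last 2 first.
- by apply/measurable_EFinP; exact: measurable_indic.
- by move=> x; rewrite lee_fin.
apply: integral0_eq => v _.
rewrite -[RHS](A0 v) -[X in _ = leb X]setIT -integral_indic//.
  rewrite -[X in measurable X]setTI; exact: (measurable_cons1 v).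
Qed.

(** Fubini reduces the claim to lines in direction i, where a Lipschitz function
    of one variable is differentiable almost everywhere. *)
Lemma lip_partial_null n (i : 'I_n) (f : 'rV[R]_n -> R) (L : R) : 0 <= L ->
  (forall x y, `|f x - f y| <= L * `|x - y|) ->
  lebesgueN n (~` diff_set i f) = 0%E.
Proof.
move=> L0; elim: n i f => [[]//|n IH] i f fL.
have cf := lip_continuous fL.
have mD : measurable (~` diff_set i f) by apply: measurableC; exact: measurable_diff_set.
case: (unliftP 0 i) mD => [j ->|->] mD.
  apply: lebesgueN_null_tail => // s.
  rewrite -(IH j (fun v => f (cons_rV (s, v)))); last first.
    by move=> v w; rewrite (le_trans (fL _ _))// ler_wpM2l// norm_cons_tail.
  congr (_ _); apply/seteqP; split => v; rewrite /diff_set/= !diff_quot_cvgE;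
    suff -> : (diff_quot (lift ord0 j) f)^~ (cons_rV (s, v)) =
      (diff_quot j (fun v => f (cons_rV (s, v))))^~ v by [];
    by apply/funext => h; rewrite /diff_quot shift_tail.
apply: lebesgueN_null_head => // v.
have /lip1_ae_derivable [N [mN N0 subN]] : forall s t,
    `|f (cons_rV (s, v)) - f (cons_rV (t, v))| <= L * `|s - t|.
  by move=> s t; rewrite (le_trans (fL _ _))// ler_wpM2l// norm_cons_head.
have mS : measurable [set s | (~` diff_set ord0 f) (cons_rV (s, v))].
  rewrite -[X in measurable X]setTI; exact: (measurable_cons1 v).
have mS' : measurable ([set s | (~` diff_set ord0 f) (cons_rV (s, v))] :
    set (measurableTypeR R)) by exact: mS.
have sub0 := subset_measure0 mS' mN _ N0.
apply: sub0; apply: subset_trans subN => s /=; rewrite /diff_set/= diff_quot_cvgE.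
apply: contra_not; rewrite /derivable.
suff -> : (diff_quot 0 f)^~ (cons_rV (s, v)) =
  (fun h => h^-1 *: (f (cons_rV (h *: 1 + s, v)) - f (cons_rV (s, v)))) by [].
by apply/funext => h; rewrite /diff_quot shift_head [h *: 1]mulr1.
Qed.

End AePartial.

(** * Dominated convergence and boundedly supported functions *)

Section RDCT.
Context d (T : measurableType d) (R : realType) (mu : {measure set T -> \bar R}).

Lemma Rdominated_convergence (D : set T) (f_ : nat -> T -> R) (f g : T -> R) :
  measurable D -> (forall n, measurable_fun D (f_ n)) -> measurable_fun D f ->
  {ae mu, forall x, D x -> f_ n x @[n --> \oo] --> f x} ->
  mu.-integrable D (EFin \o g) ->
  (forall n x, D x -> `|f_ n x| <= g x) ->
  mu.-integrable D (EFin \o f) /\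
  \int[mu]_(x in D) f_ n x @[n --> \oo] --> \int[mu]_(x in D) f x.
Proof.
move=> mD mf_ mf f_f ig f_g.
have [|||||if_ _ cf] := @dominated_convergence _ _ _ mu D mD
    (fun n x => (f_ n x)%:E) (EFin \o f) (EFin \o g).
- by move=> n; apply/measurable_EFinP.
- exact/measurable_EFinP.
- apply: ae_sub f_f => x fx Dx; apply/fine_cvgP; split; first exact: nearW.
  exact: fx.
- exact: ig.
- by apply: aeW => x n Dx; rewrite lee_fin; exact: f_g.
split => //; apply/fine_cvg; rewrite fineK//.
exact: integrable_fin_num.
Qed.

Lemma RintegrableB D (f g : T -> R) : measurable D ->
  mu.-integrable D (EFin \o f) -> mu.-integrable D (EFin \o g) ->
  mu.-integrable D (EFin \o (fun x => f x - g x)).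
Proof.
by move=> mD fi gi; apply: eq_integrable (integrableB mD fi gi) => //.
Qed.

Lemma RintegrableD D (f g : T -> R) : measurable D ->
  mu.-integrable D (EFin \o f) -> mu.-integrable D (EFin \o g) ->
  mu.-integrable D (EFin \o (fun x => f x + g x)).
Proof.
by move=> mD fi gi; apply: eq_integrable (integrableD mD fi gi) => //.
Qed.

Lemma RintegrableZ D (k : R) (f : T -> R) : measurable D ->
  mu.-integrable D (EFin \o f) -> mu.-integrable D (EFin \o (fun x => k * f x)).
Proof.
by move=> mD fi; apply: eq_integrable (integrableZl mD k fi) => //.
Qed.

End RDCT.

Section AffineR.
Context {R : realType}.

Lemma lebesgueN_cube_lty n (r : R) :
  (lebesgueN n [set x : 'rV[R]_n | (`|x| <= r)%R] < +oo)%E.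
Proof.
have [r0|r0] := ltP r 0.
  have -> : [set x : 'rV[R]_n | `|x| <= r] = set0; last by rewrite measure0 ltry.
  apply/seteqP; split => // x /= xr.
  by have := le_lt_trans xr r0; rewrite normr_lt0.
have -> : [set x : 'rV[R]_n | `|x| <= r] =
    [set v | forall i, `[- r, r]%classic (v 0 i)].
  apply/seteqP; split => x /=.
    by rewrite norm_rV_le// => /forallP H i; rewrite in_itv/= -ler_norml.
  move=> H; rewrite norm_rV_le//; apply/forallP => i.
  by have := H i; rewrite in_itv/= -ler_norml.
rewrite (@lebesgueN_box R n (fun=> `[- r, r]%classic)); last by move=> i; exact: measurable_itv.
rewrite ltey_eq; apply/orP; left.
elim/big_ind : _ => [//|x y x0 y0|i _]; first exact: fin_numM.
by rewrite lebesgue_measure_itv/=; case: ifP => _; rewrite -?EFinB.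
Qed.

Lemma measurable_cube n (r : R) : measurable [set x : 'rV[R]_n | `|x| <= r].
Proof.
have -> : [set x : 'rV[R]_n | `|x| <= r] = (fun x : 'rV[R]_n => `|x|) @^-1` `[0, r]%classic.
  by apply/seteqP; split => x /=; rewrite in_itv/= normr_ge0.
rewrite -[X in measurable X]setTI.
have : measurable_fun setT (fun x : 'rV[R]_n => `|x|).
  by apply: Defs.continuous_measurable_fun => x; exact: norm_continuous.
by apply => //; exact: measurable_itv.
Qed.

Lemma bounded_supp_integrable n (g : 'rV[R]_n -> R) (M r : R) :
  measurable_fun setT g -> (forall x, `|g x| <= M) ->
  (forall x, r < `|x| -> g x = 0) ->
  (lebesgueN n).-integrable setT (EFin \o g).
Proof.
move=> mg gM gr.
have mC := @measurable_cube n r.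
have -> : g = g \_ [set x : 'rV[R]_n | `|x| <= r].
  apply/funext => x; rewrite patchE; case: ifPn => //.
  by rewrite notin_setE/= => /negP; rewrite -ltNge => /gr.
rewrite -restrict_EFin; apply/(integrable_mkcond _ _).1 => //.
apply: measurable_bounded_integrable => //.
- exact: lebesgueN_cube_lty.
- exact: measurable_funS mg.
- exists M; split => [|N MN x _]; first exact: num_real.
  by rewrite /= (le_trans (gM x))// ltW.
Qed.

Lemma Rintegral_lebesgueN_affine n (c : 'rV[R]_n) (r : R) (g : 'rV[R]_n -> R) :
  0 < r -> (lebesgueN n).-integrable setT (EFin \o g) ->
  (lebesgueN n).-integrable setT (EFin \o (fun x : 'rV[R]_n => g (c + r *: x))) /\
  \int[lebesgueN n]_x g (c + r *: x) = (r ^+ n)^-1 * \int[lebesgueN n]_x g x.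
Proof.
move=> r0 /integrableP[mg ig].
have mga : measurable_fun setT (fun x : 'rV[R]_n => (g (c + r *: x))%:E).
  exact: (measurableT_comp mg (measurable_affine_rV c r)).
have iga : (lebesgueN n).-integrable setT (EFin \o (fun x : 'rV[R]_n => g (c + r *: x))).
  apply/integrableP; split => //=.
  rewrite (ge0_lebesgueN_affine c r0 (g := fun x : 'rV[R]_n => `|(g x)%:E|%E))//; last exact: measurableT_comp.
  by rewrite lte_mul_pinfty// lee_fin invr_ge0 exprn_ge0// ltW.
split => //; rewrite /Rintegral integralE [in RHS]integralE.
have mp : measurable_fun setT ((EFin \o g)^\+)%E by exact: measurable_funepos.
have mn : measurable_fun setT ((EFin \o g)^\-)%E by exact: measurable_funeneg.
have := @ge0_lebesgueN_affine R n c r ((EFin \o g)^\+)%E r0 mp (fun x => funepos_ge0 _ _).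
have := @ge0_lebesgueN_affine R n c r ((EFin \o g)^\-)%E r0 mn (fun x => funeneg_ge0 _ _).
have igi : (lebesgueN n).-integrable setT (EFin \o g) by apply/integrableP.
have pf := integrable_pos_fin_num measurableT igi.
have nf := integrable_neg_fin_num measurableT igi.
rewrite -(fineK pf) -(fineK nf).
set A := fine (integral _ _ _); set B := fine (integral _ _ _).
move=> E1 E2.
transitivity (fine ((r ^- n * B)%:E - (r ^- n * A)%:E)%E).
  by rewrite !EFinM -E1 -E2; congr (fine (_ - _)%E); apply: eq_integral => x _; rewrite ?funeposE ?funenegE.
by rewrite -!EFinB/= mulrBr.
Qed.

End AffineR.

(** * Integration by parts against a Lipschitz function *)

Section Ibp.
Context {R : realType}.
Variables (n : nat) (i : 'I_n).
Local Notation mu := (@lebesgueN R n).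

Lemma cvg_integral_diff_quot (u w W : 'rV[R]_n -> R) (L : R) (h : nat -> R) :
  0 <= L -> (forall x y, `|u x - u y| <= L * `|x - y|) ->
  measurable_fun setT w -> mu.-integrable setT (EFin \o W) ->
  (forall k, h k != 0) -> h k @[k --> \oo] --> 0 ->
  (forall k x, `|diff_quot i u (h k) x * w x| <= W x) ->
  mu.-integrable setT (EFin \o (fun x => partial i u x * w x)) /\
  \int[mu]_x (diff_quot i u (h k) x * w x) @[k --> \oo] -->
  \int[mu]_x (partial i u x * w x).
Proof.
move=> L0 uL mw iW h0 hc hW; have cu := lip_continuous uL.
apply: (@Rdominated_convergence _ _ _ mu setT
  (fun k x => diff_quot i u (h k) x * w x) _ W) => //.
- by move=> k; apply: measurable_funM => //; exact: measurable_diff_quot.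
- by apply: measurable_funM => //; exact: measurable_partial.
- exists (~` diff_set i u); split.
  + by apply: measurableC; exact: measurable_diff_set.
  + exact: (lip_partial_null i L0 uL).
  + move=> x /=; apply: contra_not; rewrite /diff_set/= diff_quot_cvgE => dx _.
    apply: cvgMl.
    by move: dx => /cvgr_dnbhsP; apply; split.
Qed.

(** Discrete integration by parts: translation invariance moves the increment
    from f to G and reverses its sign. *)
Lemma integral_diff_quotM (f G : 'rV[R]_n -> R) (B M r h : R) :
  measurable_fun setT f -> (forall x, `|f x| <= B) ->
  continuous G -> (forall x, `|G x| <= M) -> (forall x, r < `|x| -> G x = 0) ->
  continuous f ->
  \int[mu]_x (diff_quot i f h x * G x) = - \int[mu]_x (diff_quot i G (- h) x * f x).
Proof.
move=> mf fB cG GM Gr cf.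
have mG := Defs.continuous_measurable_fun cG.
have B0 : 0 <= B by rewrite (le_trans _ (fB 0)).
have Gi (c : 'rV[R]_n) : mu.-integrable setT (EFin \o (fun x => f (c + x) * G x)).
  apply: (@bounded_supp_integrable _ _ _ (B * M) r).
  - apply: measurable_funM => //.
    by have := (measurableT_comp mf (measurable_affine_rV c 1)); under eq_fun do rewrite /= scale1r.
  - by move=> x; rewrite normrM ler_pM.
  - by move=> x /Gr ->; rewrite mulr0.
pose e : 'rV[R]_n := h *: delta_mx 0 i.
have [] := Rintegral_lebesgueN_affine (- e) (ltr01 : 0 < 1 :> R) (Gi e).
have -> : (fun x : 'rV[R]_n => f (e + (- e + 1 *: x)) * G (- e + 1 *: x)) =
    (fun x => f x * G (- e + x)).
  by apply/funext => x; rewrite scale1r addrA subrr add0r.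
rewrite expr1n invr1 mul1r => iGe EG.
have i0 : mu.-integrable setT (EFin \o (fun x => f x * G x)).
  by apply: eq_integrable (Gi 0) => // x _; rewrite /= add0r.
have E1 : \int[mu]_x (diff_quot i f h x * G x) =
    h^-1 * (\int[mu]_x (f (e + x) * G x) - \int[mu]_x (f x * G x)).
  have ie := Gi e.
  rewrite -RintegralB// -RintegralZl//; do ?[exact: RintegrableB].
  by apply: eq_Rintegral => x _; rewrite /diff_quot -mulrA mulrBl.
have E2 : \int[mu]_x (diff_quot i G (- h) x * f x) =
    (- h)^-1 * (\int[mu]_x (f x * G (- e + x)) - \int[mu]_x (f x * G x)).
  rewrite -RintegralB// -RintegralZl//; do ?[exact: RintegrableB].
  by apply: eq_Rintegral => x _; rewrite /diff_quot scaleNr -/e -mulrA mulrBl ![f x * _]mulrC.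
by rewrite E1 E2 -EG invrN mulNr opprK.
Qed.

(** The discrete identity integral_diff_quotM passes to the limit by dominated
    convergence, the Lipschitz constants bounding the difference quotients. *)
Lemma lip_ibp (f G : 'rV[R]_n -> R) (B L M r : R) :
  (forall x, `|f x| <= B) ->
  0 <= L -> (forall x y, `|f x - f y| <= L * `|x - y|) ->
  0 <= M -> (forall x y, `|G x - G y| <= M * `|x - y|) ->
  0 <= r -> (forall x, r < `|x| -> G x = 0) ->
  [/\ mu.-integrable setT (EFin \o (fun x => partial i f x * G x)),
      mu.-integrable setT (EFin \o (fun x => partial i G x * f x)) &
      \int[mu]_x (partial i f x * G x) = - \int[mu]_x (partial i G x * f x)].
Proof.
move=> fB L0 fL M0 GM r0 Gr.
have cf := lip_continuous fL; have cG := lip_continuous GM.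
have mf := Defs.continuous_measurable_fun cf.
have mG := Defs.continuous_measurable_fun cG.
have B0 : 0 <= B by rewrite (le_trans _ (fB 0)).
(* The steps 1 / (k + 1) are at most 1, so r + 1 bounds the support of all the
   difference quotients of G. *)
pose r1 := r + 1.
have Gb x : `|G x| <= M * (2 * r1).
  have [rx|xr] := ltP r `|x|; first by rewrite Gr// normr0 !mulr_ge0// addr_ge0.
  pose z : 'rV[R]_n := const_mx r1.
  have zr : r < `|z|.
    rewrite (@lt_le_trans _ _ r1) ?ltrDl//.
    have := norm_coord_rV z i; rewrite mxE ger0_norm//.
    by rewrite addr_ge0.
  have := GM x z; rewrite (Gr z zr) subr0 => /le_trans; apply.
  rewrite ler_wpM2l// (le_trans (ler_normB _ _))// mulr_natl mulr2n lerD//.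
    by rewrite (le_trans xr)// lerDl.
  rewrite norm_rV_le ?addr_ge0//; apply/forallP => k; rewrite mxE ger0_norm//.
  by rewrite addr_ge0.
pose h k : R := k.+1%:R^-1.
have h0 k : h k != 0 by rewrite invr_eq0.
have hc : h k @[k --> \oo] --> 0 by exact: cvg_harmonic.
have Nh0 k : - h k != 0 by rewrite oppr_eq0.
have Nhc : - h k @[k --> \oo] --> 0 by rewrite -oppr0; exact: cvgN.
have [||i1 c1] := @cvg_integral_diff_quot f G (fun x => L * `|G x|) L h L0 fL mG _ h0 hc.
- apply: (@bounded_supp_integrable _ _ _ (L * (M * (2 * r1))) r).
  + by apply: measurable_funM => //; exact: measurableT_comp.
  + by move=> x; rewrite normrM normr_id ger0_norm// ler_wpM2l.
  + by move=> x /Gr ->; rewrite normr0 mulr0.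
- move=> k x; rewrite normrM ler_wpM2r//; exact: diff_quot_lip.
pose W x := (M * B) * \1_[set x : 'rV[R]_n | `|x| <= r1] x.
have [||i2 c2] := @cvg_integral_diff_quot G f W M (fun k => - h k) M0 GM mf _ Nh0 Nhc.
- apply: (@bounded_supp_integrable _ _ _ (M * B) r1).
  + apply: measurable_funM => //; apply: measurable_indic; exact: measurable_cube.
  + move=> x; rewrite normrM ger0_norm ?mulr_ge0// ler_piMr ?mulr_ge0//.
    by rewrite indicE; case: (_ \in _); rewrite ?normr1 ?normr0.
  + move=> x; rewrite ltNge => /negP xr; rewrite /W indicE memNset ?mulr0//.
- move=> k x; rewrite /W indicE; case: (boolP (x \in _)).
    by rewrite inE/= => xr; rewrite mulr1 normrM ler_pM// diff_quot_lip.
  rewrite notin_setE/= => /negP; rewrite -ltNge mulr0 => xr.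
  rewrite /diff_quot Gr; last first.
    have := ler_normD (- h k *: delta_mx 0 i + x) (- (- h k *: delta_mx 0 i)).
    rewrite addrAC subrr add0r => H.
    rewrite -(ltrD2r 1); apply: lt_le_trans xr _.
    rewrite (le_trans H)// lerD2l normrN normrZ.
    rewrite -[leRHS]mulr1 ler_pM// ?norm_delta_rV//.
    by rewrite normrN ger0_norm ?invr_ge0// invf_le1 ?ler1n// ltr0n.
  rewrite Gr; first by rewrite subrr mulr0 mul0r normr0.
  by rewrite (lt_trans _ xr)// ltrDl.
split => //.
have E k : \int[mu]_x (diff_quot i f (h k) x * G x) =
    - \int[mu]_x (diff_quot i G (- h k) x * f x).
  exact: (integral_diff_quotM (M := M * (2 * r1)) (r := r)).
move: c1; under eq_fun do rewrite E.
move=> c1.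
have c3 := cvgN c2.
exact: (cvg_unique (@Rhausdorff R) c1 (c3 _)).
Qed.

End Ibp.

(** * A bump function and its rescalings *)

Section Calculus.
Context {R : realType}.

Lemma bounded_derive_lip1 (f : R -> R) (M : R) :
  (forall t : R, derivable f t 1) -> (forall t : R, `|'D_1 f t| <= M) ->
  forall s t, `|f s - f t| <= M * `|s - t|.
Proof.
move=> df dM.
suff H s t : s < t -> `|f s - f t| <= M * `|s - t|.
  move=> s t; have [st|ts|->] := ltgtP s t; first exact: H.
    by rewrite distrC [X in _ * X]distrC; exact: H.
  by rewrite !subrr !normr0 mulr0.
move=> st.
have H1 x : x \in `]s, t[ -> is_derive x 1 f ('D_1 f x) by move=> _; exact: derivableP.
have H2 : {within `[s, t], continuous f} by apply: derivable_within_continuous => x _.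
have [c _ E] := MVT st H1 H2.
by rewrite distrC E [`|s - t|]distrC normrM ler_wpM2r.
Qed.

Lemma partial_line n (i : 'I_n) (f : 'rV[R]_n -> R) (x : 'rV[R]_n) :
  (forall y, derivable f y (delta_mx 0 i)) ->
  forall t : R, derivable (fun h : R => f (h *: delta_mx 0 i + x)) t 1 /\
    'D_1 (fun h : R => f (h *: delta_mx 0 i + x)) t = partial i f (t *: delta_mx 0 i + x).
Proof.
move=> df t.
have E : (fun h : R => h^-1 *: (f ((h *: (1 : R) + t) *: delta_mx 0 i + x) - f (t *: delta_mx 0 i + x)))
   = (fun h : R => h^-1 *: (f (h *: delta_mx 0 i + (t *: delta_mx 0 i + x)) - f (t *: delta_mx 0 i + x))).
  by apply/funext => h; rewrite [h *: 1]mulr1 scalerDl addrA.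
by split; [rewrite /derivable E; exact: df|rewrite /partial /derive E].
Qed.

(** Pass from y to x by changing one coordinate at a time. *)
Lemma bounded_partials_lip n (f : 'rV[R]_n -> R) (M : R) :
  (forall i y, derivable f y (delta_mx 0 i)) ->
  (forall i y, `|partial i f y| <= M) ->
  forall x y, `|f x - f y| <= (n%:R * M) * `|x - y|.
Proof.
move=> df dM x y.
(* The first k coordinates come from x, the others from y. *)
pose z (k : nat) : 'rV[R]_n := \row_j (if (j < k)%N then x 0 j else y 0 j).
have zn : z n = x by apply/rowP => j; rewrite mxE ltn_ord.
have z0 : z 0%N = y by apply/rowP => j; rewrite mxE.
have -> : f x - f y = \sum_(i < n) (f (z i.+1) - f (z i)).
  by rewrite -zn -z0 -(telescope_sumr (f \o z) (leq0n n)) big_mkord.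
rewrite (le_trans (ler_norm_sum _ _ _))// -mulrA mulr_natl.
rewrite -[X in _ <= _ *+ X](card_ord n) -sumr_const ler_sum// => i _.
have E : z i.+1 = (x 0 i - y 0 i) *: delta_mx 0 i + z i.
  apply/rowP => j; rewrite !mxE ltnS leq_eqVlt eqxx/= -val_eqE/=.
  have [ji|ij|/val_inj ->] := ltngtP j i; rewrite ?mulr0 ?add0r//.
  by rewrite mulr1 subrK.
have F t := partial_line (z i) (df i) t.
have := @bounded_derive_lip1 (fun h : R => f (h *: delta_mx 0 i + z i)) M (fun t => (F t).1) _ (x 0 i - y 0 i) 0.
rewrite -E scale0r add0r subr0 => H.
rewrite (le_trans (H _))//; first by move=> t; rewrite (F t).2.
have := norm_coord_rV (x - y) i; rewrite mxE [X in _ + X]mxE => Hn.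
by rewrite ler_wpM2l// (le_trans _ (dM i 0)).
Qed.

(** The square makes the positive part continuously differentiable, which is
    all the smoothness that the bump below needs. *)
Definition sqr_pos_part (u : R) : R := (Num.max 0 u) ^+ 2.

Lemma is_derive_sqr_pos_part (u : R) : is_derive u 1 sqr_pos_part (2 * Num.max 0 u).
Proof.
have key h : `|sqr_pos_part (h + u) - sqr_pos_part u - 2 * Num.max 0 u * h| <= h ^+ 2.
  rewrite /sqr_pos_part ler_norml.
  have [u0|u0] := leP 0 u; have [v0|v0] := leP 0 (h + u); apply/andP; split; nra.
have c : h^-1 *: (sqr_pos_part (h *: (1 : R) + u) - sqr_pos_part u) @[h --> 0^'] --> 2 * Num.max 0 u.
  apply/cvgrPdist_le => e e0; near=> h.
  have h0 : h != 0 by near: h; exact: nbhs_dnbhs_neq.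
  rewrite [h *: 1]mulr1 distrC.
  have -> : h^-1 *: (sqr_pos_part (h + u) - sqr_pos_part u) - 2 * Num.max 0 u =
     h^-1 * (sqr_pos_part (h + u) - sqr_pos_part u - 2 * Num.max 0 u * h).
    by rewrite [_ *: _]mulrC; field.
  rewrite normrM normfV ler_pdivrMl ?normr_gt0// (le_trans (key h))//.
  rewrite -real_normK ?num_real// expr2 ler_wpM2l//.
  by near: h; exact: dnbhs0_le.
by split; [apply/cvg_ex; eexists; exact: c|exact: cvg_lim c].
Unshelve. all: by end_near. Qed.

Variable n : nat.

(** A bump supported in the Euclidean unit ball, with bounded and explicit
    partial derivatives dbump. *)
Definition bump (z : 'rV[R]_n) : R := sqr_pos_part (1 - dotv z z).

Definition dbump (i : 'I_n) (z : 'rV[R]_n) : R :=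
  - 4 * z 0 i * Num.max 0 (1 - dotv z z).

Lemma is_derive_bump_path (w : R -> 'rV[R]_n) (t : R) (w' : 'I_n -> R) :
  (forall j, is_derive t 1 (fun s => w s 0 j) (w' j)) ->
  is_derive t 1 (bump \o w) (\sum_j dbump j (w t) * w' j).
Proof.
move=> dw.
have dq : is_derive t 1 (fun s => 1 - dotv (w s) (w s)) (- \sum_j (2 * w t 0 j * w' j)).
  rewrite /dotv.
  have -> : (fun s => 1 - \sum_j w s 0 j * w s 0 j) =
     (cst 1 - \sum_j (fun s => w s 0 j * w s 0 j)).
    by apply/funext => s; rewrite !fctE/= fct_sumE.
  have D : is_derive t 1 (\sum_j (fun s : R => w s 0 j * w s 0 j))
      (\sum_j (2 * w t 0 j * w' j)).
    apply: is_derive_sum => j.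
    have -> : 2 * w t 0 j * w' j = w t 0 j *: w' j + w t 0 j *: w' j.
      by rewrite /GRing.scale/=; ring.
    exact: is_deriveM.
  rewrite -[X in is_derive _ _ _ X]sub0r.
  exact: (is_deriveB (is_derive_cst (1 : R) t (1 : R)) D).
have -> : \sum_j dbump j (w t) * w' j =
   (2 * Num.max 0 (1 - dotv (w t) (w t))) * (- \sum_j (2 * w t 0 j * w' j)).
  rewrite mulrN mulr_sumr -sumrN; apply: eq_bigr => j _; rewrite /dbump; ring.
exact: (@is_derive1_comp _ sqr_pos_part _ _ _ _ (is_derive_sqr_pos_part _) dq).
Qed.

End Calculus.

Section BumpFacts.
Context {R : realType}.
Variable n : nat.
Local Notation mu := (@lebesgueN R n).
Implicit Types z : 'rV[R]_n.

Lemma dotv_ge0 z : 0 <= dotv z z.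
Proof. by apply: sumr_ge0 => i _; rewrite -expr2 sqr_ge0. Qed.

Lemma bump_ge0 z : 0 <= bump z. Proof. exact: sqr_ge0. Qed.

Lemma bump_eq0 z : 1 <= dotv z z -> bump z = 0.
Proof.
move=> z1; rewrite /bump /sqr_pos_part max_l ?expr0n//.
by rewrite subr_le0.
Qed.

Lemma bump_le1 z : bump z <= 1.
Proof.
rewrite /bump /sqr_pos_part; have z0 := dotv_ge0 z.
have [le0|lt0] := leP 0 (1 - dotv z z); last by rewrite expr0n.
by rewrite expr_le1// gerBl.
Qed.

Lemma dotv_coord z j : dotv z z < 1 -> `|z 0 j| <= 1.
Proof.
move=> z1; rewrite -(@ler_pXn2r _ 2)// ?nnegrE// real_normK ?num_real// expr1n.
rewrite (le_trans _ (ltW z1))// /dotv (bigD1 j)//= -expr2 lerDl.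
by apply: sumr_ge0 => i _; rewrite -expr2 sqr_ge0.
Qed.

Lemma dotv_norm z : dotv z z < 1 -> `|z| <= 1.
Proof. by move=> z1; rewrite norm_rV_le//; apply/forallP => j; exact: dotv_coord. Qed.

Lemma bump_supp z : 1 < `|z| -> bump z = 0.
Proof.
move=> z1; apply: bump_eq0; rewrite leNgt; apply/negP => /dotv_norm.
by rewrite leNgt z1.
Qed.

Lemma dbump_le j z : `|dbump j z| <= 4.
Proof.
rewrite /dbump; have [le0|lt0] := leP 0 (1 - dotv z z); last by rewrite mulr0 normr0.
move: le0; rewrite subr_ge0 le_eqVlt => /orP[/eqP ->|z1].
  by rewrite subrr mulr0 normr0.
rewrite 2!normrM normrN [`|4|]ger0_norm// -[leRHS]mulr1 ler_pM ?mulr_ge0//; last first.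
  by have d0 := dotv_ge0 z; rewrite ler_norml; apply/andP; split; lra.
by rewrite -[leRHS]mulr1 ler_pM// dotv_coord.
Qed.

Lemma dbump_eq0 j z : 1 <= dotv z z -> dbump j z = 0.
Proof. by move=> z1; rewrite /dbump max_l ?mulr0// subr_le0. Qed.

Lemma measurable_bump_comp d (T : measurableType d) (Z : T -> 'rV[R]_n) :
  (forall j, measurable_fun setT (fun p => Z p 0 j)) ->
  measurable_fun setT (fun p => bump (Z p)).
Proof.
move=> mZ; rewrite /bump /sqr_pos_part /dotv.
apply: measurable_funX; apply: measurable_maxr => //.
apply: measurable_funB => //; apply: measurable_sum => j.
exact: measurable_funM.
Qed.

Lemma measurable_coord j : measurable_fun setT (fun z => z 0 j).
Proof. by apply: Defs.continuous_measurable_fun; exact: coord_continuous. Qed.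

Lemma measurable_bump : measurable_fun setT (@bump R n).
Proof. by apply: measurable_bump_comp => j; exact: measurable_coord. Qed.

Lemma integrable_bump : mu.-integrable setT (EFin \o @bump R n).
Proof.
apply: (@bounded_supp_integrable _ _ _ 1 1); first exact: measurable_bump.
  by move=> x; rewrite ger0_norm ?bump_ge0// bump_le1.
exact: bump_supp.
Qed.

Definition bump_mass : R := \int[mu]_z bump z.

(** On the cube of half-side 1 / (n + 1) one has |z|^2 <= 1/2, hence
    bump z >= 1/4 there. *)
Lemma bump_mass_gt0 : 0 < bump_mass.
Proof.
pose d : R := n.+1%:R^-1.
have d0 : 0 < d by rewrite invr_gt0.
pose C := [set z : 'rV[R]_n | `|z| <= d].
have mC : measurable C by exact: measurable_cube.
have vC : mu C = ((2 * d) ^+ n)%:E.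
  have -> : C = [set v | forall i, `[- d, d]%classic (v 0 i)].
    apply/seteqP; split => x; rewrite /C/= norm_rV_le ?(ltW d0)//.
      by move=> /forallP H i; rewrite in_itv/= -ler_norml.
    by move=> H; apply/forallP => i; have := H i; rewrite in_itv/= -ler_norml.
  rewrite (@lebesgueN_box R n (fun=> `[- d, d]%classic)); last by move=> i; exact: measurable_itv.
  under eq_bigr do rewrite lebesgue_measure_itv/= lte_fin gtrN// -EFinB opprK.
  have -> : d + d = 2 * d by ring.
  elim: (n) => [|k IH]; first by rewrite big_ord0 expr0.
  by rewrite big_ord_recl IH -EFinM exprS.
have bC z : C z -> 1 / 4 <= bump z.
  move=> Cz; have dz : dotv z z <= 1 / 2.
    apply: (@le_trans _ _ (\sum_(i < n) d ^+ 2)).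
      apply: ler_sum => i _; rewrite -expr2 -real_normK ?num_real//.
      by rewrite ler_pXn2r ?nnegrE// ?(ltW d0)// (le_trans (norm_coord_rV _ _)).
    rewrite sumr_const card_ord -[_ *+ n]mulr_natl /d exprVn.
    rewrite ler_pdivrMr ?exprn_gt0//.
    by rewrite -(natr1 n); have : 0 <= n%:R :> R by []; nra.
  rewrite /bump /sqr_pos_part max_r; last by lra.
  by nra.
have i4 : mu.-integrable setT (EFin \o (fun z => 1 / 4 * \1_C z)).
  apply: (@bounded_supp_integrable _ _ _ (1 / 4) d).
  - by apply: measurable_funM => //; exact: measurable_indic.
  - by move=> x; rewrite indicE; case: (_ \in _); rewrite ?mulr1 ?mulr0 ?normr0 ?ger0_norm.
  - by move=> x xd; rewrite indicE memNset ?mulr0// /C/= leNgt xd.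
have : \int[mu]_z (1 / 4 * \1_C z) <= bump_mass.
  apply: le_Rintegral => //; first exact: integrable_bump.
  move=> z _; rewrite indicE; case: (boolP (z \in C)) => [|_].
    by rewrite inE mulr1 => /bC.
  by rewrite mulr0 bump_ge0.
apply: lt_le_trans.
rewrite RintegralZl//; last first.
  apply: (@bounded_supp_integrable _ _ _ 1 d).
  - exact: measurable_indic.
  - by move=> x; rewrite indicE; case: (_ \in _); rewrite ?normr0 ?normr1.
  - by move=> x xd; rewrite indicE memNset// /C/= leNgt xd.
rewrite /Rintegral integral_indic// setIT [X in fine X]vC/=.
by rewrite mulr_gt0// exprn_gt0// mulr_gt0.
Qed.

Definition mollifier (c : 'rV[R]_n) (l : R) (x : 'rV[R]_n) : R :=
  bump_mass^-1 * (l^-1 ^+ n * bump (l^-1 *: (x - c))).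

Lemma mollifier_ge0 c l x : 0 <= l -> 0 <= mollifier c l x.
Proof.
move=> l0; rewrite /mollifier mulr_ge0 ?invr_ge0 ?(ltW bump_mass_gt0)//.
by rewrite mulr_ge0 ?bump_ge0// exprn_ge0// invr_ge0.
Qed.

Lemma mollifier_le c l x : 0 <= l -> mollifier c l x <= bump_mass^-1 * l^-1 ^+ n.
Proof.
move=> l0; rewrite /mollifier ler_wpM2l ?invr_ge0 ?(ltW bump_mass_gt0)//.
by rewrite ler_piMr ?bump_le1// exprn_ge0// invr_ge0.
Qed.

Lemma dotvZ a (z : 'rV[R]_n) : dotv (a *: z) (a *: z) = a ^+ 2 * dotv z z.
Proof. by rewrite /dotv mulr_sumr; apply: eq_bigr => i _; rewrite !mxE; ring. Qed.

Lemma mollifier_eq0 c l x : 0 < l -> l <= enorm (x - c) -> mollifier c l x = 0.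
Proof.
move=> l0 lx; rewrite /mollifier bump_eq0 ?mulr0// dotvZ exprVn.
rewrite ler_pdivlMl ?exprn_gt0// mulr1.
rewrite -(@sqr_sqrtr _ (dotv (x - c) (x - c))) ?dotv_ge0//.
by rewrite ler_pXn2r// nnegrE ?sqrtr_ge0// ltW.
Qed.

Lemma mollifier_supp c l x : 0 < l -> `|c| + l < `|x| -> mollifier c l x = 0.
Proof.
move=> l0 lx; rewrite /mollifier bump_supp ?mulr0// normrZ normfV (gtr0_norm l0).
rewrite ltr_pdivlMl// mulr1 -(ltrD2l `|c|) (lt_le_trans lx)//.
by rewrite -[x in leLHS](subrK c) addrC ler_normD.
Qed.

(** The change of variables x = c + l z; its right-hand side makes sense for l = 0
    too, which is how the transport starts from a single point. *)
Lemma integral_mollifier (u : 'rV[R]_n -> R) B c l : 0 < l ->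
  measurable_fun setT u -> (forall x, `|u x| <= B) ->
  [/\ mu.-integrable setT (EFin \o (fun x => u x * mollifier c l x)),
      mu.-integrable setT (EFin \o (fun z => u (c + l *: z) * (bump_mass^-1 * bump z))) &
  \int[mu]_x (u x * mollifier c l x) =
  \int[mu]_z (u (c + l *: z) * (bump_mass^-1 * bump z))].
Proof.
move=> l0 mu_ uB.
have l0' := ltW l0.
have mmol : measurable_fun setT (mollifier c l).
  rewrite /mollifier; apply: measurable_funM => //; apply: measurable_funM => //.
  apply: measurable_bump_comp => j.
  have -> : (fun p : 'rV[R]_n => (l^-1 *: (p - c)) 0 j) = (fun p => l^-1 * (p 0 j - c 0 j)).
    by apply/funext => p; rewrite !mxE.
  apply: measurable_funM => //; apply: measurable_funB => //; exact: measurable_coord.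
have i1 : mu.-integrable setT (EFin \o (fun x => u x * mollifier c l x)).
  apply: (@bounded_supp_integrable _ _ _ (B * (bump_mass^-1 * l^-1 ^+ n)) (`|c| + l)).
  - exact: measurable_funM.
  - move=> x; rewrite normrM ler_pM// ger0_norm ?mollifier_le//.
    exact: mollifier_ge0.
  - by move=> x /(mollifier_supp l0) ->; rewrite mulr0.
have [] := Rintegral_lebesgueN_affine c l0 i1.
have -> : (fun z : 'rV[R]_n => u (c + l *: z) * mollifier c l (c + l *: z)) =
  (fun z => l^-1 ^+ n * (u (c + l *: z) * (bump_mass^-1 * bump z))).
  apply/funext => z; rewrite /mollifier addrAC subrr add0r scalerA mulVf ?gt_eqF// scale1r.
  by ring.
move=> i2 E.
have i3 : mu.-integrable setT (EFin \o (fun z => u (c + l *: z) * (bump_mass^-1 * bump z))).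
  have := RintegrableZ (l ^+ n) measurableT i2.
  apply: eq_integrable => // x _; rewrite /= mulrA -exprMn mulfV ?gt_eqF// expr1n mul1r.
  by [].
split => //.
rewrite RintegralZl// in E.
have ln0 : l^-1 ^+ n != 0 by rewrite expf_neq0// invr_eq0 gt_eqF.
by apply: (mulfI ln0); rewrite E exprVn.
Qed.

End BumpFacts.

(** * A bump moving along a segment *)

Section Line.
Context {R : realType}.
Variable n : nat.
Variables (c0 v : 'rV[R]_n) (l0 l1 : R).

Definition center_at (t : R) : 'rV[R]_n := c0 + t *: v.
Definition radius_at (t : R) : R := l0 + t * l1.
Definition coord_at (t : R) (x : 'rV[R]_n) : 'rV[R]_n := (radius_at t)^-1 *: (x - center_at t).
Definition bump_at (t : R) (x : 'rV[R]_n) : R := mollifier (center_at t) (radius_at t) x.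
(** The velocity of the material point at rescaled position z in the moving ball is
    v + l1 z; the field is this velocity times the density. *)
Definition field_at (i : 'I_n) (t : R) (x : 'rV[R]_n) : R :=
  (v 0 i + l1 * coord_at t x 0 i) * bump_at t x.

Lemma is_derive_coord_path (a b t : R) : is_derive t 1 (fun h : R => h * a + b) a.
Proof.
have -> : (fun h : R => h * a + b) = ( *%R^~ a + cst b) by apply/funext.
rewrite -[X in is_derive _ _ _ X]addr0; apply: is_deriveD.
have -> : *%R^~ a = a *: (@idfun R) by apply/funext => h; rewrite mulrC.
rewrite -[X in is_derive _ _ _ X]mulr1; exact: is_deriveZ.
Qed.

Lemma partial_field_at (i j : 'I_n) t x : radius_at t != 0 ->
  derivable (field_at i t) x (delta_mx 0 j) /\
  partial j (field_at i t) x = (bump_mass n)^-1 * (radius_at t)^-1 ^+ n.+1 *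
    (l1 * (i == j)%:R * bump (coord_at t x) + (v 0 i + l1 * coord_at t x 0 i) * dbump j (coord_at t x)).
Proof.
move=> rt.
pose w (h : R) := coord_at t (h *: delta_mx 0 j + x).
have wE h k : w h 0 k = h * ((radius_at t)^-1 * (k == j)%:R) + coord_at t x 0 k.
  by rewrite /w /coord_at !mxE eqxx/=; ring.
have dw k : is_derive (0 : R) 1 (fun s => w s 0 k) ((radius_at t)^-1 * (k == j)%:R).
  by rewrite (funext (wE^~ k)); exact: is_derive_coord_path.
have w0 : w 0 = coord_at t x by rewrite /w scale0r add0r.
have db := is_derive_bump_path dw.
have EL : (fun h : R => field_at i t (h *: delta_mx 0 j + x)) =
    (fun h => v 0 i + l1 * w h 0 i) * (fun h => (bump_mass n)^-1 * ((radius_at t)^-1 ^+ n) * bump (w h)).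
  by apply/funext => h; rewrite /field_at /bump_at /mollifier -/(coord_at _ _) -/(w h) !fctE mulrA.
have d1 : is_derive (0 : R) 1 (fun h => v 0 i + l1 * w h 0 i) (l1 * ((radius_at t)^-1 * (i == j)%:R)).
  have -> : (fun h : R => v 0 i + l1 * w h 0 i) =
     (fun h => h * (l1 * ((radius_at t)^-1 * (i == j)%:R)) + (v 0 i + l1 * coord_at t x 0 i)).
    by apply/funext => h; rewrite wE; ring.
  exact: is_derive_coord_path.
have d2 : is_derive (0 : R) 1 (fun h => (bump_mass n)^-1 * ((radius_at t)^-1 ^+ n) * bump (w h))
    ((bump_mass n)^-1 * ((radius_at t)^-1 ^+ n) * \sum_k dbump k (w 0) * ((radius_at t)^-1 * (k == j)%:R)).
  exact: (is_deriveZ ((bump_mass n)^-1 * ((radius_at t)^-1 ^+ n)) db).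
have dM := is_deriveM d1 d2.
have sE : \sum_k dbump k (w 0) * ((radius_at t)^-1 * (k == j)%:R) = (radius_at t)^-1 * dbump j (coord_at t x).
  rewrite (bigD1 j)//= eqxx big1 ?addr0 ?w0; first by rewrite mulr1 mulrC.
  by move=> k /negPf ->; rewrite !mulr0.
rewrite -EL sE w0 in dM.
have E (h : R) : h^-1 *: (field_at i t (h *: delta_mx 0 j + x) - field_at i t x) =
   h^-1 *: (((fun h : R => field_at i t (h *: delta_mx 0 j + x)) \o shift 0) (h *: (1 : R))
    - (fun h : R => field_at i t (h *: delta_mx 0 j + x)) 0).
  by rewrite /= scale0r add0r addr0 [h *: 1]mulr1.
split; rewrite /derivable /partial /derive (funext E); first exact: ex_derive.
rewrite -[LHS]/('D_1 (fun h : R => field_at i t (h *: delta_mx 0 j + x)) 0) derive_val.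
by rewrite /GRing.scale/= exprS; ring.
Qed.

(** The continuity equation: the density moves with the velocity field of the
    expanding ball.  It is checked by computing both sides from the gradient
    of the bump. *)
Lemma is_derive_bump_at (t : R) x : radius_at t != 0 ->
  is_derive t 1 (bump_at^~ x) (- \sum_i partial i (field_at i t) x).
Proof.
move=> rt.
have drad : is_derive t 1 radius_at l1.
  have -> : radius_at = (fun h : R => h * l1 + l0) by apply/funext => h; rewrite /radius_at addrC.
  exact: is_derive_coord_path.
have dinv : is_derive t 1 (fun s => (radius_at s)^-1) (- l1 * (radius_at t)^-1 ^+ 2).
  have := is_deriveV (rt : radius_at t != 0).
  move=> /(_ _ _ drad); rewrite /GRing.scale/= => H.
  by rewrite exprVn mulNr mulrC -mulNr.
have dpow : is_derive t 1 (fun s => (radius_at s)^-1 ^+ n) (- (n%:R * l1) * (radius_at t)^-1 ^+ n.+1).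
  elim: (n) => [|k IH].
    rewrite mul0r oppr0 mul0r.
    have -> : (fun s => (radius_at s)^-1 ^+ 0) = cst 1 by apply/funext => s; rewrite expr0.
    exact: is_derive_cst.
  have -> : (fun s => (radius_at s)^-1 ^+ k.+1) = (fun s => (radius_at s)^-1) * (fun s => (radius_at s)^-1 ^+ k).
    by apply/funext => s; rewrite exprS.
  have := is_deriveM dinv IH; rewrite /GRing.scale/= => H.
  have -> : - (k.+1%:R * l1) * (radius_at t)^-1 ^+ k.+2 =
     (radius_at t)^-1 * (- (k%:R * l1) * (radius_at t)^-1 ^+ k.+1) + (radius_at t)^-1 ^+ k * (- l1 * (radius_at t)^-1 ^+ 2).
    by rewrite -natr1 !exprS; ring.
  exact: H.
pose w (s : R) := coord_at s x.
have dw k : is_derive t 1 (fun s => w s 0 k) (- (radius_at t)^-1 * (v 0 k + l1 * w t 0 k)).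
  have -> : (fun s => w s 0 k) = (fun s => (radius_at s)^-1) * (fun s => s * (- v 0 k) + (x 0 k - c0 0 k)).
    by apply/funext => s; rewrite /w /coord_at /center_at !mxE/= !fctE; ring.
  have := is_deriveM dinv (is_derive_coord_path (- v 0 k) (x 0 k - c0 0 k) t).
  rewrite /GRing.scale/= => H.
  have -> : - (radius_at t)^-1 * (v 0 k + l1 * w t 0 k) =
    (radius_at t)^-1 * - v 0 k + (t * - v 0 k + (x 0 k - c0 0 k)) * (- l1 * (radius_at t)^-1 ^+ 2).
    by rewrite /w /coord_at /center_at !mxE; ring.
  exact: H.
have db := is_derive_bump_path dw.
have dM := is_deriveM dpow db.
have dZ := is_deriveZ ((bump_mass n)^-1) dM.
have -> : bump_at^~ x = (bump_mass n)^-1 *: ((fun s => (radius_at s)^-1 ^+ n) * (@bump R n \o w)) by apply/funext.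
suff -> : - \sum_i partial i (field_at i t) x = (bump_mass n)^-1 *:
   ((radius_at t)^-1 ^+ n *: (\sum_j dbump j (w t) * (- (radius_at t)^-1 * (v 0 j + l1 * w t 0 j))) +
   (@bump R n \o w) t *: (- (n%:R * l1) * (radius_at t)^-1 ^+ n.+1)) by exact: dZ.
pose S := \sum_i (v 0 i + l1 * coord_at t x 0 i) * dbump i (coord_at t x).
have -> : \sum_j dbump j (w t) * (- (radius_at t)^-1 * (v 0 j + l1 * w t 0 j)) = - (radius_at t)^-1 * S.
  by rewrite mulr_sumr; apply: eq_bigr => j _; rewrite /w; ring.
have -> : \sum_i partial i (field_at i t) x =
    (bump_mass n)^-1 * (radius_at t)^-1 ^+ n.+1 * (n%:R * l1 * bump (coord_at t x) + S).
  under eq_bigr => i _ do rewrite (partial_field_at i i x rt).2 eqxx mulr1.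
  rewrite -mulr_sumr big_split/= -mulr_suml sumr_const card_ord.
  by rewrite -[l1 *+ n]mulr_natl.
by rewrite /GRing.scale/= exprS /w; ring.
Qed.

Lemma bump_at_eq0 t x : 0 < radius_at t -> 1 <= dotv (coord_at t x) (coord_at t x) -> bump_at t x = 0.
Proof. by move=> r0 z1; rewrite /bump_at /mollifier -/(coord_at t x) bump_eq0// !mulr0. Qed.

Lemma coord_at_far t x : 0 < radius_at t -> `|center_at t| + radius_at t < `|x| ->
  1 <= dotv (coord_at t x) (coord_at t x).
Proof.
move=> r0 xr; rewrite leNgt; apply/negP => /dotv_norm.
rewrite leNgt => /negP; apply.
rewrite /coord_at normrZ normfV (gtr0_norm r0) ltr_pdivlMl// mulr1.
rewrite -(ltrD2l `|center_at t|) (lt_le_trans xr)//.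
by rewrite -[x in leLHS](subrK (center_at t)) addrC ler_normD.
Qed.

Variable V : R.
Hypothesis vV : `|v| <= V.
Hypothesis l1_ge0 : 0 <= l1.

Let V0 : 0 <= V. Proof. exact: le_trans vV. Qed.

Lemma speed_at_le i z : dotv z z < 1 -> `|v 0 i + l1 * z 0 i| <= V + l1.
Proof.
move=> z1; rewrite (le_trans (ler_normD _ _))// lerD//.
  by rewrite (le_trans (norm_coord_rV v i)).
by rewrite normrM ger0_norm// ler_piMr// dotv_coord.
Qed.

Lemma field_at_le i t x : 0 < radius_at t -> `|field_at i t x| <= (V + l1) * bump_at t x.
Proof.
move=> r0; rewrite /field_at normrM [`|bump_at _ _|]ger0_norm; last exact/mollifier_ge0/ltW.
have [z1|z1] := ltP (dotv (coord_at t x) (coord_at t x)) 1.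
  by rewrite ler_wpM2r ?speed_at_le//; exact/mollifier_ge0/ltW.
by rewrite (bump_at_eq0 r0 z1) !mulr0.
Qed.

Lemma partial_field_at_le i j t x : 0 < radius_at t ->
  `|partial j (field_at i t) x| <= (bump_mass n)^-1 * (radius_at t)^-1 ^+ n.+1 * (l1 + 4 * (V + l1)).
Proof.
move=> r0; rewrite (partial_field_at i j x (lt0r_neq0 r0)).2 normrM ger0_norm; last first.
  by rewrite mulr_ge0 ?invr_ge0 ?(ltW (bump_mass_gt0 _))// exprn_ge0// invr_ge0 ltW.
rewrite ler_wpM2l//.
  by rewrite mulr_ge0 ?invr_ge0 ?(ltW (bump_mass_gt0 _))// exprn_ge0// invr_ge0 ltW.
rewrite (le_trans (ler_normD _ _))// lerD//.
  rewrite 2!normrM (ger0_norm l1_ge0) -mulrA ler_piMr// -[leRHS]mulr1 ler_pM//.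
    by case: eqP; rewrite ?normr0 ?normr1.
  by rewrite ger0_norm ?bump_ge0// bump_le1.
have [z1|z1] := ltP (dotv (coord_at t x) (coord_at t x)) 1.
  by rewrite normrM mulrC ler_pM ?dbump_le// speed_at_le.
by rewrite dbump_eq0// mulr0 normr0 mulr_ge0// addr_ge0.
Qed.

Lemma field_at_lip i t : 0 < radius_at t -> exists2 M, 0 <= M &
  forall x y, `|field_at i t x - field_at i t y| <= M * `|x - y|.
Proof.
move=> r0; pose M := (bump_mass n)^-1 * (radius_at t)^-1 ^+ n.+1 * (l1 + 4 * (V + l1)).
have M0 : 0 <= M.
  rewrite mulr_ge0//; last by rewrite addr_ge0// mulr_ge0// addr_ge0.
  by rewrite mulr_ge0 ?invr_ge0 ?(ltW (bump_mass_gt0 _))// exprn_ge0// invr_ge0 ltW.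
exists (n%:R * M); first exact: mulr_ge0.
apply: bounded_partials_lip => [j y|j y]; last exact: partial_field_at_le.
exact: (partial_field_at i j y (lt0r_neq0 r0)).1.
Qed.

Lemma field_at_supp i t x : 0 < radius_at t -> `|center_at t| + radius_at t < `|x| -> field_at i t x = 0.
Proof. by move=> r0 /(coord_at_far r0) z1; rewrite /field_at bump_at_eq0// mulr0. Qed.

End Line.

Section Transport.
Context {R : realType}.
Variable n : nat.
Local Notation mu := (@lebesgueN R n).
Local Notation leb := (@lebesgue_measure R).
Variables (c0 v : 'rV[R]_n) (l0 l1 V : R).
Hypothesis vV : `|v| <= V.
Hypothesis l0_ge0 : 0 <= l0.
Hypothesis l1_ge0 : 0 <= l1.
Hypothesis l01_gt0 : 0 < l0 + l1.
Local Notation cen := (center_at c0 v).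
Local Notation rad := (radius_at l0 l1).
Local Notation den := (bump_at c0 v l0 l1).
Local Notation ker := (field_at c0 v l0 l1).

Let V0 : 0 <= V. Proof. exact: le_trans vV. Qed.

Lemma radius_at_gt0 t : 0 < t -> 0 < rad t.
Proof.
move=> t0; rewrite /radius_at; move: l0_ge0; rewrite le_eqVlt => /orP[/eqP l00|l0p].
  by rewrite -l00 add0r mulr_gt0//; move: l01_gt0; rewrite -l00 add0r.
by rewrite ltr_wpDr// mulr_ge0// ltW.
Qed.

Lemma ball_at_le t : 0 <= t <= 1 -> `|cen t| + rad t <= `|c0| + V + (l0 + l1).
Proof.
move=> /andP[t0 t1]; rewrite /center_at /radius_at lerD//.
  rewrite (le_trans (ler_normD _ _))// lerD2l normrZ ger0_norm//.
  by rewrite -[leRHS]mul1r ler_pM.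
by rewrite lerD2l ler_piMl.
Qed.

Variables (f : 'rV[R]_n -> R) (B L : R).
Hypothesis fB : forall x, `|f x| <= B.
Hypothesis L0 : 0 <= L.
Hypothesis fL : forall x y, `|f x - f y| <= L * `|x - y|.

Let cf : continuous f. Proof. exact: lip_continuous fL. Qed.
Let mf : measurable_fun setT f. Proof. exact: Defs.continuous_measurable_fun. Qed.
Let B0 : 0 <= B. Proof. exact: le_trans (fB 0). Qed.

(** The integral of f against the moving bump, written after rescaling so that it
    is meaningful, and Lipschitz in t, even when the radius vanishes. *)
Definition average_at (t : R) : R :=
  \int[mu]_z (f (cen t + rad t *: z) * ((bump_mass n)^-1 * bump z)).

Lemma integrable_average_at t :
  mu.-integrable setT (EFin \o (fun z => f (cen t + rad t *: z) * ((bump_mass n)^-1 * bump z))).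
Proof.
have m0 : 0 <= (bump_mass n)^-1 :> R by rewrite invr_ge0 ltW// bump_mass_gt0.
apply: (@bounded_supp_integrable _ _ _ (B * (bump_mass n)^-1) 1).
- apply: measurable_funM; last by apply: measurable_funM => //; exact: measurable_bump.
  exact: (measurableT_comp mf (measurable_affine_rV _ _)).
- move=> x; rewrite normrM ler_pM// ger0_norm ?ler_piMr ?bump_le1//.
  by rewrite mulr_ge0// bump_ge0.
- by move=> x x1; rewrite bump_supp// !mulr0.
Qed.

Lemma integral_normalised_bump : \int[mu]_z ((bump_mass n)^-1 * bump z) = 1 :> R.
Proof.
rewrite RintegralZl//; last exact: integrable_bump.
by rewrite mulVf// lt0r_neq0// bump_mass_gt0.
Qed.

Lemma integrable_normalised_bump : mu.-integrable setT (EFin \o (fun z => (bump_mass n)^-1 * bump z)).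
Proof. by apply: RintegrableZ => //; exact: integrable_bump. Qed.

(** A point of the moving ball has speed at most V + l1. *)
Lemma average_at_lip s t : `|average_at s - average_at t| <= L * (V + l1) * `|s - t|.
Proof.
have m0 : 0 <= (bump_mass n)^-1 :> R by rewrite invr_ge0 ltW// bump_mass_gt0.
have is_ := integrable_average_at s; have it := integrable_average_at t.
rewrite /average_at -RintegralB//.
apply: (le_trans (le_normr_Rintegral _ _)) => //; first exact: RintegrableB.
rewrite -[leRHS]mulr1 -integral_normalised_bump -RintegralZl//; last exact: integrable_normalised_bump.
apply: le_Rintegral => //.
- by apply: (@integrable_norm _ _ _ mu); exact: RintegrableB.
- by apply: RintegrableZ => //; exact: integrable_normalised_bump.
move=> z _; have nb0 : 0 <= (bump_mass n)^-1 * bump z by apply: mulr_ge0 => //; exact: bump_ge0.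
rewrite -mulrBl normrM [X in _ * X]ger0_norm//.
have [z1|z1] := ltP (dotv z z) 1; last by rewrite bump_eq0// !mulr0.
apply: ler_wpM2r => //.
rewrite (le_trans (fL _ _))// -mulrA ler_wpM2l//.
have -> : cen s + rad s *: z - (cen t + rad t *: z) = (s - t) *: (v + l1 *: z).
  by apply/rowP => j; rewrite /center_at /radius_at !mxE; ring.
rewrite normrZ mulrC ler_wpM2r// (le_trans (ler_normD _ _))// lerD//.
by rewrite normrZ ger0_norm// ler_piMr// dotv_norm.
Qed.

Lemma integral_bump_at t : 0 < rad t -> \int[mu]_x (f x * den t x) = average_at t.
Proof. by move=> r0; have [] := integral_mollifier (cen t) r0 mf fB. Qed.

Lemma partial_field_at_eq0 i t x : 0 < rad t -> `|cen t| + rad t < `|x| ->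
  partial i (ker i t) x = 0.
Proof.
move=> r0 /(coord_at_far r0) z1.
by rewrite (partial_field_at c0 v i i x (lt0r_neq0 r0)).2 bump_eq0// dbump_eq0// !mulr0 addr0 mulr0.
Qed.

(** Differentiate under the integral, use the continuity equation, and integrate
    by parts in x for a fixed t.  The radius stays away from 0 near t > 0, which
    provides the domination. *)
Lemma is_derive_average_at (t : R) : 0 < t < 1 ->
  is_derive t 1 average_at (\sum_i \int[mu]_x (partial i f x * ker i t x)).
Proof.
move=> /andP[t0 t1].
have t2 : 0 < t / 2 by rewrite divr_gt0.
have tt : t / 2 < t by rewrite ltr_pdivrMr// ltr_pMr// ltr1n.
pose u := t / 2; pose m := rad u.
have m0 : 0 < m by exact: radius_at_gt0.
have Ir s : s \in `]u, 1[ -> [/\ 0 < s, s < 1, 0 < rad s & m <= rad s].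
  rewrite in_itv/= => /andP[us s1]; have s0 := lt_trans t2 us.
  split => //; first exact: radius_at_gt0.
  by rewrite /m /radius_at lerD2l ler_wpM2r// ltW.
(* Radius of a ball that contains all the moving balls. *)
pose rho := `|c0| + V + (l0 + l1).
have far s (x : 'rV[R]_n) : s \in `]u, 1[ -> rho < `|x| -> `|cen s| + rad s < `|x|.
  by move=> /Ir[s0 s1 _ _]; apply: le_lt_trans; apply: ball_at_le; rewrite !ltW.
pose K := (bump_mass n)^-1 * m^-1 ^+ n.+1 * (l1 + 4 * (V + l1)).
have mass0 : 0 <= (bump_mass n)^-1 :> R by rewrite invr_ge0 ltW// bump_mass_gt0.
have l1V : 0 <= l1 + 4 * (V + l1) by rewrite addr_ge0// mulr_ge0// addr_ge0.
have K0 : 0 <= K by rewrite !mulr_ge0// exprn_ge0// invr_ge0 ltW.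
have pK i s x : s \in `]u, 1[ -> `|partial i (ker i s) x| <= K.
  move=> /Ir[s0 s1 r0 mr]; rewrite (le_trans (partial_field_at_le c0 vV l1_ge0 i i x r0))//.
  rewrite ler_wpM2r// ler_wpM2l// lerXn2r ?nnegrE ?invr_ge0 ?(ltW r0) ?(ltW m0)//.
  by rewrite lef_pV2.
pose C := [set x : 'rV[R]_n | `|x| <= rho].
pose G (x : 'rV[R]_n) := B * (n%:R * K) * \1_C x.
have BK0 : 0 <= B * (n%:R * K) by apply: mulr_ge0 => //; apply: mulr_ge0.
have It : t \in `]u, 1[ by rewrite in_itv/= tt.
have iF s : s \in `]u, 1[ -> mu.-integrable setT (EFin \o (fun x => f x * den s x)).
  by move=> /Ir[_ _ r0 _]; have [] := integral_mollifier (cen s) r0 mf fB.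
have dF s x : s \in `]u, 1[ -> is_derive s 1 (fun s => f x * den s x)
    (f x * - \sum_i partial i (ker i s) x).
  move=> /Ir[_ _ r0 _]; have := is_deriveZ (f x) (is_derive_bump_at c0 v x (lt0r_neq0 r0)).
  by [].
have iG : mu.-integrable setT (EFin \o G).
  apply: (@bounded_supp_integrable _ _ _ (B * (n%:R * K)) rho).
  - by apply: measurable_funM => //; apply: measurable_indic; exact: measurable_cube.
  - move=> x; rewrite /G normrM ger0_norm// ler_piMr//.
    by rewrite indicE; case: (_ \in _); rewrite ?normr0 ?normr1.
  - by move=> x xr; rewrite /G indicE memNset ?mulr0// /C/= leNgt xr.
have G0 x : 0 <= G x by rewrite mulr_ge0.
have dG s x : s \in `]u, 1[ -> `|f x * - \sum_i partial i (ker i s) x| <= G x.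
  move=> Is; rewrite /G indicE; case: (boolP (x \in C)) => [_|].
    rewrite mulr1 normrM ler_pM// normrN (le_trans (ler_norm_sum _ _ _))//.
    rewrite mulr_natl -[X in _ <= _ *+ X](card_ord n) -sumr_const ler_sum// => i _.
    exact: pK.
  rewrite notin_setE /C/= => /negP; rewrite -ltNge => xr.
  rewrite mulr0 big1 ?oppr0 ?mulr0 ?normr0// => i _.
  have [_ _ r0 _] := Ir s Is; apply: partial_field_at_eq0 => //; exact: far.
have I1 : `]u, 1[%classic t by [].
have d1 (s : R) (x : 'rV[R]_n) : `]u, 1[%classic s -> setT x -> derivable (fun s => f x * den s x) s 1.
  by move=> Is _; exact: (@ex_derive _ _ _ _ _ _ _ (dF s x Is)).
have d2 (s : R) (x : 'rV[R]_n) : `]u, 1[%classic s -> setT x ->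
    `|partial1of2 (fun s x => f x * den s x) s x| <= G x.
  by move=> Is _; rewrite partial1of2E (@derive_val _ _ _ _ _ _ _ (dF s x Is)); exact: dG.
have := @differentiation_under_integral _ _ _ mu (fun s x => f x * den s x) setT
  measurableT t u 1 I1 iF d1 G G0 iG d2.
have := @derivable_under_integral _ _ _ mu (fun s x => f x * den s x) setT
  measurableT t u 1 I1 iF d1 G G0 iG d2.
rewrite derive1E => parm_bump dv.
have {}parm_bump : is_derive t 1 (fun s => \int[mu]_x (f x * den s x))
    (\sum_i \int[mu]_x (partial i f x * ker i t x)).
  split => //; rewrite dv.
  have [_ _ r0 _] := Ir t It.
  transitivity (\int[mu]_x (\sum_i - (partial i (ker i t) x * f x))).
    apply: eq_Rintegral => x _; rewrite partial1of2E (@derive_val _ _ _ _ _ _ _ (dF t x It)).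
    by rewrite -sumrN mulr_sumr; apply: eq_bigr => i _; rewrite mulrN mulrC.
  have [rho0] : 0 <= rho by rewrite !addr_ge0.
  have ib i : [/\ mu.-integrable setT (EFin \o (fun x => partial i f x * ker i t x)),
      mu.-integrable setT (EFin \o (fun x => partial i (ker i t) x * f x)) &
      \int[mu]_x (partial i f x * ker i t x) = - \int[mu]_x (partial i (ker i t) x * f x)].
    have [M M0 kM] := field_at_lip c0 vV l1_ge0 i r0.
    apply: (lip_ibp i fB L0 fL M0 kM rho0) => x xr.
    by apply: field_at_supp => //; exact: far.
  have iN i : mu.-integrable setT (EFin \o (fun x => - (partial i (ker i t) x * f x))).
    have [_ ii _] := ib i; have := RintegrableZ (-1) measurableT ii.
    by apply: eq_integrable => // x _; rewrite /= mulN1r.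
  rewrite /Rintegral; under eq_integral do rewrite -sumEFin.
  rewrite integral_sum//.
  rewrite (eq_bigr (fun i => (\int[mu]_x (partial i f x * ker i t x))%:E)).
    by rewrite sumEFin.
  move=> i _; have [_ ii ->] := ib i.
  rewrite -[- _]mulN1r -RintegralZl// /Rintegral fineK.
    by apply: eq_integral => x _; rewrite mulN1r.
  apply: integrable_fin_num => //.
  exact: RintegrableZ.
apply: near_eq_is_derive parm_bump; rewrite ?oner_eq0//.
have := near_in_itvoo It; apply: filterS => s /Ir[_ _ r0 _].
exact: integral_bump_at.
Qed.

(** The moving average is Lipschitz up to t = 0, so the fundamental theorem of
    calculus holds on the whole of ]0, 1[ although the field is singular at the
    starting point. *)
Lemma line_transport : average_at 1 - average_at 0 =
  \int[leb]_(t in `]0, 1[) \sum_i \int[mu]_x (partial i f x * ker i t x).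
Proof. exact: (lip1_FTC average_at_lip is_derive_average_at). Qed.

End Transport.

(** * Fubini for real integrals and an integral of a power *)

Section MeasurableInv.
Context {R : realType}.

(** Write 1 / x as x times the square of a real power, to cover x = 0. *)
Lemma measurable_inv : measurable_fun setT (fun x : R => x^-1).
Proof.
have -> : (fun x : R => x^-1) = (fun x => x * (`|x| `^ (-1)) ^+ 2).
  apply/funext => x; rewrite powR_inv1// exprVn real_normK ?num_real//.
  have [->|x0] := eqVneq x 0; first by rewrite invr0 mul0r.
  by rewrite expr2 invfM mulrA mulfV// mul1r.
apply: measurable_funM => //; apply: measurable_funX.
exact: (measurableT_comp (measurable_powR (-1))).
Qed.

End MeasurableInv.

Section RFubini.
Context d1 d2 (T1 : measurableType d1) (T2 : measurableType d2) (R : realType).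
Variable m1 : {sigma_finite_measure set T1 -> \bar R}.
Variable m2 : {sigma_finite_measure set T2 -> \bar R}.

Lemma integrable_fine d (T : measurableType d) (m : {measure set T -> \bar R})
    (F : T -> \bar R) : m.-integrable setT F ->
  m.-integrable setT (EFin \o (fine \o F)) /\
  (\int[m]_x (fine (F x))%:E = \int[m]_x F x)%E.
Proof.
move=> iF; have /integrableP[mF F_lty] := iF.
have mf : measurable_fun setT (EFin \o (fine \o F)).
  by apply/measurable_EFinP; exact: measurableT_comp.
have ae : ae_eq m setT (EFin \o (fine \o F)) F.
  apply: ae_sub (integrable_ae measurableT iF) => x /= /(_ I) Fx _.
  by rewrite fineK.
split; last exact: ae_eq_integral.
apply/integrableP; split => //.
rewrite (ge0_ae_eq_integral (g := fun x => `|F x|%E))//.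
- exact: measurableT_comp.
- exact: measurableT_comp.
- by apply: ae_sub ae => x /= /(_ I) E _; rewrite -E.
Qed.

Lemma Rfubini1 (g : T1 * T2 -> R) : (m1 \x m2)%E.-integrable setT (EFin \o g) ->
  m1.-integrable setT (EFin \o (fun x => \int[m2]_y g (x, y))) /\
  \int[m1]_x (\int[m2]_y g (x, y)) = \int[(m1 \x m2)%E]_z g z.
Proof.
move=> ig; have iF := integrable_fubini_F ig.
have [i1 E] := integrable_fine iF; split => //.
by rewrite /Rintegral -(integral12_prod_meas1 ig) -E.
Qed.

Lemma Rfubini2 (g : T1 * T2 -> R) : (m1 \x m2)%E.-integrable setT (EFin \o g) ->
  m2.-integrable setT (EFin \o (fun y => \int[m1]_x g (x, y))) /\
  \int[m2]_y (\int[m1]_x g (x, y)) = \int[(m1 \x m2)%E]_z g z.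
Proof.
move=> ig; have mg := measurable_int _ ig.
have iF : m2.-integrable setT (fun y => \int[m1]_x (g (x, y))%:E)%E.
  apply/integrableP; split; first exact: (measurable_fubini_G ig).
  have ma : measurable_fun setT (fun z => `|(g z)%:E|)%E by exact: measurableT_comp.
  apply: le_lt_trans ((integrable21ltyP m1 m2 mg).1 ig).
  apply: ge0_le_integral => //.
  - by apply: measurableT_comp => //; exact: (measurable_fubini_G ig).
  - by apply: (@measurable_fun_fubini_tonelli_G _ _ _ _ R m1 (fun z => `|(g z)%:E|%E)).
  - move=> y _; apply: le_abse_integral => //.
    by apply: (measurableT_comp mg); exact: measurable_pair2.
have [i1 E] := integrable_fine iF; split => //.
by rewrite /Rintegral -(integral21_prod_meas1 ig) -E.
Qed.

End RFubini.

Section PowerIntegral.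
Context {R : realType}.
Local Notation leb := (@lebesgue_measure R).

(** Exhaust ]0, 1[ by [1 / k, 1], where the primitive t^(1 - a) / (1 - a) applies. *)
Lemma integral_powR_lty (a : R) : a < 1 ->
  (\int[leb]_(t in `]0%R, 1%R[) (t `^ (- a))%:E < +oo)%E.
Proof.
move=> a1; have b0 : 0 < 1 - a by rewrite subr_gt0.
pose F (k : nat) : set R := `[k.+2%:R^-1, 1]%classic.
have mF k : measurable (F k) by exact: measurable_itv.
have mp : measurable_fun setT (fun t : R => (t `^ (- a))%:E).
  by apply/measurable_EFinP; exact: measurable_powR.
have p0 (t : R) : (0 <= (t `^ (- a))%:E)%E by rewrite lee_fin powR_ge0.
have k1 (k : nat) : k.+2%:R^-1 < 1 :> R by rewrite invf_lt1 ?ltr1n// ltr0n.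
have k0 (k : nat) : 0 < k.+2%:R^-1 :> R by rewrite invr_gt0 ltr0n.
have ndF : nondecreasing_seq F.
  move=> m n mn; apply/subsetPset => x; rewrite /F/= !in_itv/= => /andP[mx ->].
  by rewrite andbT (le_trans _ mx)// lef_pV2 ?posrE ?ltr0n// ler_nat.
have IF k : (\int[leb]_(t in F k) (t `^ (- a))%:E <= ((1 - a)^-1)%:E)%E.
  have pos (t : R) : k.+2%:R^-1 <= t -> 0 < t by apply: lt_le_trans.
  pose P (t : R) := (1 - a)^-1 * t `^ (1 - a).
  have dP (t : R) : 0 < t -> is_derive t 1 P (t `^ (- a)).
    move=> t0; have := is_deriveZ (1 - a)^-1 (is_derive1_powR (1 - a) t0).
    by rewrite /GRing.scale/= mulrA mulVf ?gt_eqF// mul1r addrAC subrr add0r.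
  have cP (t : R) : 0 < t -> {for t, continuous P}.
    by move=> t0; apply: differentiable_continuous; apply/derivable1_diffP;
      exact: (@ex_derive _ _ _ _ _ _ _ (dP t t0)).
  have cp (t : R) : 0 < t -> {for t, continuous (fun s : R => s `^ (- a))}.
    move=> t0; apply: differentiable_continuous; apply/derivable1_diffP.
    exact: (@ex_derive _ _ _ _ _ _ _ (is_derive1_powR (- a) t0)).
  rewrite (@continuous_FTC2 _ (fun s : R => s `^ (- a)) P _ _ (k1 k)).
  - rewrite -EFinB lee_fin /P powR1 mulr1 gerBl mulr_ge0 ?powR_ge0//.
    by rewrite invr_ge0 ltW.
  - apply: continuous_in_subspaceT => t; rewrite inE/= in_itv/= => /andP[kt _].
    by apply: cp; exact: pos.
  - split.
    + move=> t; rewrite in_itv/= => /andP[kt _].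
      exact: (@ex_derive _ _ _ _ _ _ _ (dP t (pos _ (ltW kt)))).
    + by apply: cvg_at_right_filter; exact: cP.
    + by apply: cvg_at_left_filter; exact: cP.
  - move=> t; rewrite in_itv/= => /andP[kt _]; rewrite derive1E.
    exact: (@derive_val _ _ _ _ _ _ _ (dP t (pos _ (ltW kt)))).
have c : (\int[leb]_(t in F k) (t `^ (- a))%:E @[k --> \oo] -->
    \int[leb]_(t in \bigcup_k F k) (t `^ (- a))%:E)%E.
  apply: ge0_nondecreasing_set_cvg_integral => //.
  by move=> i; exact: measurable_funTS.
have le : (\int[leb]_(t in \bigcup_k F k) (t `^ (- a))%:E <= ((1 - a)^-1)%:E)%E.
  rewrite -(cvg_lim _ c)//; apply: lime_le; first by apply/cvg_ex; eexists; exact: c.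
  exact: nearW.
apply: (@le_lt_trans _ _ (\int[leb]_(t in \bigcup_k F k) (t `^ (- a))%:E)%E).
  apply: ge0_subset_integral => //.
  - by apply: bigcup_measurable => k _; exact: mF.
  - exact: measurable_funTS.
  - move=> t /=; rewrite in_itv/= => /andP[t0 t1].
    have [k _ /(_ k (leqnn k)) kt] := near_infty_natSinv_lt (PosNum t0).
    exists k => //=; rewrite /F/= in_itv/= (ltW t1) andbT (le_trans _ (ltW kt))//.
    by rewrite lef_pV2 ?posrE ?ltr0n// ler_nat.
by rewrite (le_lt_trans le)// ltry.
Qed.

End PowerIntegral.

(** * Superposition of moving bumps *)

Section Superposition.
Context {R : realType}.
Variable n : nat.
Local Notation mu := (@lebesgueN R n).
Context d (S : measurableType d) (P : {sigma_finite_measure set S -> \bar R}).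
Variable D : set S.
Hypothesis mD : measurable D.
Hypothesis PD : (P D < +oo)%E.
Variables (time : S -> R) (c0 v : S -> 'rV[R]_n) (l0 l1 V : R).
Hypothesis mtime : measurable_fun setT time.
Hypothesis time01 : forall p, D p -> 0 < time p < 1.
Hypothesis mc0 : forall j, measurable_fun setT (fun p => c0 p 0 j).
Hypothesis mv : forall j, measurable_fun setT (fun p => v p 0 j).
Hypothesis vV : forall p, D p -> `|v p| <= V.
Hypothesis V0 : 0 <= V.
Hypothesis l0_ge0 : 0 <= l0.
Hypothesis l1_ge0 : 0 <= l1.
Hypothesis l01_gt0 : 0 < l0 + l1.

(** The parameter p collects the time and the starting point; D is the set of
    parameters in use. *)
Definition parm_field (i : 'I_n) (x : 'rV[R]_n) (p : S) : R :=
  \1_D p * field_at (c0 p) (v p) l0 l1 i (time p) x.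
Definition parm_bump (x : 'rV[R]_n) (p : S) : R :=
  \1_D p * bump_at (c0 p) (v p) l0 l1 (time p) x.

(** The superposition of the moving fields over all times and starting points. *)
Definition flow (i : 'I_n) (x : 'rV[R]_n) : R := \int[P]_p parm_field i x p.

Lemma parm_radius_gt0 p : D p -> 0 < radius_at l0 l1 (time p).
Proof. by move=> /time01/andP[t0 _]; exact: radius_at_gt0. Qed.

Lemma parm_bump_ge0 x p : 0 <= parm_bump x p.
Proof.
rewrite /parm_bump indicE; case: (boolP (p \in D)) => [|_]; last by rewrite mul0r.
by rewrite inE mul1r => /parm_radius_gt0 /ltW; exact: mollifier_ge0.
Qed.

Lemma parm_field_le i x p : `|parm_field i x p| <= (V + l1) * parm_bump x p.
Proof.
rewrite /parm_field /parm_bump indicE; case: (boolP (p \in D)) => [|_]; last by rewrite !mul0r mulr0 normr0.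
rewrite inE !mul1r => Dp.
exact: (field_at_le _ (vV Dp) l1_ge0 _ _ (parm_radius_gt0 Dp)).
Qed.

Let mX j : measurable_fun setT (fun z : 'rV[R]_n * S => z.1 0 j).
Proof. exact: (measurableT_comp (@measurable_coord R n j) measurable_fst). Qed.
Let mT : measurable_fun setT (fun z : 'rV[R]_n * S => time z.2).
Proof. exact: (measurableT_comp mtime measurable_snd). Qed.
Let mC j : measurable_fun setT (fun z : 'rV[R]_n * S => c0 z.2 0 j).
Proof. exact: (measurableT_comp (mc0 j) measurable_snd). Qed.
Let mV j : measurable_fun setT (fun z : 'rV[R]_n * S => v z.2 0 j).
Proof. exact: (measurableT_comp (mv j) measurable_snd). Qed.
Let mI : measurable_fun setT (fun z : 'rV[R]_n * S => \1_D z.2 : R).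
Proof.
by apply: (measurableT_comp _ measurable_snd); apply: measurable_indic; exact: mD.
Qed.
Let mRi : measurable_fun setT (fun z : 'rV[R]_n * S => (radius_at l0 l1 (time z.2))^-1).
Proof.
apply: (measurableT_comp measurable_inv); rewrite /radius_at.
by apply: measurable_funD => //; exact: measurable_funM.
Qed.
Let mZ j : measurable_fun setT
  (fun z : 'rV[R]_n * S => coord_at (c0 z.2) (v z.2) l0 l1 (time z.2) z.1 0 j).
Proof.
have -> : (fun z : 'rV[R]_n * S => coord_at (c0 z.2) (v z.2) l0 l1 (time z.2) z.1 0 j) =
  (fun z => (radius_at l0 l1 (time z.2))^-1 * (z.1 0 j - (c0 z.2 0 j + time z.2 * v z.2 0 j))).
  by apply/funext => z; rewrite /coord_at /center_at !mxE.
apply: measurable_funM => //; apply: measurable_funB => //.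
by apply: measurable_funD => //; exact: measurable_funM.
Qed.
Let mden : measurable_fun setT
  (fun z : 'rV[R]_n * S => bump_at (c0 z.2) (v z.2) l0 l1 (time z.2) z.1).
Proof.
rewrite /bump_at /mollifier; apply: measurable_funM => //; apply: measurable_funM.
  exact: measurable_funX.
exact: measurable_bump_comp.
Qed.

Lemma measurable_parm_bump : measurable_fun setT (fun z : 'rV[R]_n * S => parm_bump z.1 z.2).
Proof. exact: measurable_funM. Qed.

Lemma measurable_parm_field i : measurable_fun setT (fun z : 'rV[R]_n * S => parm_field i z.1 z.2).
Proof.
apply: measurable_funM => //; apply: measurable_funM => //.
by apply: measurable_funD => //; exact: measurable_funM.
Qed.

Lemma measurable_parm_bump1 p : measurable_fun setT (parm_bump^~ p).
Proof. exact: (measurableT_comp measurable_parm_bump (measurable_pair2 p)). Qed.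

Lemma measurable_parm_bump2 x : measurable_fun setT (parm_bump x).
Proof. exact: (measurableT_comp measurable_parm_bump (measurable_pair1 x)). Qed.

Lemma measurable_parm_field2 i x : measurable_fun setT (parm_field i x).
Proof. exact: (measurableT_comp (measurable_parm_field i) (measurable_pair1 x)). Qed.

Lemma integral_parm_bump p : (\int[mu]_x (parm_bump x p)%:E = (\1_D p)%:E)%E.
Proof.
rewrite /parm_bump indicE; case: (boolP (p \in D)) => [|_]; last first.
  by under eq_integral do rewrite mul0r; rewrite integral0.
rewrite inE => /parm_radius_gt0 r0; under eq_integral do rewrite mul1r.
have cB (x : 'rV[R]_n) : `|(1 : R)| <= 1 by rewrite normr1.
have [i1 _] := integral_mollifier (center_at (c0 p) (v p) (time p)) r0 (@measurable_cst _ _ 'rV[R]_n R setT 1) cB.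
under [RHS]eq_Rintegral do rewrite mul1r.
rewrite (integral_normalised_bump n) => E.
have := integrable_fin_num measurableT i1.
under eq_integral do rewrite /= mul1r.
move=> /fineK <-; congr (_%:E); rewrite -E.
by congr fine; apply: eq_integral => x _; rewrite mul1r.
Qed.

Lemma integrable_parm_bump : (mu \x P)%E.-integrable setT (EFin \o (fun z => parm_bump z.1 z.2)).
Proof.
have mdd : measurable_fun setT (EFin \o (fun z : 'rV[R]_n * S => parm_bump z.1 z.2)).
  by apply/measurable_EFinP; exact: measurable_parm_bump.
apply/(integrable21ltyP mu P mdd).2.
under eq_integral do under eq_integral do rewrite /= ger0_norm ?parm_bump_ge0//.
under eq_integral do rewrite integral_parm_bump.
by rewrite integral_indic// setIT.
Qed.

Lemma integrable_parm_field i : (mu \x P)%E.-integrable setT (EFin \o (fun z => parm_field i z.1 z.2)).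
Proof.
apply: (@le_integrable _ _ _ _ _ measurableT _ (EFin \o (fun z => (V + l1) * parm_bump z.1 z.2))).
- by apply/measurable_EFinP; exact: measurable_parm_field.
- move=> z _; rewrite /= lee_fin (le_trans (parm_field_le _ _ _))// ler_norm.
  by [].
- by apply: RintegrableZ => //; exact: integrable_parm_bump.
Qed.

Lemma measurable_flow i : measurable_fun setT (flow i).
Proof.
have := measurable_fubini_F (integrable_parm_field i).
by move=> mF; apply: (measurableT_comp _ mF).
Qed.

Lemma integrable_flow i : mu.-integrable setT (EFin \o flow i).
Proof. exact: (Rfubini1 (integrable_parm_field i)).1. Qed.

(** The time spent near x by the moving bumps; it controls the flow because the
    bumps have bounded speed. *)
Definition occupation (x : 'rV[R]_n) : \bar R := (\int[P]_p (parm_bump x p)%:E)%E.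

Lemma flow_le i x : (`|flow i x|%:E <= (V + l1)%:E * occupation x)%E.
Proof.
have Vl0 : 0 <= V + l1 by rewrite addr_ge0.
have le1 : (`|\int[P]_p (parm_field i x p)%:E| <= (V + l1)%:E * occupation x)%E.
  rewrite /occupation -ge0_integralZl_EFin//; last 2 first.
    by move=> p _; rewrite lee_fin parm_bump_ge0.
    by apply/measurable_EFinP; exact: measurable_parm_bump2.
  apply: (le_trans (le_abse_integral _ _ _)) => //.
    by apply/measurable_EFinP; exact: measurable_parm_field2.
  apply: ge0_le_integral => //.
  - by apply: measurableT_comp => //; apply/measurable_EFinP; exact: measurable_parm_field2.
  - by apply: measurable_funeM; apply/measurable_EFinP; exact: measurable_parm_bump2.
  - by move=> p _; rewrite lee_fin parm_field_le.
rewrite /flow /Rintegral; move: le1.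
case: (integral _ _ _) => [r|_|_]; rewrite ?lee_fin//= normr0 mule_ge0 ?lee_fin//;
  by apply: integral_ge0 => p _; rewrite lee_fin parm_bump_ge0.
Qed.

Lemma flow_eq0 i x : (forall p, D p ->
    bump_at (c0 p) (v p) l0 l1 (time p) x = 0) -> flow i x = 0.
Proof.
move=> d0; apply/eqP; rewrite -normr_le0 -lee_fin.
apply: (le_trans (flow_le i x)); rewrite /occupation.
rewrite (_ : (fun p => _) = cst 0%E) ?integral0 ?mule0//.
apply/funext => p; rewrite /parm_bump indicE; case: (boolP (p \in D)) => [|_]; last by rewrite mul0r.
by rewrite inE => /d0 ->; rewrite mulr0.
Qed.

(** Fubini; the parameter integral of the bumps is finite because every bump
    has integral 1. *)
Lemma flow_pairing i (phi : 'rV[R]_n -> R) (L : R) :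
  measurable_fun setT phi -> (forall x, `|phi x| <= L) ->
  [/\ mu.-integrable setT (EFin \o (fun x => phi x * flow i x)),
      P.-integrable setT (EFin \o (fun p => \int[mu]_x (phi x * parm_field i x p))) &
      \int[mu]_x (phi x * flow i x) = \int[P]_p \int[mu]_x (phi x * parm_field i x p)].
Proof.
move=> mphi phiL.
pose g (z : 'rV[R]_n * S) := phi z.1 * parm_field i z.1 z.2.
have L0 : 0 <= L := le_trans (normr_ge0 _) (phiL 0).
have mg : measurable_fun setT g.
  apply: measurable_funM; last exact: measurable_parm_field.
  exact: (measurableT_comp mphi measurable_fst).
have ig : (mu \x P)%E.-integrable setT (EFin \o g).
  apply: (@le_integrable _ _ _ _ _ measurableT _ (EFin \o (fun z => L * ((V + l1) * parm_bump z.1 z.2)))).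
  - exact/measurable_EFinP.
  - move=> z _; rewrite /= lee_fin /g normrM (le_trans _ (ler_norm _))// ler_pM//.
    exact: parm_field_le.
  - by apply: RintegrableZ => //; apply: RintegrableZ => //; exact: integrable_parm_bump.
have [i1 E1] := Rfubini1 ig; have [i2 E2] := Rfubini2 ig.
have /integrableP[mphiE _] := integrable_parm_field i.
have iflow := integrable_flow i.
have imul : mu.-integrable setT (EFin \o (fun x => phi x * flow i x)).
  apply: (@le_integrable _ _ _ _ _ measurableT _ (EFin \o (fun x => L * flow i x))).
  - by apply/measurable_EFinP; apply: measurable_funM => //; exact: measurable_flow.
  - move=> x _; rewrite /= lee_fin !normrM ler_wpM2r// (le_trans (phiL x))// ler_norm.
    by [].
  - exact: RintegrableZ.
split => //; rewrite E2 -E1; rewrite /Rintegral; congr fine.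
apply: ae_eq_integral => //.
- by have /integrableP[] := imul.
- by have /integrableP[] := i1.
apply: ae_sub (ae_integrable1 (integrable_parm_field i)) => x ix _ /=; congr EFin.
by rewrite /flow -/(Rintegral _ _ _) -RintegralZl.
Qed.

(** If after time s no bump meets T, only the parameters of time less than s
    contribute, each of them with a bump of integral 1. *)
Lemma integral_flow_le i (T : set 'rV[R]_n) (s : R) : measurable T ->
  (forall x p, T x -> D p -> s <= time p -> bump_at (c0 p) (v p) l0 l1 (time p) x = 0) ->
  (\int[mu]_(x in T) (`|flow i x|)%:E <= (V + l1)%:E * P [set p | D p /\ (time p < s)%R])%E.
Proof.
move=> mT' dT; pose E := D `&` time @^-1` `]-oo, s[%classic.
have Vl0 : 0 <= V + l1 by rewrite addr_ge0.
have mE : measurable E.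
  apply: measurableI => //; rewrite -[X in measurable X]setTI.
  by apply: mtime => //; exact: measurable_itv.
have -> : [set p | D p /\ time p < s] = E.
  by apply/seteqP; split => p [Dp /=]; rewrite ?in_itv/= => ts; split => //=; rewrite in_itv.
have mocc : measurable_fun setT occupation.
  apply: (@measurable_fun_fubini_tonelli_F _ _ _ _ R P (fun z => (parm_bump z.1 z.2)%:E)).
    by apply/measurable_EFinP; exact: measurable_parm_bump.
  by move=> z; rewrite lee_fin parm_bump_ge0.
apply: (@le_trans _ _ (\int[mu]_(x in T) ((V + l1)%:E * occupation x))%E).
  apply: ge0_le_integral => //.
  - by apply/measurable_EFinP; apply: measurableT_comp => //; apply: measurable_funTS; exact: measurable_flow.
  - by apply: measurable_funeM; exact: measurable_funTS.
  - by move=> x _; exact: flow_le.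
rewrite ge0_integralZl_EFin//; last 2 first.
- by move=> x _; apply: integral_ge0 => p _; rewrite lee_fin parm_bump_ge0.
- exact: measurable_funTS.
rewrite lee_wpmul2l ?lee_fin//.
rewrite integral_mkcond.
pose h (z : 'rV[R]_n * S) : \bar R := (\1_T z.1 * parm_bump z.1 z.2)%:E.
have mh : measurable_fun setT h.
  apply/measurable_EFinP; apply: measurable_funM; last exact: measurable_parm_bump.
  apply: (measurableT_comp _ measurable_fst); exact: measurable_indic.
have h0 z : (0 <= h z)%E by rewrite lee_fin mulr_ge0// parm_bump_ge0.
have -> : occupation \_ T = (fun x => \int[P]_p h (x, p))%E.
  apply/funext => x; rewrite patchE /h/= indicE; case: ifPn => xT.
    by apply: eq_integral => p _; rewrite mul1r.
  by rewrite (_ : (fun p => _) = cst 0%E) ?integral0//; apply/funext => p; rewrite mul0r.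
rewrite (@fubini_tonelli _ _ _ _ R mu P h mh h0) -[X in (_ <= P X)%E]setIT -integral_indic//.
apply: ge0_le_integral => //.
- by move=> p _; apply: integral_ge0.
- exact: (@measurable_fun_fubini_tonelli_G _ _ _ _ R mu h mh h0).
- by apply/measurable_EFinP; exact: measurable_indic.
move=> p _; rewrite indicE; case: (boolP (p \in E)) => [_|].
  apply: (@le_trans _ _ (\int[mu]_x (parm_bump x p)%:E)%E).
    apply: ge0_le_integral => //.
    - by apply: (measurableT_comp mh); exact: measurable_pair2.
    - by apply/measurable_EFinP; exact: measurable_parm_bump1.
    - move=> x _; by rewrite lee_fin ler_piMl ?parm_bump_ge0.
  by rewrite integral_parm_bump lee_fin indicE; case: (p \in D).
rewrite notin_setE => nE; rewrite integral0_eq// => x _; congr EFin.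
rewrite /parm_bump !indicE; case: (boolP (p \in D)) => [|_]; last by rewrite mul0r mulr0.
rewrite inE => Dp; case: (boolP (x \in T)) => [|_]; last by rewrite mul0r.
rewrite inE => Tx; rewrite dT ?mulr0// leNgt; apply/negP => ts; apply: nE.
by split => //=; rewrite in_itv.
Qed.

Variable r : R.
Hypothesis r0 : 0 < r.
Hypothesis rad_ge : forall p, D p -> r * time p <= radius_at l0 l1 (time p).
Hypothesis intD : forall a, a < 1 ->
  (\int[P]_p (\1_D p * time p `^ (- a))%:E < +oo)%E.
Lemma flow_L1 i : flow i \in Lfun mu 1%:E.
Proof.
apply/(Lfun1_integrable _ _).2.
exact: integrable_flow.
Qed.

Let M : R := (bump_mass n)^-1 * r^-1 ^+ n.

Let M0 : 0 <= M.
Proof.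
by rewrite mulr_ge0 ?exprn_ge0 ?invr_ge0 ?(ltW r0)// ltW// bump_mass_gt0.
Qed.

(** At time t the bump is at most M t^-n, and one factor of it is kept. *)
Lemma parm_bump_powR_le (q : R) x p : 1 < q -> D p ->
  (parm_bump x p) `^ q <= M `^ (q - 1) * time p `^ (- (n%:R * (q - 1))) * parm_bump x p.
Proof.
move=> q1 Dp; have q10 : 0 < q - 1 by rewrite subr_gt0.
have /andP[t0 _] := time01 Dp.
have rp : 0 < radius_at l0 l1 (time p) by exact: parm_radius_gt0.
have t0' := ltW t0.
have ddM : parm_bump x p <= M * (time p) `^ (- n%:R).
  rewrite powR_invn// -exprVn.
  rewrite /parm_bump indicE mem_set// mul1r.
  rewrite (le_trans (mollifier_le _ _ (ltW rp)))// /M -mulrA ler_wpM2l//.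
    by rewrite invr_ge0 ltW// bump_mass_gt0.
  rewrite -exprMn -invfM lerXn2r ?nnegrE ?invr_ge0 ?mulr_ge0 ?(ltW r0) ?(ltW rp)//.
  by rewrite lef_pV2 ?posrE ?mulr_gt0 ?rad_ge.
rewrite -mulr_powRB1 ?parm_bump_ge0 ?(lt_trans ltr01)// mulrC ler_wpM2r ?parm_bump_ge0//.
have Mt0 : 0 <= M * time p `^ (- n%:R) by apply: mulr_ge0 => //; exact: powR_ge0.
rewrite (le_trans (ge0_ler_powR (ltW q10) _ _ ddM)) ?nnegrE ?parm_bump_ge0//.
by rewrite powRM ?powR_ge0// -powRrM mulNr.
Qed.

Lemma integral_parm_bump_powR (q : R) p : 1 < q -> D p ->
  (\int[mu]_x ((parm_bump x p) `^ q)%:E <=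
   (M `^ (q - 1) * time p `^ (- (n%:R * (q - 1))))%:E)%E.
Proof.
move=> q1 Dp; pose K := M `^ (q - 1) * time p `^ (- (n%:R * (q - 1))).
have K0 : 0 <= K by rewrite mulr_ge0 ?powR_ge0.
have md1 : measurable_fun setT (parm_bump^~ p) by exact: measurable_parm_bump1.
apply: (@le_trans _ _ (\int[mu]_x (K%:E * (parm_bump x p)%:E))%E).
  apply: ge0_le_integral => //.
  - by move=> x _; rewrite lee_fin powR_ge0.
  - by apply/measurable_EFinP; exact: (measurableT_comp (measurable_powR _) md1).
  - by apply: measurable_funeM; exact/measurable_EFinP.
  - by move=> x _; rewrite -EFinM lee_fin parm_bump_powR_le.
rewrite ge0_integralZl_EFin//; last 2 first.
- by move=> x _; rewrite lee_fin parm_bump_ge0.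
- exact/measurable_EFinP.
rewrite integral_parm_bump// /K indicE mem_set// mule1.
by [].
Qed.

(** Hoelder in the parameter, splitting the bump into (bump t^s) t^(-s).  The power
    t^(-s q') is integrable when s q' < 1, and the remaining integral of
    bump^q t^(s q) is of order t^(s q - n (q - 1)), which is integrable when
    n (q - 1) - s q < 1.  Both are possible exactly when q < n / (n - 1). *)
Lemma flow_Lp i (q : R) : 1 <= q -> q < n%:R / (n%:R - 1) ->
  flow i \in Lfun mu q%:E.
Proof.
rewrite le_eqVlt => /predU1P[<- _|q1 qn]; first exact: flow_L1.
have q0 : 0 < q := lt_trans ltr01 q1.
have q10 : 0 < q - 1 by rewrite subr_gt0.
have [n1 n1q] : 0 < n%:R - 1 :> R /\ (n%:R - 1) * q < n%:R.
  have n1 : 0 < n%:R - 1 :> R.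
    rewrite ltNge; apply/negP => n1.
    have : n%:R / (n%:R - 1) <= 0 :> R by rewrite mulr_ge0_le0// invr_le0.
    by rewrite leNgt (lt_trans q0 qn).
  by split => //; rewrite mulrC -ltr_pdivlMr.
(* s q is the midpoint of the interval ]n (q - 1) - 1, q - 1[ of admissible values. *)
pose s := ((n%:R * (q - 1) - 1) + (q - 1)) / 2 / q.
pose q' := q / (q - 1).
have q'0 : 0 < q' by rewrite divr_gt0.
have qq : q^-1 + q'^-1 = 1.
  by rewrite /q' invf_div; field; rewrite lt0r_neq0.
have sq : s * q = ((n%:R * (q - 1) - 1) + (q - 1)) / 2 by rewrite divfK// lt0r_neq0.
have s1 : n%:R * (q - 1) - s * q < 1 by rewrite sq; nra.
have s2 : s * q' < 1.
  rewrite /q' mulrA sq ltr_pdivrMr// mul1r; nra.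
have md2 x : measurable_fun setT (parm_bump x) by exact: measurable_parm_bump2.
have mpow a : measurable_fun setT (fun p => time p `^ a).
  exact: (measurableT_comp (measurable_powR _) mtime).
pose b p := \1_D p * time p `^ (- s).
have mb : measurable_fun setT b.
  by apply: measurable_funM => //; exact: measurable_indic.
pose a x p := parm_bump x p * time p `^ s.
have ma x : measurable_fun setT (a x) by exact: measurable_funM.
have occE x : occupation x = 'N[P]_1[EFin \o (a x \* b)%R]%E.
  rewrite Lnorm1; apply: eq_integral => p _ /=; congr EFin.
  rewrite /a /b /parm_bump indicE; case: (boolP (p \in D)) => [|_]; last by rewrite !mul0r normr0.
  rewrite inE => Dp; have /andP[t0 _] := time01 Dp.
  rewrite !mul1r -mulrA -powRD ?subrr ?eqxx ?lt0r_neq0// powRr0 mulr1 ger0_norm//.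
  by apply/mollifier_ge0/ltW; exact: parm_radius_gt0.
pose B := ('N[P]_q'%:E[EFin \o b] `^ q)%E.
have By : (B < +oo)%E.
  apply: poweR_lty; rewrite unlock; apply: poweR_lty.
  rewrite (eq_integral (fun p => (\1_D p * time p `^ (- (s * q')))%:E)); first exact: intD.
  move=> p _; rewrite /= /b; congr EFin; rewrite indicE; case: (p \in D).
    by rewrite !mul1r ger0_norm ?powR_ge0// -powRrM mulNr.
  by rewrite !mul0r normr0 powR0// lt0r_neq0.
pose A x := (\int[P]_p ((parm_bump x p) `^ q * time p `^ (s * q))%:E)%E.
have A0 x : (0 <= A x)%E.
  by apply: integral_ge0 => p _; rewrite lee_fin mulr_ge0 ?powR_ge0.
have B0 : (0 <= B)%E by exact: poweR_ge0.
have Vl : 0 <= V + l1 by rewrite addr_ge0.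
have occq x : (occupation x `^ q <= A x * B)%E.
  have -> : A x = ('N[P]_q%:E[EFin \o a x] `^ q)%E.
    rewrite poweR_Lnorm ?lt0r_neq0//; apply: eq_integral => p _ /=; congr EFin.
    have t0 : 0 <= time p `^ s by exact: powR_ge0.
    rewrite /a ger0_norm; last by apply: mulr_ge0 => //; exact: parm_bump_ge0.
    by rewrite (powRM _ (parm_bump_ge0 x p) t0) powRrM.
  rewrite -poweRM ?Lnorm_ge0//; apply: gt0_ler_poweR; rewrite ?(ltW q0)//.
  - by rewrite in_itv/= leey andbT; rewrite occE Lnorm_ge0.
  - by rewrite in_itv/= leey andbT mule_ge0 ?Lnorm_ge0.
  - by rewrite occE; exact: hoelder.
have Vlq : (0 <= ((V + l1) `^ q)%:E)%E by rewrite lee_fin powR_ge0.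
have flowq x : ((`|flow i x| `^ q)%:E <= ((V + l1) `^ q)%:E * (A x * B))%E.
  have occ0 : (0 <= occupation x)%E by rewrite occE Lnorm_ge0.
  apply: (@le_trans _ _ (((V + l1)%:E * occupation x) `^ q)%E); last first.
    by rewrite poweRM ?lee_fin// poweR_EFin lee_wpmul2l.
  rewrite -poweR_EFin; apply: gt0_ler_poweR; rewrite ?(ltW q0)//.
  - by rewrite in_itv/= leey andbT.
  - by rewrite in_itv/= leey andbT mule_ge0.
  - exact: flow_le.
have mh : measurable_fun setT
   (fun z : 'rV[R]_n * S => ((parm_bump z.1 z.2) `^ q * time z.2 `^ (s * q))%:E).
  apply/measurable_EFinP; apply: measurable_funM.
    exact: (measurableT_comp (measurable_powR _) measurable_parm_bump).
  exact: (measurableT_comp (mpow _) measurable_snd).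
have h0 (z : 'rV[R]_n * S) : (0 <= ((parm_bump z.1 z.2) `^ q * time z.2 `^ (s * q))%:E)%E.
  by rewrite lee_fin mulr_ge0 ?powR_ge0.
have mA : measurable_fun setT A.
  exact: (@measurable_fun_fubini_tonelli_F _ _ _ _ R P _ mh h0).
have Ay : (\int[mu]_x A x < +oo)%E.
  rewrite /A (@fubini_tonelli _ _ _ _ R mu P _ mh h0)/=.
  apply: (@le_lt_trans _ _ (\int[P]_p ((M `^ (q - 1))%:E *
     (\1_D p * time p `^ (- (n%:R * (q - 1) - s * q)))%:E))%E); last first.
    rewrite ge0_integralZl_EFin ?powR_ge0//; last 2 first.
    - by move=> p _; rewrite lee_fin mulr_ge0 ?powR_ge0.
    - by apply/measurable_EFinP; apply: measurable_funM => //; exact: measurable_indic.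
    by rewrite lte_mul_pinfty ?lee_fin ?powR_ge0//; exact: intD.
  apply: ge0_le_integral => //.
  - by move=> p _; apply: integral_ge0 => x _; exact: (h0 (x, p)).
  - exact: (@measurable_fun_fubini_tonelli_G _ _ _ _ R mu _ mh h0).
  - by apply: measurable_funeM; apply/measurable_EFinP; apply: measurable_funM.
  move=> p _; case: (boolP (p \in D)) => [|pD].
    rewrite inE => Dp; have /andP[t0 _] := time01 Dp.
    under eq_integral do rewrite mulrC EFinM.
    rewrite ge0_integralZl_EFin ?powR_ge0//; last 2 first.
    - by move=> x _; rewrite lee_fin powR_ge0.
    - apply/measurable_EFinP; apply: (measurableT_comp (measurable_powR _)).
      exact: (measurable_parm_bump1 p).
    rewrite indicE mem_set// mul1r.
    apply: (le_trans (lee_wpmul2l _ (integral_parm_bump_powR q1 Dp))); first by rewrite lee_fin powR_ge0.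
    rewrite -!EFinM lee_fin mulrCA -powRD ?(lt0r_neq0 t0) ?implybT//.
    by rewrite opprB.
  rewrite integral0_eq; first by rewrite indicE (negbTE pD) mul0r mule0.
  move=> x _; rewrite /parm_bump indicE (negbTE pD) mul0r powR0 ?lt0r_neq0//.
  by rewrite mul0r.
rewrite inE; apply/andP; split; rewrite inE.
  exact: measurable_flow.
rewrite /= /finite_norm unlock; apply: poweR_lty.
have mfl : measurable_fun setT (flow i) by exact: measurable_flow.
have Bf : B \is a fin_num by rewrite ge0_fin_numE.
pose K := (V + l1) `^ q * fine B.
have K0 : 0 <= K by rewrite mulr_ge0 ?powR_ge0// fine_ge0.
apply: (@le_lt_trans _ _ (\int[mu]_x (K%:E * A x))%E).
  apply: ge0_le_integral => //.
  - by move=> x _; exact: poweR_ge0.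
  - apply/measurable_EFinP; apply: (measurableT_comp (measurable_powR _)).
    by apply: measurableT_comp.
  - exact: measurable_funeM.
  - by move=> x _; rewrite (le_trans (flowq x))// [(A x * B)%E]muleC muleA /K EFinM fineK.
by rewrite ge0_integralZl_EFin// lte_mul_pinfty.
Qed.

End Superposition.

(** * Streams driven by a finite measure *)

Section PartialBound.
Context {R : realType}.

(** At a point where the derivative does not exist its value is the default
    point, hence the extra term. *)
Lemma partial_bound n (i : 'I_n) (f : 'rV[R]_n -> R) (L : R) : 0 <= L ->
  (forall x y, `|f x - f y| <= L * `|x - y|) ->
  forall x, `|partial i f x| <= L + `|(point : R)|.
Proof.
move=> L0 fL x; case: (pselect (derivable f x (delta_mx 0 i))) => [dx|ndx].
  apply: (@le_trans _ _ L); last by rewrite lerDl.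
  have {}dx : (diff_quot i f)^~ x @ 0^' --> partial i f x by exact: dx.
  rewrite ler_norml; apply/andP; split.
    apply: (limr_ge dx).
    by near=> h; have := diff_quot_lip i h x L0 fL; rewrite ler_norml => /andP[].
  apply: (limr_le dx).
  by near=> h; have := diff_quot_lip i h x L0 fL; rewrite ler_norml => /andP[].
have -> : partial i f x = (point : R).
  by rewrite partialE; apply: dvgP => c; exact: ndx.
by rewrite lerDr.
Unshelve. all: by end_near. Qed.

End PartialBound.

Section RintegralSum.
Context d (T : measurableType d) (R : realType) (m : {measure set T -> \bar R}).
Variables (D : set T) (mD : measurable D) (I : finType) (G : I -> T -> R).
Hypothesis iG : forall i, m.-integrable D (EFin \o G i).

Lemma Rintegral_sum : m.-integrable D (EFin \o (fun x => \sum_i G i x)) /\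
  \sum_i \int[m]_(x in D) G i x = \int[m]_(x in D) \sum_i G i x.
Proof.
elim: (index_enum I) => [|i s [IH1 IH2]].
  rewrite (_ : (fun x => _) = cst 0); last by apply/funext => x; rewrite big_nil.
  by split; [exact: integrable0|rewrite big_nil Rintegral_cst// mul0r].
rewrite (_ : (fun x => _) = (fun x => G i x + \sum_(j <- s) G j x)); last first.
  by apply/funext => x; rewrite big_cons.
by split; [exact: RintegrableD|rewrite big_cons IH2 RintegralD].
Qed.

End RintegralSum.

Section SigmaFiniteProduct.
Local Open Scope ereal_scope.
Context d1 d2 (T1 : measurableType d1) (T2 : measurableType d2) (R : realType).
Variable m1 : {sigma_finite_measure set T1 -> \bar R}.
Variable m2 : {sigma_finite_measure set T2 -> \bar R}.

(** The product measure under a name of its own, to give it a sigma-finite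
    structure. *)
Definition sf_prod : set (T1 * T2)%type -> \bar R := product_measure1 m1 m2.

HB.instance Definition _ := Measure.copy sf_prod (product_measure1 m1 m2).

Let sf_prod_sigma_finite : sigma_finite setT sf_prod.
Proof.
have /sigma_finiteP[F [TF ndF Foo]] := sigma_finiteT m1.
have /sigma_finiteP[G [TG ndG Goo]] := sigma_finiteT m2.
exists (fun n => F n `*` G n).
  apply/seteqP; split => // -[x y] _.
  have [i _ Fi] : (\bigcup_i F i) x by rewrite -TF.
  have [j _ Gj] : (\bigcup_i G i) y by rewrite -TG.
  exists (maxn i j) => //; split => /=.
    by have /subsetPset := ndF _ _ (leq_maxl i j); apply.
  by have /subsetPset := ndG _ _ (leq_maxr i j); apply.
move=> k; have [? ?] := Foo k; have [? ?] := Goo k.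
split; first exact: measurableX.
by rewrite /sf_prod product_measure1E// lte_mul_pinfty// ge0_fin_numE.
Qed.

HB.instance Definition _ := @Measure_isSigmaFinite.Build _ _ _ sf_prod
  sf_prod_sigma_finite.

End SigmaFiniteProduct.

Section Streams.
Context {R : realType}.
Variable n : nat.
Local Notation mu := (@lebesgueN R n).
Local Notation leb := (@lebesgue_measure R).
Variables (nu : {finite_measure set 'rV[R]_n -> \bar R}) (A : set 'rV[R]_n).
Hypothesis mA : measurable A.
Variables (c0 v : 'rV[R]_n -> 'rV[R]_n) (l0 l1 V : R).
Hypothesis mc0 : forall j, measurable_fun setT (fun y => c0 y 0 j).
Hypothesis mv : forall j, measurable_fun setT (fun y => v y 0 j).
Hypothesis vV : forall y, A y -> `|v y| <= V.
Hypothesis V0 : 0 <= V.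
Hypothesis l0_ge0 : 0 <= l0.
Hypothesis l1_ge0 : 0 <= l1.
Hypothesis l01_gt0 : 0 < l0 + l1.

Local Notation S := (measurableTypeR R * 'rV[R]_n)%type.
Definition parm_measure : {sigma_finite_measure set S -> \bar R} := sf_prod leb nu.
Let P := parm_measure.
Let I01 : set (measurableTypeR R) := `]0, 1[%classic.
Let D : set S := I01 `*` A.

(** The flow whose starting points are the points of A, distributed according
    to nu, and whose times are uniform in ]0, 1[. *)
Definition stream (i : 'I_n) : 'rV[R]_n -> R :=
  flow P D fst (fun p : S => c0 p.2) (fun p : S => v p.2) l0 l1 i.

Let mI01 : measurable I01. Proof. exact: measurable_itv. Qed.

Let mD : measurable D. Proof. exact: measurableX. Qed.

Let leb_itv (s : R) : 0 <= s -> leb (`]0, s[%classic : set (measurableTypeR R)) = s%:E.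
Proof.
move=> s0; apply: etrans (lebesgue_measure_itv (`]0, s[ : interval R)) _.
rewrite /= lte_fin; case: ltP => [_|]; first by rewrite oppr0 addr0.
by move=> s0'; congr EFin; apply/eqP; rewrite eq_le s0 s0'.
Qed.

Let P_slab (s : R) : 0 <= s ->
  P ((`]0, s[%classic : set (measurableTypeR R)) `*` A) = (s%:E * nu A)%E.
Proof.
move=> s0; apply: etrans (product_measure1E leb nu _ mA) _; first exact: measurable_itv.
by congr (_ * _)%E; exact: leb_itv.
Qed.

Let nuA_lty : (nu A < +oo)%E.
Proof. by rewrite ltey_eq fin_num_measure. Qed.

Let PD : (P D < +oo)%E.
Proof. by apply: (@le_lt_trans _ _ (1 * nu A)%E); [rewrite -P_slab|rewrite mul1e]. Qed.

Let mtime : measurable_fun setT (fst : S -> R).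
Proof. exact: measurable_fst. Qed.
Let time01 : forall p : S, D p -> 0 < p.1 < 1.
Proof. by move=> p [/=]; rewrite /I01/= in_itv. Qed.
Let mc0' j : measurable_fun setT (fun p : S => c0 p.2 0 j).
Proof. exact: (measurableT_comp (mc0 j) measurable_snd). Qed.
Let mv' j : measurable_fun setT (fun p : S => v p.2 0 j).
Proof. exact: (measurableT_comp (mv j) measurable_snd). Qed.
Let vV' (p : S) : D p -> `|v p.2| <= V.
Proof. by move=> [_ /vV]. Qed.

Lemma stream_Lp i (q : R) : 1 <= q -> q < n%:R / (n%:R - 1) ->
  stream i \in Lfun mu q%:E.
Proof.
apply: (@flow_Lp R n _ S P D mD PD fst _ _ l0 l1 V mtime time01 mc0' mv' vV' V0 l0_ge0 l1_ge0 l01_gt0 _ l01_gt0).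
  move=> p /time01/andP[t0 t1]; rewrite /radius_at mulrDl lerD//; last by rewrite mulrC.
  by rewrite ler_piMr// ltW.
move=> a a1.
pose g (z : S) : \bar R := (\1_D z * z.1 `^ (- a))%:E.
have mg : measurable_fun setT g.
  apply/measurable_EFinP; apply: measurable_funM; first exact: measurable_indic.
  exact: (measurableT_comp (measurable_powR _) mtime).
have g0 z : (0 <= g z)%E by rewrite lee_fin mulr_ge0 ?powR_ge0.
rewrite (@fubini_tonelli1 _ _ _ _ R leb nu g mg g0) /fubini_F.
have E (t : measurableTypeR R) : (\int[nu]_y g (t, y) = (\1_I01 t * t `^ (- a))%:E * nu A)%E.
  rewrite -(setIT A) -integral_indic// -ge0_integralZl_EFin//; last 2 first.
  - by apply/measurable_EFinP; exact: measurable_indic.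
  - by rewrite mulr_ge0 ?powR_ge0.
  apply: eq_integral => y _; rewrite /g -EFinM; congr EFin.
  rewrite /D !indicE in_setX/=; case: (t \in I01); case: (y \in A); rewrite ?mul1r ?mul0r ?mulr1 ?mulr0//.
under eq_integral do rewrite E.
have nuf : nu A \is a fin_num by rewrite fin_num_measure.
have p0 (t : measurableTypeR R) : (0 <= (\1_I01 t * t `^ (- a))%:E)%E.
  by rewrite lee_fin mulr_ge0 ?powR_ge0.
rewrite ge0_integralZr//; last first.
  by apply/measurable_EFinP; apply: measurable_funM; [exact: measurable_indic|exact: measurable_powR].
rewrite muleC lte_mul_pinfty//; last first.
apply: le_lt_trans (integral_powR_lty a1).
rewrite [leRHS]integral_mkcond le_eqVlt; apply/orP; left; apply/eqP.
apply: eq_integral => t _; rewrite patchE indicE.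
by case: (t \in I01); rewrite ?mul1r ?mul0r.
Qed.

Lemma stream_eq0 i x :
  (forall y t, A y -> 0 < t < 1 -> bump_at (c0 y) (v y) l0 l1 t x = 0) ->
  stream i x = 0.
Proof.
move=> d0; apply: (flow_eq0 P mD mtime time01 mc0' mv' vV' V0 l0_ge0 l1_ge0 l01_gt0).
by move=> p Dp; apply: d0; [exact: Dp.2|exact: time01].
Qed.

Lemma integral_stream_le i (T : set 'rV[R]_n) (s : R) : measurable T -> 0 <= s ->
  (forall x y t, T x -> A y -> 0 < t < 1 -> s <= t -> bump_at (c0 y) (v y) l0 l1 t x = 0) ->
  (\int[mu]_(x in T) (`|stream i x|)%:E <= ((V + l1) * s)%:E * nu A)%E.
Proof.
move=> mT s0 dT.
apply: (le_trans (integral_flow_le mD PD mtime time01 mc0' mv' vV' V0 l0_ge0 l1_ge0 l01_gt0 i mT (s := s) _)).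
  by move=> x p Tx Dp st; apply: dT => //; [exact: Dp.2|exact: time01].
rewrite EFinM -muleA lee_wpmul2l ?lee_fin ?addr_ge0//.
rewrite -P_slab//; apply: le_measure; rewrite ?inE.
- rewrite (_ : [set p : S | D p /\ p.1 < s] = D `&` fst @^-1` `]-oo, s[%classic).
    apply: measurableI => //; rewrite -[X in measurable X]setTI.
    by apply: mtime => //; exact: measurable_itv.
  by apply/seteqP; split => p [Dp /=]; rewrite ?in_itv/= => ts; split => //=; rewrite in_itv.
- apply: measurableX => //; exact: measurable_itv.
- move=> p [[/= + Ap] ps]; rewrite /I01/= in_itv/= => /andP[t0 _]; split => //=.
  by rewrite in_itv/= t0.
Qed.

Variables (f : 'rV[R]_n -> R) (B L : R).
Hypothesis fB : forall x, `|f x| <= B.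
Hypothesis L0 : 0 <= L.
Hypothesis fL : forall x y, `|f x - f y| <= L * `|x - y|.

(** Fubini brings the time integral inside, where line_transport applies to
    each starting point. *)
Lemma stream_pairing : \sum_i \int[mu]_x (partial i f x * stream i x) =
  \int[nu]_(y in A) (average_at (c0 y) (v y) l0 l1 f 1 - average_at (c0 y) (v y) l0 l1 f 0).
Proof.
have cf := lip_continuous fL.
have mpf i := @measurable_partial R n i f cf.
have pB i := partial_bound i L0 fL.
pose k i := parm_field D fst (fun p : S => c0 p.2) (fun p : S => v p.2) l0 l1 i.
pose G i (p : S) := \int[mu]_x (partial i f x * k i x p).
have Gi i : P.-integrable setT (EFin \o G i).
  by have [_ iG _] := flow_pairing mD PD mtime time01 mc0' mv' vV' l0_ge0 l1_ge0 l01_gt0 i (mpf i) (pB i).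
have GE i : \int[mu]_x (partial i f x * stream i x) = \int[P]_p G i p.
  by have [_ _] := flow_pairing mD PD mtime time01 mc0' mv' vV' l0_ge0 l1_ge0 l01_gt0 i (mpf i) (pB i).
under eq_bigr do rewrite GE.
have [sG sE] := Rintegral_sum measurableT Gi.
rewrite sE.
have [_ E2] := @Rfubini2 _ _ _ _ R leb nu _ sG.
transitivity (\int[nu]_y \int[leb]_t \sum_i G i (t, y)); first by rewrite E2.
rewrite [RHS]Rintegral_mkcond; apply: eq_Rintegral => y _.
rewrite patchE; case: ifPn => [|yA].
  rewrite inE => Ay.
  rewrite (line_transport (c0 y) (vV Ay) l0_ge0 l1_ge0 l01_gt0 fB L0 fL).
  rewrite [RHS]Rintegral_mkcond; apply: eq_Rintegral => t _.
  rewrite patchE; case: ifPn => t01.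
    apply: eq_bigr => i _; apply: eq_Rintegral => x _.
    by rewrite /k /parm_field indicE mem_set ?mul1r// /D; split => //; rewrite inE in t01.
  apply: big1 => i _; rewrite /G /k /parm_field.
  under eq_Rintegral do rewrite indicE /D in_setX (negbTE t01) mul0r mulr0.
  by rewrite Rintegral_cst// mul0r.
rewrite (_ : (fun t => _) = cst 0) ?Rintegral_cst ?mul0r//.
apply/funext => t; apply: big1 => i _; rewrite /G /k /parm_field.
under eq_Rintegral do rewrite indicE /D in_setX (negbTE yA) andbF mul0r mulr0.
by rewrite Rintegral_cst// mul0r.
Qed.

End Streams.

(** * Euclidean balls and the cone condition *)

Section Euclid.
Context {R : realType}.

Lemma lipschitzP n (f : 'rV[R]_n -> R) : lipschitz f ->
  exists2 L, 0 <= L & forall x y, `|f x - f y| <= L * `|x - y|.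
Proof.
move=> [M [Mr HM]]; exists (`|M| + 1); first by rewrite addr_ge0.
move=> x y; apply: (HM (`|M| + 1) _ (x, y)) => //.
by rewrite (le_lt_trans (ler_norm M))// ltrDl.
Qed.

Variable n : nat.
Implicit Types x y z : 'rV[R]_n.

Lemma dotvC x y : dotv x y = dotv y x.
Proof. by apply: eq_bigr => i _; rewrite mulrC. Qed.

Lemma dotvDl x y z : dotv (x + y) z = dotv x z + dotv y z.
Proof. by rewrite /dotv -big_split; apply: eq_bigr => i _; rewrite mxE mulrDl. Qed.

Lemma dotvZl a x y : dotv (a *: x) y = a * dotv x y.
Proof. by rewrite /dotv mulr_sumr; apply: eq_bigr => i _; rewrite mxE mulrA. Qed.

Lemma dotvDr x y z : dotv z (x + y) = dotv z x + dotv z y.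
Proof. by rewrite !(dotvC z) dotvDl. Qed.

Lemma dotvZr a x y : dotv x (a *: y) = a * dotv x y.
Proof. by rewrite !(dotvC x) dotvZl. Qed.

Lemma enorm_ge0 x : 0 <= enorm x. Proof. exact: sqrtr_ge0. Qed.

Lemma sqr_enorm x : enorm x ^+ 2 = dotv x x.
Proof. by rewrite sqr_sqrtr// dotv_ge0. Qed.

Lemma enormZ a x : enorm (a *: x) = `|a| * enorm x.
Proof. by rewrite /enorm dotvZl dotvZr mulrA -expr2 sqrtrM ?sqr_ge0// sqrtr_sqr. Qed.

Lemma enormN x : enorm (- x) = enorm x.
Proof. by rewrite -scaleN1r enormZ normrN1 mul1r. Qed.

Lemma enormB x y : enorm (x - y) = enorm (y - x).
Proof. by rewrite -enormN opprB. Qed.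

Lemma norm_le_enorm x : `|x| <= enorm x.
Proof.
rewrite norm_rV_le ?enorm_ge0//; apply/forallP => j.
rewrite -sqrtr_sqr ler_wsqrtr// /dotv (bigD1 j)//= -expr2 lerDl.
by apply: sumr_ge0 => i _; rewrite -expr2 sqr_ge0.
Qed.

Lemma enorm0_eq0 x : enorm x = 0 -> x = 0.
Proof. by move=> x0; apply/eqP; rewrite -normr_le0 -x0 norm_le_enorm. Qed.

Lemma enorm_le x : enorm x <= n%:R * `|x|.
Proof.
rewrite -(ler_pXn2r (ltn0Sn 1)) ?nnegrE ?enorm_ge0 ?mulr_ge0//.
rewrite sqr_enorm (@le_trans _ _ (n%:R * `|x| ^+ 2))//.
  rewrite mulr_natl -[X in _ *+ X](card_ord n) -sumr_const; apply: ler_sum => i _.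
  rewrite -expr2 -real_normK ?num_real// lerXn2r ?nnegrE// norm_coord_rV//.
rewrite exprMn ler_wpM2r ?sqr_ge0//.
by case: (n) => [|k]; rewrite ?expr0n// ler_eXnr// ler1n.
Qed.

(** Expand the square of |y| x - |x| y. *)
Lemma dotv_le x y : dotv x y <= enorm x * enorm y.
Proof.
have [y0|y0] := eqVneq (enorm y) 0.
  rewrite (enorm0_eq0 y0) /dotv big1 ?mulr_ge0 ?enorm_ge0// => i _.
  by rewrite mxE mulr0.
have yp : 0 < enorm y by rewrite lt_neqAle eq_sym y0 enorm_ge0.
have := dotv_ge0 (enorm y *: x - (enorm x) *: y).
rewrite -scaleNr dotvDl !dotvDr !dotvZl !dotvZr -!sqr_enorm (dotvC y x) => H.
have [x0|x0] := eqVneq (enorm x) 0.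
  rewrite (enorm0_eq0 x0) /dotv big1 ?mulr_ge0 ?enorm_ge0// => i _.
  by rewrite mxE mul0r.
have xp : 0 < enorm x by rewrite lt_neqAle eq_sym x0 enorm_ge0.
have xy : 0 < enorm x * enorm y by rewrite mulr_gt0.
rewrite -(ler_pM2l xy); nra.
Qed.

Lemma enormD x y : enorm (x + y) <= enorm x + enorm y.
Proof.
rewrite -(ler_pXn2r (ltn0Sn 1)) ?nnegrE ?enorm_ge0 ?addr_ge0 ?enorm_ge0//.
rewrite sqr_enorm dotvDl !dotvDr (dotvC y x) sqrrD !sqr_enorm.
by have := dotv_le x y; lra.
Qed.

Lemma enorm_dist x y z : enorm (x - z) <= enorm (x - y) + enorm (y - z).
Proof. by rewrite (le_trans _ (enormD _ _))// addrA subrK. Qed.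

Lemma enorm_lip c x y : `|enorm (x - c) - enorm (y - c)| <= n%:R * `|x - y|.
Proof.
rewrite (@le_trans _ _ (enorm (x - y))) ?enorm_le// ler_norml.
have := enorm_dist x y c; have := enorm_dist y x c; rewrite (enormB y x); lra.
Qed.

Lemma continuous_enorm c : continuous (fun x => enorm (x - c)).
Proof. exact: lip_continuous (enorm_lip c). Qed.

(** Euclidean balls, as opposed to the balls of the sup norm. *)
Definition eball (c : 'rV[R]_n) (r : R) : set 'rV[R]_n := [set x | enorm (x - c) < r].

Lemma open_eball c r : open (eball c r).
Proof.
have /continuousP/(_ `]-oo, r[%classic) := @continuous_enorm c.
rewrite (_ : _ @^-1` _ = eball c r); first by apply; exact: interval_open.
by apply/seteqP; split => x /=; rewrite in_itv.
Qed.

Lemma closed_eball (c : 'rV[R]_n) (r : R) : closed [set x | enorm (x - c) <= r].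
Proof.
rewrite (_ : [set _ | _] = ~` ((fun x => enorm (x - c)) @^-1` `]r, +oo[%classic)).
  apply: open_closedC; have /continuousP := @continuous_enorm c.
  by apply; exact: interval_open.
by apply/seteqP; split => x /=; rewrite in_itv/= andbT leNgt; [move/negP|move/negP].
Qed.

Lemma eball_center c r : 0 < r -> eball c r c.
Proof. by move=> r0; rewrite /eball/= subrr -(scale0r (0 : 'rV[R]_n)) enormZ normr0 mul0r. Qed.

Lemma open_eballP (U : set 'rV[R]_n) x : open U -> U x ->
  exists2 r : R, 0 < r & eball x r `<=` U.
Proof.
move=> oU Ux; have /nbhs_ballP[e /= e0 eU] : nbhs x U by exact: open_nbhs_nbhs.
exists e => // y; rewrite /eball/= => yx; apply: eU.
by rewrite -ball_normE/= distrC (le_lt_trans (norm_le_enorm _)).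
Qed.

(** The ball is open. *)
Lemma eball_disjoint_closure (A : set 'rV[R]_n) c r :
  eball c r `&` A = set0 -> eball c r `&` closure A = set0.
Proof.
move=> cA; apply/seteqP; split => // x [cx Ax].
have /Ax [y [Ay cy]] : nbhs x (eball c r) by apply: open_nbhs_nbhs; split => //; exact: open_eball.
suff : (eball c r `&` A) y by rewrite cA.
by split.
Qed.

Lemma tubeE (e : R) (A : set 'rV[R]_n) : tube e A = \bigcup_(y in A) eball y e.
Proof.
apply/seteqP; split => x.
  by rewrite /tube/= => /ereal_inf_lt [_ /= [y Ay <-]]; rewrite lte_fin => xy; exists y.
move=> [y Ay xy]; rewrite /tube/=.
apply: (@le_lt_trans _ _ (enorm (x - y))%:E); last by rewrite lte_fin.
by apply: ereal_inf_lbound; exists y.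
Qed.

Lemma measurable_tube (e : R) (A : set 'rV[R]_n) : measurable (tube e A).
Proof.
apply: open_measurable_rV; rewrite tubeE; apply: bigcup_open => y _.
exact: open_eball.
Qed.


Lemma enorm_mulQ (Q : 'M[R]_n) x : Q *m Q^T = 1%:M -> enorm (x *m Q) = enorm x.
Proof.
move=> QQ; have dE (u v : 'rV[R]_n) : dotv u v = (u *m v^T) 0 0.
  by rewrite mxE; apply: eq_bigr => i _; rewrite mxE.
by rewrite /enorm !dE trmx_mul mulmxA -(mulmxA x) QQ mulmx1.
Qed.

(** Let h be the height above the graph, so that near x0 the domain is h > 0 and
    h vanishes on the boundary.  It increases at unit rate along the vertical
    e and is (1 + L)-Lipschitz.  Starting from a boundary point y, a move by
    t tau e changes h by t tau, and an additional displacement of at most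
    2 c t changes it by less than that. *)
Lemma boundary_cone (Omega : set 'rV[R]_n) x0 : open Omega ->
  lipschitz_boundary Omega -> boundary Omega x0 ->
  exists (c : R) (w : 'rV[R]_n), 0 < c /\
    forall y t, boundary Omega y -> enorm (y - x0) < c -> 0 < t -> t <= 1 ->
      eball (y + t *: (x0 + w - y)) (c * t) `<=` Omega /\
      eball (y + t *: (x0 - w - y)) (c * t) `&` Omega = set0.
Proof.
move=> oO lb bx0; have [r [Q [i [g [r0 QQ glip gO]]]]] := lb _ bx0.
have QtQ : Q^T *m Q = 1%:M by exact: mulmx1C.
have [L L0 gL] := lipschitzP glip.
pose h (x : 'rV[R]_n) := (x *m Q) 0 i - g (col' i (x *m Q)).
have hlip x y : `|h x - h y| <= (1 + L) * enorm (x - y).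
  have -> : h x - h y = ((x *m Q) 0 i - (y *m Q) 0 i) - (g (col' i (x *m Q)) - g (col' i (y *m Q))).
    by rewrite /h; ring.
  have xyE : `|(x - y) *m Q| <= enorm (x - y) by rewrite -(enorm_mulQ _ QQ) norm_le_enorm.
  rewrite (le_trans (ler_normB _ _))// mulrDl mul1r lerD//.
    rewrite (le_trans _ xyE)// mulmxBl; have := norm_coord_rV (x *m Q - y *m Q) i.
    by rewrite !mxE.
  rewrite (le_trans (gL _ _))// ler_wpM2l// (le_trans _ xyE)// mulmxBl -raddfB/=.
  rewrite norm_rV_le//; apply/forallP => j; rewrite mxE; exact: norm_coord_rV.
have hO x : enorm (x - x0) < r -> Omega x <-> 0 < h x.
  by move=> xr; rewrite (gO _ xr) /h subr_gt0.
have h_bd y : boundary Omega y -> enorm (y - x0) < r -> h y = 0.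
  move=> [cy niy] yr.
  have nOy : ~ Omega y by move=> Oy; apply: niy; move: oO; rewrite openE; apply.
  apply/eqP; rewrite eq_le; apply/andP; split.
    by rewrite leNgt; apply/negP => /(hO _ yr).
  rewrite leNgt; apply/negP => hy.
  have L1 : 0 < 1 + L by rewrite ltr_pwDl.
  pose e := Num.min (- h y / (1 + L)) (r - enorm (y - x0)).
  have e0 : 0 < e by rewrite lt_min divr_gt0 ?oppr_gt0//= subr_gt0.
  have : eball y e `&` closure Omega = set0.
    apply: eball_disjoint_closure; apply/seteqP; split => // z [].
    rewrite /eball/= /e lt_min => /andP[]; rewrite ltr_pdivlMr// => z1 z2 Oz.
    have zr : enorm (z - x0) < r by have := enorm_dist z y x0; lra.
    have /(hO _ zr) := Oz; have := hlip z y; rewrite ler_norml => /andP[_]; nra.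
  by move=> /seteqP[/(_ y) + _]; apply; split => //; exact: eball_center.
pose e := (delta_mx 0 i : 'rV[R]_n) *m Q^T.
have eQ : e *m Q = delta_mx 0 i by rewrite /e -mulmxA QtQ mulmx1.
have enorm_e : enorm e = 1.
  rewrite -(enorm_mulQ _ QQ) eQ /enorm /dotv (bigD1 i)//= !mxE !eqxx/= mulr1 big1 ?addr0 ?sqrtr1//.
  by move=> j ji; rewrite !mxE (negbTE ji) andbF mul0r.
have he x s : h (x + s *: e) = h x + s.
  rewrite /h mulmxDl -scalemxAl eQ.
  have -> : col' i (x *m Q + s *: delta_mx 0 i) = col' i (x *m Q).
    by apply/rowP => j; rewrite !mxE eqxx/= lift_eqF mulr0 addr0.
  by rewrite !mxE !eqxx/= mulr1; ring.
have L1 : 1 <= 1 + L by rewrite lerDl.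
have L0' : 0 < 1 + L by exact: lt_le_trans L1.
(* tau is small enough to stay in the chart, and (1 + L) 2 c <= tau / 2. *)
pose tau := r / 4; have tau0 : 0 < tau by rewrite divr_gt0.
pose c := tau / (4 * (1 + L)).
have c0 : 0 < c by rewrite divr_gt0// mulr_gt0.
have cE : 4 * (1 + L) * c = tau by rewrite /c mulrC divfK// lt0r_neq0// mulr_gt0.
have ct : 4 * c <= tau by rewrite -cE; nra.
have rE : r = 4 * tau by rewrite /tau mulrC divfK.
exists c, (tau *: e); split => // y t by_ yc t0 t1.
have yr : enorm (y - x0) < r by rewrite (lt_trans yc)//; lra.
have hy := h_bd _ by_ yr.
have key (s : R) x : `|s| = tau -> enorm (x - (y + t *: (x0 + s *: e - y))) < c * t ->
    enorm (x - x0) < r /\ `|h x - t * s| < t * tau.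
  move=> sE xc.
  have yx : y + t *: (x0 + s *: e - y) = (y + (t * s) *: e) + t *: (x0 - y).
    by apply/rowP => j; rewrite !mxE; ring.
  have d1 : enorm (x - (y + (t * s) *: e)) < 2 * c * t.
    rewrite (le_lt_trans (enorm_dist _ (y + t *: (x0 + s *: e - y)) _))//.
    have -> : y + t *: (x0 + s *: e - y) - (y + (t * s) *: e) = t *: (x0 - y).
      by rewrite yx addrAC subrr add0r.
    rewrite enormZ gtr0_norm// (enormB x0).
    have yct : t * enorm (y - x0) < t * c by rewrite ltr_pM2l.
    by lra.
  split.
    have := enorm_dist x (y + (t * s) *: e) x0.
    have := enormD (y - x0) ((t * s) *: e); rewrite addrAC enormZ enorm_e mulr1 normrM sE gtr0_norm//.
    nra.
  have := hlip x (y + (t * s) *: e); rewrite he hy add0r => H.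
  apply: le_lt_trans H _; nra.
split.
  move=> x; rewrite /eball/= => xc; have [xr] := key tau x (gtr0_norm tau0) xc.
  by rewrite ltr_distl => /andP[h1 _]; apply/(hO _ xr); move: h1; rewrite subrr.
apply/seteqP; split => // x []; rewrite /eball/= -scaleNr => xc Ox.
have [xr] := key (- tau) x (etrans (normrN _) (gtr0_norm tau0)) xc.
rewrite ltr_distl => /andP[_]; rewrite mulrN addNr.
by have /(hO _ xr) := Ox; lra.
Qed.

End Euclid.

(** * Fields with prescribed divergence and trace *)

Section Carriers.
Context {R : realType}.
Variable n : nat.
Hypothesis n2 : (2 <= n)%N.
Local Notation mu := (@lebesgueN R n).
Implicit Types (f d : 'rV[R]_n -> R) (F G : 'I_n -> 'rV[R]_n -> R).

Lemma bounded_lipschitzP f : bounded_lipschitz f ->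
  exists B L, [/\ forall x, `|f x| <= B, 0 <= L &
    forall x y, `|f x - f y| <= L * `|x - y|].
Proof.
move=> [[M [Mr HM]] /lipschitzP[L L0 fL]].
exists (`|M| + 1), L; split => // x; apply: HM => //.
by rewrite (le_lt_trans (ler_norm M))// ltrDl.
Qed.

Lemma bounded_lipschitz_measurable f : bounded_lipschitz f -> measurable_fun setT f.
Proof.
by move=> /bounded_lipschitzP[B [L [_ _ /lip_continuous/Defs.continuous_measurable_fun]]].
Qed.

Lemma sobolev_exponent_gt1 : 1 < n%:R / (n%:R - 1) :> R.
Proof.
have n1 : 0 < n%:R - 1 :> R by rewrite subr_gt0 ltr1n.
by rewrite ltr_pdivlMr// mul1r gtrBl.
Qed.

(** The coordinate form of the integral of F . grad f over D. *)
Definition flux (D : set 'rV[R]_n) f F : R :=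
  \sum_i \int[mu]_(x in D) (partial i f x * F i x).

(** The densities of the divergences that occur: bounded with bounded support,
    so in every L^p. *)
Definition compact_density d := measurable_fun setT d /\
  exists M r, (forall x, `|d x| <= M) /\ (forall x, r < `|x| -> d x = 0).

Lemma compact_densityD d1 d2 : compact_density d1 -> compact_density d2 ->
  compact_density (fun x => d1 x + d2 x).
Proof.
move=> [md1 [M1 [r1 [b1 s1]]]] [md2 [M2 [r2 [b2 s2]]]]; split.
  exact: measurable_funD.
exists (M1 + M2), (Num.max r1 r2); split => x.
  by rewrite (le_trans (ler_normD _ _))// lerD.
by rewrite gt_max => /andP[/s1 -> /s2 ->]; rewrite addr0.
Qed.

Lemma compact_densityZ a d : compact_density d -> compact_density (fun x => a * d x).
Proof.
move=> [md [M [r [b s]]]]; split; first exact: measurable_funM.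
exists (`|a| * M), r; split => x; first by rewrite normrM ler_wpM2l.
by move=> /s ->; rewrite mulr0.
Qed.

Lemma compact_density_mollifier c (l : R) : 0 < l -> compact_density (mollifier c l).
Proof.
move=> l0; have l0' := ltW l0; split.
  rewrite /mollifier; apply: measurable_funM => //; apply: measurable_funM => //.
  apply: measurable_bump_comp => j.
  rewrite (_ : (fun x => _) = (fun x : 'rV[R]_n => l^-1 * (x 0 j - c 0 j))).
    apply: measurable_funM => //; apply: measurable_funB => //; exact: measurable_coord.
  by apply/funext => x; rewrite !mxE.
exists ((bump_mass n)^-1 * l^-1 ^+ n), (`|c| + l); split => x.
  by rewrite ger0_norm ?mollifier_ge0// mollifier_le.
exact: mollifier_supp.
Qed.

Lemma integrable_compact_density f d : bounded_lipschitz f -> compact_density d ->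
  mu.-integrable setT (EFin \o (fun x => f x * d x)).
Proof.
move=> bf [md [M [r [dM dr]]]]; have mf := bounded_lipschitz_measurable bf.
have [B [L [fB _ _]]] := bounded_lipschitzP bf.
apply: (@bounded_supp_integrable _ _ _ (B * M) r).
- exact: measurable_funM.
- by move=> x; rewrite normrM ler_pM.
- by move=> x /dr ->; rewrite mulr0.
Qed.

Lemma integrable_partial f i (g : 'rV[R]_n -> R) : bounded_lipschitz f ->
  mu.-integrable setT (EFin \o g) ->
  mu.-integrable setT (EFin \o (fun x => partial i f x * g x)).
Proof.
move=> bf ig; have [B [L [fB L0 fL]]] := bounded_lipschitzP bf.
have pB := partial_bound i L0 fL.
apply: (@le_integrable _ _ _ _ _ measurableT _ (EFin \o (fun x => (L + `|(point : R)|) * g x))).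
- apply/measurable_EFinP; apply: measurable_funM.
    by apply: measurable_partial; exact: lip_continuous fL.
  by apply/measurable_EFinP; have /integrableP[] := ig.
- move=> x _; rewrite /= lee_fin !normrM ler_wpM2r// (le_trans (pB x))// ler_norm.
  by [].
- exact: RintegrableZ.
Qed.

Definition good_field F := forall i q, 1 <= q -> q < n%:R / (n%:R - 1) ->
  F i \in Lfun mu q%:E.

Lemma good_fieldD F G : good_field F -> good_field G ->
  good_field (fun i x => F i x + G i x).
Proof.
move=> gF gG i q q1 qn; have q1' : (1 <= q%:E)%E by rewrite lee_fin.
have [_ H] := Lfun_submod_closed mu q1'.
by have := H 1 _ _ (gF i q q1 qn) (gG i q q1 qn); rewrite scale1r.
Qed.

Lemma good_fieldZ a F : good_field F -> good_field (fun i x => a * F i x).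
Proof.
move=> gF i q q1 qn; have q1' : (1 <= q%:E)%E by rewrite lee_fin.
have [H0 H] := Lfun_submod_closed mu q1'.
by have := H a _ _ (gF i q q1 qn) H0; rewrite addr0.
Qed.

Lemma good_integrable F i : good_field F -> mu.-integrable setT (EFin \o F i).
Proof.
move=> gF; apply/(Lfun1_integrable _ _).1; apply: gF => //.
exact: sobolev_exponent_gt1.
Qed.

Lemma good_integrable_partial f F i D : bounded_lipschitz f -> good_field F -> measurable D ->
  mu.-integrable D (EFin \o (fun x => partial i f x * F i x)).
Proof.
move=> bf gF mD; apply: (@integrableS _ _ _ mu setT) => //.
apply: integrable_partial => //; exact: good_integrable.
Qed.

Lemma integrable_compact_densityS f d D : bounded_lipschitz f -> compact_density d ->
  measurable D -> mu.-integrable D (EFin \o (fun x => f x * d x)).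
Proof.
move=> bf cd mD; apply: (@integrableS _ _ _ mu setT) => //.
exact: integrable_compact_density.
Qed.

Lemma integral_normD F G i D (a b : \bar R) : measurable D -> good_field F -> good_field G ->
  (\int[mu]_(x in D) (`|F i x|)%:E <= a)%E -> (\int[mu]_(x in D) (`|G i x|)%:E <= b)%E ->
  (\int[mu]_(x in D) (`|F i x + G i x|)%:E <= a + b)%E.
Proof.
move=> mD gF gG Fa Gb.
have mF H : good_field H -> measurable_fun D (H i).
  move=> gH; apply: measurable_funTS.
  by apply/measurable_EFinP; have /integrableP[] := good_integrable i gH.
have mN H : good_field H -> measurable_fun D (fun x => (`|H i x|)%:E).
  by move=> /mF mH; apply/measurable_EFinP; exact: measurableT_comp.
apply: (le_trans _ (leeD Fa Gb)); rewrite -ge0_integralD//; do ?exact: mN.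
apply: ge0_le_integral => //.
- apply/measurable_EFinP; apply: measurableT_comp => //.
  by apply: measurable_funD; exact: mF.
- by apply: emeasurable_funD; exact: mN.
- by move=> x _; rewrite -EFinD lee_fin ler_normD.
Qed.

Lemma integral_normZ F i D (c k : R) : measurable D -> good_field F ->
  (\int[mu]_(x in D) (`|F i x|)%:E <= k%:E)%E ->
  (\int[mu]_(x in D) (`|(c * F i x)%R|)%:E <= (`|c| * k)%:E)%E.
Proof.
move=> mD gF Fk; under eq_integral do rewrite normrM EFinM.
rewrite ge0_integralZl_EFin//; first by rewrite EFinM lee_wpmul2l ?lee_fin.
apply/measurable_EFinP; apply: measurableT_comp => //; apply: measurable_funTS.
by apply/measurable_EFinP; have /integrableP[] := good_integrable i gF.
Qed.

Lemma fluxD D f F G : measurable D -> bounded_lipschitz f -> good_field F -> good_field G ->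
  flux D f (fun i x => F i x + G i x) = flux D f F + flux D f G.
Proof.
move=> mD bf gF gG; rewrite /flux -big_split; apply: eq_bigr => i _ /=.
rewrite -RintegralD//; do ?exact: good_integrable_partial.
by apply: eq_Rintegral => x _; rewrite mulrDr.
Qed.

Lemma fluxZ D f F a : measurable D -> bounded_lipschitz f -> good_field F ->
  flux D f (fun i x => a * F i x) = a * flux D f F.
Proof.
move=> mD bf gF; rewrite /flux mulr_sumr; apply: eq_bigr => i _ /=.
rewrite -RintegralZl//; do ?exact: good_integrable_partial.
by apply: eq_Rintegral => x _; rewrite mulrCA.
Qed.

Lemma flux_supp D f F : (forall i x, ~ D x -> F i x = 0) -> flux D f F = flux setT f F.
Proof.
move=> F0; apply: eq_bigr => i _; rewrite Rintegral_mkcond; apply: eq_Rintegral => x _.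
by rewrite patchE; case: ifPn => //; rewrite notin_setE => /F0 ->; rewrite mulr0.
Qed.

Lemma Rintegral_supp D (g : 'rV[R]_n -> R) : (forall x, ~ D x -> g x = 0) ->
  \int[mu]_(x in D) g x = \int[mu]_x g x.
Proof.
move=> F0; rewrite Rintegral_mkcond; apply: eq_Rintegral => x _.
by rewrite patchE; case: ifPn => //; rewrite notin_setE => /F0 ->.
Qed.

Lemma flux_eq0 D f F : (forall i x, D x -> F i x = 0) -> flux D f F = 0.
Proof.
move=> F0; apply: big1 => i _; rewrite Rintegral_mkcond.
rewrite (_ : restrict _ _ = cst 0) ?Rintegral_cst ?mul0r//.
apply/funext => x; rewrite patchE; case: ifPn => //; rewrite inE => /F0 ->.
by rewrite mulr0.
Qed.

Variable Omega : set 'rV[R]_n.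
Hypothesis oO : open Omega.

Let mO : measurable Omega. Proof. exact: open_measurable_rV. Qed.

(** The five quantitative properties of the field, separated from any measure: the
    functional lam is its normal trace on Omega, d is its divergence, and K
    bounds its mass near the boundary.  Written this way they are additive
    and homogeneous. *)
Definition carries F d (lam : ('rV[R]_n -> R) -> R) (K : R) :=
  [/\ good_field F, compact_density d,
    forall f, bounded_lipschitz f -> flux setT f F + \int[mu]_x (f x * d x) = 0,
    forall f, bounded_lipschitz f ->
      flux Omega f F + \int[mu]_(x in Omega) (f x * d x) = lam f &
    forall i (e : R), 0 < e ->
      (\int[mu]_(x in tube e (boundary Omega)) (`|F i x|)%:E <= (K * e)%:E)%E].

Lemma carries_weaken F d lam lam' K K' : carries F d lam K ->
  (forall f, bounded_lipschitz f -> lam f = lam' f) -> K <= K' -> carries F d lam' K'.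
Proof.
move=> [h1 h2 h3 h4 h5] ll KK; split => //.
  by move=> f bf; rewrite -ll// h4.
move=> i e e0; apply: (le_trans (h5 i e e0)).
by rewrite lee_fin ler_wpM2r// ltW.
Qed.

Lemma carriesD F1 F2 d1 d2 lam1 lam2 K1 K2 : carries F1 d1 lam1 K1 -> carries F2 d2 lam2 K2 ->
  carries (fun i x => F1 i x + F2 i x) (fun x => d1 x + d2 x)
    (fun f => lam1 f + lam2 f) (K1 + K2).
Proof.
move=> [g1 c1 z1 l1 k1] [g2 c2 z2 l2 k2].
have dD D f : measurable D -> bounded_lipschitz f ->
    \int[mu]_(x in D) (f x * (d1 x + d2 x)) =
    \int[mu]_(x in D) (f x * d1 x) + \int[mu]_(x in D) (f x * d2 x).
  move=> mD bf; rewrite -RintegralD//; do ?exact: integrable_compact_densityS.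
  by apply: eq_Rintegral => x _; rewrite mulrDr.
split.
- exact: good_fieldD.
- exact: compact_densityD.
- by move=> f bf; rewrite fluxD// dD// addrACA z1// z2// addr0.
- by move=> f bf; rewrite fluxD// dD// addrACA l1// l2.
move=> i e e0; rewrite mulrDl EFinD.
by apply: integral_normD => //; [exact: measurable_tube|exact: k1|exact: k2].
Qed.

Lemma carriesZ a F d lam K : carries F d lam K ->
  carries (fun i x => a * F i x) (fun x => a * d x) (fun f => a * lam f) (`|a| * K).
Proof.
move=> [g c z l k].
have dZ D f : measurable D -> bounded_lipschitz f ->
    \int[mu]_(x in D) (f x * (a * d x)) = a * \int[mu]_(x in D) (f x * d x).
  move=> mD bf; rewrite -RintegralZl//; do ?exact: integrable_compact_densityS.
  by apply: eq_Rintegral => x _; rewrite mulrCA.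
split.
- exact: good_fieldZ.
- exact: compact_densityZ.
- by move=> f bf; rewrite fluxZ// dZ// -mulrDr z// mulr0.
- by move=> f bf; rewrite fluxZ// dZ// -mulrDr l.
move=> i e e0; rewrite -mulrA.
by apply: integral_normZ => //; [exact: measurable_tube|exact: k].
Qed.

Lemma carries0 : carries (fun _ _ => 0) (fun=> 0) (fun=> 0) 0.
Proof.
have f0 D f : \int[mu]_(x in D) (f x * 0) = 0.
  under eq_Rintegral do rewrite mulr0.
  rewrite Rintegral_mkcond (_ : restrict _ _ = cst 0) ?Rintegral_cst ?mul0r//.
  by apply/funext => x; rewrite patchE; case: ifP.
split.
- move=> i q q1 qn; have q1' : (1 <= q%:E)%E by rewrite lee_fin.
  by have [H0 _] := Lfun_submod_closed mu q1'.
- by split => //; exists 0, 0; split => x; rewrite ?normr0.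
- by move=> f _; rewrite flux_eq0// f0 addr0.
- by move=> f _; rewrite flux_eq0// f0 addr0.
- move=> i e e0; rewrite mul0r integral0_eq// => x _; by rewrite normr0.
Qed.

End Carriers.

(** * Fields in a boundary chart and inside the domain *)

Section Charts.
Context {R : realType}.
Variable n : nat.
Hypothesis n2 : (2 <= n)%N.
Local Notation mu := (@lebesgueN R n).
Variable Omega : set 'rV[R]_n.
Hypothesis oO : open Omega.
Let mO : measurable Omega. Proof. exact: open_measurable_rV. Qed.
Implicit Types (nu : {finite_measure set 'rV[R]_n -> \bar R}) (A : set 'rV[R]_n).
Implicit Types (f : 'rV[R]_n -> R).
Local Notation carries := (carries Omega).

(** A point at distance less than e from the boundary cannot lie in the bump of
    time t once c t >= e, so only times t < e / c contribute. *)
Lemma stream_tube nu A (c0 v : 'rV[R]_n -> 'rV[R]_n) (l0 l1 V c : R) :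
  measurable A ->
  (forall j, measurable_fun setT (fun y => c0 y 0 j)) ->
  (forall j, measurable_fun setT (fun y => v y 0 j)) ->
  (forall y, A y -> `|v y| <= V) -> 0 <= V -> 0 <= l0 -> 0 <= l1 -> 0 < l0 + l1 ->
  0 < c ->
  (forall y t z, A y -> 0 < t < 1 -> boundary Omega z ->
     radius_at l0 l1 t + c * t <= enorm (z - center_at (c0 y) (v y) t)) ->
  forall i (e : R), 0 < e ->
  (\int[mu]_(x in tube e (boundary Omega)) (`|stream nu A c0 v l0 l1 i x|)%:E <=
    ((V + l1) / c * fine (nu A) * e)%:E)%E.
Proof.
move=> mA mc0 mv vV V0 l00 l10 l010 c0' far i e e0.
have nuf : nu A \is a fin_num by exact: fin_num_measure.
rewrite (_ : (V + l1) / c * fine (nu A) * e = (V + l1) * (e / c) * fine (nu A)); last by ring.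
rewrite EFinM fineK//.
apply: (integral_stream_le nu mA mc0 mv vV) => //.
- exact: measurable_tube.
- by rewrite divr_ge0// ltW.
move=> x y t; rewrite tubeE => -[z bz xz] Ay t01; rewrite ler_pdivrMr// => et.
have /andP[t0 _] := t01.
apply: mollifier_eq0; first exact: radius_at_gt0.
rewrite leNgt; apply/negP => xc.
have := far _ _ _ Ay t01 bz; have := enorm_dist z x (center_at (c0 y) (v y) t).
by have : enorm (x - z) < e by []; rewrite (enormB z x); lra.
Qed.

Lemma mollifier_mean f a (r : R) : 0 < r -> bounded_lipschitz f ->
  \int[mu]_x (f x * mollifier a r x) = \int[mu]_z (f (a + r *: z) * ((bump_mass n)^-1 * bump z)).
Proof.
move=> r0 bf; have [B [L [fB _ _]]] := bounded_lipschitzP bf.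
by have [_ _] := integral_mollifier a r0 (bounded_lipschitz_measurable bf) fB.
Qed.

(** With v = b - y, l0 = 0 and l1 = r the bump grows from the point y to the ball
    of centre b and radius r. *)
Lemma average_at_focus f y b (r : R) : 0 < r -> bounded_lipschitz f ->
  average_at y (b - y) 0 r f 0 = f y /\
  average_at y (b - y) 0 r f 1 = \int[mu]_x (f x * mollifier b r x).
Proof.
move=> r0 bf; rewrite mollifier_mean// /average_at /center_at /radius_at; split.
  transitivity (\int[mu]_z (f y * ((bump_mass n)^-1 * bump z))).
    by apply: eq_Rintegral => z _; rewrite mul0r addr0 !scale0r !addr0.
  by rewrite RintegralZl// ?integral_normalised_bump ?mulr1//; exact: integrable_normalised_bump.
by apply: eq_Rintegral => z _; rewrite mul1r add0r scale1r (addrC y) subrK.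
Qed.

(** With v = b - a, l0 = r and l1 = 0 a ball of radius r is translated from a to b. *)
Lemma average_at_slide f a b (r : R) : 0 < r -> bounded_lipschitz f ->
  average_at a (b - a) r 0 f 0 = \int[mu]_x (f x * mollifier a r x) /\
  average_at a (b - a) r 0 f 1 = \int[mu]_x (f x * mollifier b r x).
Proof.
move=> r0 bf; rewrite !mollifier_mean// /average_at /center_at /radius_at; split.
  by apply: eq_Rintegral => z _; rewrite mul0r addr0 scale0r addr0.
by apply: eq_Rintegral => z _; rewrite mulr0 addr0 scale1r (addrC a) subrK.
Qed.

Lemma bounded_integrable d (T : measurableType d) (m : {finite_measure set T -> \bar R}) (D : set T)
    (g : T -> R) (B : R) : measurable D -> measurable_fun setT g -> (forall x, `|g x| <= B) ->
  m.-integrable D (EFin \o g).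
Proof.
move=> mD mg gB; apply: (@le_integrable _ _ _ _ _ mD _ (EFin \o cst B)).
- by apply/measurable_EFinP; exact: measurable_funTS.
- by move=> x _; rewrite /= lee_fin (le_trans (gB x))// ler_norm.
- by apply: finite_measure_integrable_cst.
Qed.

Lemma measurable_sub_coord (b : 'rV[R]_n) j : measurable_fun setT (fun y : 'rV[R]_n => (b - y) 0 j).
Proof.
rewrite (_ : (fun y => _) = (fun y : 'rV[R]_n => b 0 j - y 0 j)).
  by apply: measurable_funB => //; exact: measurable_coord.
by apply/funext => y; rewrite !mxE.
Qed.

(** The stream that gathers the measure nu on A into the ball of centre b and
    radius r. *)
Definition focus nu A (b : 'rV[R]_n) (r : R) :=
  stream nu A id (fun y => b - y) 0 r.

Lemma focus_pairing nu A b (r V : R) f : measurable A -> 0 < r ->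
  (forall y, A y -> `|b - y| <= V) -> bounded_lipschitz f ->
  flux setT f (focus nu A b r) =
  fine (nu A) * \int[mu]_x (f x * mollifier b r x) - \int[nu]_(y in A) f y.
Proof.
move=> mA r0 bV bf; have [B [L [fB L0 fL]]] := bounded_lipschitzP bf.
have r00 := ltW r0; have r0' : 0 < 0 + r by rewrite add0r.
rewrite /flux /focus (stream_pairing nu mA (fun j => @measurable_coord R n j) (measurable_sub_coord b) bV _ _ r0' fB L0 fL)//.
under eq_Rintegral do rewrite !(average_at_focus _ _ r0 bf).1 (average_at_focus _ _ r0 bf).2.
rewrite RintegralB//; last 2 first.
- by apply: finite_measure_integrable_cst.
- by apply: bounded_integrable fB => //; exact: bounded_lipschitz_measurable bf.
by rewrite Rintegral_cst// mulrC.
Qed.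

Lemma fine_measure_ge0 nu A : 0 <= fine (nu A).
Proof. exact/fine_ge0. Qed.

Lemma cone_endpoints x0 (c : R) (w : 'rV[R]_n) : 0 < c -> boundary Omega x0 ->
  (forall y t, boundary Omega y -> enorm (y - x0) < c -> 0 < t -> t <= 1 ->
      eball (y + t *: (x0 + w - y)) (c * t) `<=` Omega /\
      eball (y + t *: (x0 - w - y)) (c * t) `&` Omega = set0) ->
  eball (x0 + w) c `<=` Omega /\ eball (x0 - w) c `&` Omega = set0.
Proof.
move=> c0 bx0 /(_ x0 1 bx0 (eball_center _ c0) ltr01 (lexx 1)).
have E u : x0 + 1 *: (x0 + u - x0) = x0 + u by rewrite scale1r (addrC x0) subrK.
by rewrite !E mulr1.
Qed.

(** The field is focus towards the outer point minus focus towards the inner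
    point.  The terms carrying nu cancel on the whole space.  On Omega the outer stream
    vanishes, and the inner one leaves nu as the normal trace. *)
Lemma chart_carries x0 (c : R) (w : 'rV[R]_n) : 0 < c ->
  (forall y t, boundary Omega y -> enorm (y - x0) < c -> 0 < t -> t <= 1 ->
      eball (y + t *: (x0 + w - y)) (c * t) `<=` Omega /\
      eball (y + t *: (x0 - w - y)) (c * t) `&` Omega = set0) ->
  boundary Omega x0 ->
  exists2 K, 0 <= K & forall r : R, 0 < r -> r <= c / 2 ->
  forall nu A, measurable A -> A `<=` boundary Omega `&` eball x0 c ->
  exists F, carries F
    (fun x => fine (nu A) * (mollifier (x0 + w) r x - mollifier (x0 - w) r x))
    (fun f => \int[nu]_(y in A) f y) (K * fine (nu A)).
Proof.
move=> c0 cone bx0; pose V := `|w| + c.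
have V0 : 0 <= V by rewrite addr_ge0// ltW.
(* Two streams of speed at most V + c, each moving away at rate c / 2. *)
pose K := 2 * ((V + c) / (c / 2)).
exists K; first by rewrite mulr_ge0// divr_ge0 ?addr_ge0 ?divr_ge0 ?(ltW c0).
move=> r r0 rc nu A mA Ab.
have r00 := ltW r0; have r0' : 0 < 0 + r by rewrite add0r.
have c20 : 0 < c / 2 by rewrite divr_gt0.
have bnd (s : R) y : `|s| = 1 -> A y -> `|x0 + s *: w - y| <= V.
  move=> s1 /Ab[_ yc]; rewrite addrAC [x0 - y + _]addrC (le_trans (ler_normD _ _))//.
  by rewrite normrZ s1 mul1r lerD// (le_trans (norm_le_enorm _))// enormB ltW.
have bin y : A y -> `|x0 + w - y| <= V by have := bnd 1 y (normr1 _); rewrite scale1r.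
have bout y : A y -> `|x0 - w - y| <= V by have := bnd (-1) y (normrN1 _); rewrite scaleN1r.
have geo y t : A y -> 0 < t < 1 ->
    eball (y + t *: (x0 + w - y)) (c * t) `<=` Omega /\
    eball (y + t *: (x0 - w - y)) (c * t) `&` Omega = set0.
  by move=> /Ab[by_ yc] /andP[t0 t1]; exact: (cone _ _ by_ yc t0 (ltW t1)).
have [in1 out1] := cone_endpoints c0 bx0 cone.
(* As r <= c / 2, the ball of radius r t leaves the margin (c / 2) t in the cone. *)
have half (t : R) : 0 < t -> r * t + c / 2 * t <= c * t.
  by move=> t0; rewrite -mulrDl ler_wpM2r ?(ltW t0)//; lra.
have bdO z : boundary Omega z -> closure Omega z /\ ~ Omega z.
  move=> [cz niz]; split => // Oz; apply: niz; move: oO; rewrite openE; exact.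
have farin y t z : A y -> 0 < t < 1 -> boundary Omega z ->
    radius_at 0 r t + c / 2 * t <= enorm (z - center_at y (x0 + w - y) t).
  move=> Ay t01 /bdO[_ nOz]; have [gi _] := geo y t Ay t01; have /andP[t0 _] := t01.
  rewrite leNgt; apply/negP => zc; apply: nOz; apply: gi.
  by apply: (lt_le_trans zc); rewrite /radius_at add0r (mulrC t) half.
have farout y t z : A y -> 0 < t < 1 -> boundary Omega z ->
    radius_at 0 r t + c / 2 * t <= enorm (z - center_at y (x0 - w - y) t).
  move=> Ay t01 /bdO[cz _]; have [_ go] := geo y t Ay t01; have /andP[t0 _] := t01.
  rewrite leNgt; apply/negP => zc.
  have /seteqP[/(_ z) + _] := eball_disjoint_closure go; apply; split => //.
  by apply: (lt_le_trans zc); rewrite /radius_at add0r (mulrC t) half.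
pose Fi := focus nu A (x0 + w) r; pose Fo := focus nu A (x0 - w) r.
have mid j := @measurable_coord R n j.
have Fi0 i x : ~ Omega x -> Fi i x = 0.
  move=> nOx; apply: (stream_eq0 nu mA mid (measurable_sub_coord _) bin) => //.
  move=> y t Ay t01; have /andP[t0 _] := t01.
  apply: mollifier_eq0; first exact: radius_at_gt0.
  rewrite leNgt; apply/negP => xc; apply: nOx; have [gi _] := geo y t Ay t01.
  apply: gi; rewrite /eball/= (lt_le_trans xc)// /radius_at add0r mulrC ler_wpM2r ?(ltW t0)//.
  by lra.
have Fo0 i x : Omega x -> Fo i x = 0.
  move=> Ox; apply: (stream_eq0 nu mA mid (measurable_sub_coord _) bout) => //.
  move=> y t Ay t01; have /andP[t0 _] := t01.
  apply: mollifier_eq0; first exact: radius_at_gt0.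
  rewrite leNgt; apply/negP => xc; have [_ go] := geo y t Ay t01.
  suff : (eball (y + t *: (x0 - w - y)) (c * t) `&` Omega) x by rewrite go.
  split => //; rewrite /eball/= (lt_le_trans xc)// /radius_at add0r mulrC ler_wpM2r ?(ltW t0)//.
  by lra.
have gFi : good_field Fi by move=> i q; exact: (stream_Lp nu mA mid (measurable_sub_coord _) bin).
have gFo : good_field Fo by move=> i q; exact: (stream_Lp nu mA mid (measurable_sub_coord _) bout).
pose m := fine (nu A); pose Pi := mollifier (x0 + w) r; pose Po := mollifier (x0 - w) r.
have m0 : 0 <= m by exact: fine_measure_ge0.
have Pi0 x : ~ Omega x -> Pi x = 0.
  move=> nOx; apply: mollifier_eq0 => //; rewrite leNgt; apply/negP => xc; apply: nOx.
  by apply: in1; rewrite /eball/= (lt_le_trans xc)//; lra.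
have Po0 x : Omega x -> Po x = 0.
  move=> Ox; apply: mollifier_eq0 => //; rewrite leNgt; apply/negP => xc.
  suff : (eball (x0 - w) c `&` Omega) x by rewrite out1.
  by split => //; rewrite /eball/= (lt_le_trans xc)//; lra.
have cPi : compact_density Pi by exact: compact_density_mollifier.
have cPo : compact_density Po by exact: compact_density_mollifier.
have cd : compact_density (fun x => m * (Pi x - Po x)).
  apply: compact_densityZ; apply: compact_densityD => //.
  by under eq_fun do rewrite -mulN1r; exact: compact_densityZ.
have FiE f : bounded_lipschitz f ->
    flux setT f Fi = m * \int[mu]_x (f x * Pi x) - \int[nu]_(y in A) f y.
  exact: (focus_pairing nu mA r0 bin).
have FoE f : bounded_lipschitz f ->
    flux setT f Fo = m * \int[mu]_x (f x * Po x) - \int[nu]_(y in A) f y.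
  exact: (focus_pairing nu mA r0 bout).
have Fi_tube := stream_tube nu mA mid (measurable_sub_coord _) bin V0 (lexx 0) r00 r0' c20 farin.
have Fo_tube := stream_tube nu mA mid (measurable_sub_coord _) bout V0 (lexx 0) r00 r0' c20 farout.
rewrite -/(focus nu A (x0 + w) r) -/Fi -/m in Fi_tube.
rewrite -/(focus nu A (x0 - w) r) -/Fo -/m in Fo_tube.
rewrite -/Pi -/Po -/m; clearbody Fi Fo Pi Po m.
exists (fun i x => Fo i x + -1 * Fi i x).
have gN : good_field (fun i x => -1 * Fi i x) by exact: good_fieldZ.
have iP D P f : measurable D -> bounded_lipschitz f -> compact_density P ->
  mu.-integrable D (EFin \o (fun x => f x * P x)).
  by move=> mD bf cP; exact: integrable_compact_densityS.
have dE D f : measurable D -> bounded_lipschitz f ->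
   \int[mu]_(x in D) (f x * (m * (Pi x - Po x))) =
   m * (\int[mu]_(x in D) (f x * Pi x) - \int[mu]_(x in D) (f x * Po x)).
  move=> mD bf; rewrite -RintegralB//; do ?exact: iP.
  rewrite -RintegralZl//; last by apply: RintegrableB => //; exact: iP.
  by apply: eq_Rintegral => x _; rewrite mulrCA mulrBr.
split => //.
- exact: good_fieldD.
- move=> f bf; rewrite fluxD// fluxZ// FiE// FoE// dE//.
  by ring.
- move=> f bf; rewrite fluxD// fluxZ// (flux_supp _ Fi0) (flux_eq0 _ Fo0) FiE// dE//.
  rewrite [X in m * (X - _)]Rintegral_supp; last by move=> x /Pi0 ->; rewrite mulr0.
  rewrite (_ : \int[mu]_(x in Omega) (f x * Po x) = 0).
    by ring.
  rewrite Rintegral_mkcond (_ : restrict _ _ = cst 0) ?Rintegral_cst ?mul0r//.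
  apply/funext => x; rewrite patchE; case: ifPn => //; rewrite inE => /Po0 ->.
  by rewrite mulr0.
move=> i e e0; have mT := measurable_tube e (boundary Omega).
have hK : (((V + r) / (c / 2) * m * e)%:E <= ((V + c) / (c / 2) * m * e)%:E)%E.
  by rewrite lee_fin ler_wpM2r ?(ltW e0)// ler_wpM2r// ler_wpM2r ?invr_ge0 ?(ltW c20)//; lra.
rewrite (_ : K * m * e = (V + c) / (c / 2) * m * e + (V + c) / (c / 2) * m * e); last first.
  by rewrite /K; ring.
rewrite EFinD; apply: (integral_normD n2 mT gFo gN); apply: (le_trans _ hK).
  exact: Fo_tube.
by have := integral_normZ n2 (-1) mT gFi (Fi_tube i e e0); rewrite normrN1 mul1r.
Qed.


(** The stream of a translated ball, for a unit mass: it stays inside a ball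
    contained in Omega, so it has no normal trace.  The constant 1 is the
    ratio of the speed bound rho / 4 to the distance rate rho / 4. *)
Lemma slide_carries a b (rho : R) : eball a rho `<=` Omega -> 0 < rho ->
  enorm (b - a) < rho / 4 -> forall r : R, 0 < r -> r <= rho / 4 ->
  exists F, carries F (fun x => mollifier a r x - mollifier b r x) (fun=> 0) 1.
Proof.
move=> aO rho0 ba r r0 rrho; have r00 := ltW r0; have r0' : 0 < r + 0 by rewrite addr0.
(* A unit mass; c0 and v being constant, its position is irrelevant. *)
pose nu := @dirac _ 'rV[R]_n (0 : 'rV[R]_n) R; pose V := rho / 4.
have bV y : [set: 'rV[R]_n] y -> `|b - a| <= V.
  by move=> _; rewrite (le_trans (norm_le_enorm _))// ltW.
have mcst u j : measurable_fun setT (fun y : 'rV[R]_n => (u : 'rV[R]_n) 0 j) by [].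
pose F := stream nu setT (fun=> a) (fun=> b - a) r 0.
have V0 : 0 <= V by rewrite divr_ge0// ltW.
have c0 : 0 < rho / 4 by rewrite divr_gt0.
have m1 : fine (nu setT) = 1 by rewrite /nu diracT.
have near t z : 0 < t < 1 -> enorm (z - center_at a (b - a) t) < radius_at r 0 t + rho / 4 * t -> eball a rho z.
  move=> /andP[t0 t1]; rewrite /radius_at mulr0 addr0 /center_at => zc; rewrite /eball/=.
  have := enorm_dist z (a + t *: (b - a)) a; rewrite (addrC a) addrK enormZ gtr0_norm//.
  rewrite (addrC _ a).
  have : t * enorm (b - a) <= enorm (b - a) by rewrite ler_piMl ?enorm_ge0// ltW.
  have : rho / 4 * t <= rho / 4 by rewrite ler_piMr ?(ltW c0)// ltW.
  by move: zc; lra.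
have far (y : 'rV[R]_n) t z : [set: 'rV[R]_n] y -> 0 < t < 1 -> boundary Omega z ->
    radius_at r 0 t + rho / 4 * t <= enorm (z - center_at a (b - a) t).
  move=> _ t01 [_ niz]; rewrite leNgt; apply/negP => /(near _ _ t01)/aO Oz.
  by apply: niz; move: oO; rewrite openE; exact.
have tubeF := stream_tube nu measurableT (mcst a) (mcst (b - a)) bV V0 r00 (lexx 0) r0' c0 far.
have F0 i x : ~ Omega x -> F i x = 0.
  move=> nOx; apply: (stream_eq0 nu measurableT (mcst a) (mcst (b - a)) bV) => //.
  move=> y t _ t01; apply: mollifier_eq0; first by rewrite /radius_at mulr0 addr0.
  rewrite leNgt; apply/negP => xc; apply: nOx; apply: aO; apply: (near _ _ t01).
  by rewrite (lt_le_trans xc)// lerDl mulr_ge0 ?(ltW c0)//; case/andP: t01 => /ltW.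
have gF : good_field F.
  by move=> i q; exact: (stream_Lp nu measurableT (mcst a) (mcst (b - a)) bV).
have FE f : bounded_lipschitz f -> flux setT f F =
    \int[mu]_x (f x * mollifier b r x) - \int[mu]_x (f x * mollifier a r x).
  move=> bf; have [B [L [fB L0 fL]]] := bounded_lipschitzP bf.
  rewrite /flux /F (stream_pairing nu measurableT (mcst a) (mcst (b - a)) bV r00 _ r0' fB L0 fL)//.
  rewrite (average_at_slide _ _ r0 bf).1 (average_at_slide _ _ r0 bf).2 Rintegral_cst//.
  by rewrite m1 mulr1.
rewrite -/F in tubeF; rewrite m1 in tubeF; clearbody F.
have cPa : compact_density (mollifier a r) by exact: compact_density_mollifier.
have cPb : compact_density (mollifier b r) by exact: compact_density_mollifier.
have eO u x : enorm (u - a) < rho / 4 -> ~ Omega x -> mollifier u r x = 0.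
  move=> ua nOx; apply: mollifier_eq0 => //; rewrite leNgt; apply/negP => xu; apply: nOx.
  by apply: aO; rewrite /eball/=; have := enorm_dist x u a; lra.
have aa : enorm (a - a) < rho / 4 by exact: eball_center.
have dE f : bounded_lipschitz f ->
    \int[mu]_x (f x * (mollifier a r x - mollifier b r x)) =
    \int[mu]_x (f x * mollifier a r x) - \int[mu]_x (f x * mollifier b r x).
  move=> bf; rewrite -RintegralB//; do ?exact: integrable_compact_density.
  by apply: eq_Rintegral => x _; rewrite mulrBr.
exists F; split => //.
- by apply: compact_densityD => //; under eq_fun do rewrite -mulN1r; exact: compact_densityZ.
- by move=> f bf; rewrite FE// dE//; ring.
- move=> f bf; rewrite (flux_supp _ F0) FE//.
  rewrite [X in _ + X]Rintegral_supp; last by move=> x nOx; rewrite (eO a)// (eO b)// subrr mulr0.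
  by rewrite (dE f bf) addrA subrK subrr.
move=> i e e0; apply: (le_trans (tubeF i e e0)).
by rewrite addr0 /V divff ?mul1r// lt0r_neq0.
Qed.

(** A unit mass can be moved between a and b inside Omega, for all small radii
    and with a common bound K. *)
Definition linked a b := exists r0 K : R, [/\ 0 < r0, 0 <= K &
  forall r, 0 < r -> r <= r0 ->
  exists F, carries F (fun x => mollifier a r x - mollifier b r x) (fun=> 0) K].

Lemma linked_refl a : linked a a.
Proof.
exists 1, 0; split => // r r0 _; exists (fun _ _ => 0).
rewrite (_ : (fun x => _ - _) = cst 0); last by apply/funext => x; rewrite subrr.
exact: carries0.
Qed.

Lemma linked_sym a b : linked a b -> linked b a.
Proof.
move=> [r0 [K [r00 K0 H]]]; exists r0, K; split => [//|//|r rp rr].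
have [F cF] := H r rp rr; have := carriesZ n2 oO (-1) cF.
rewrite normrN1 mul1r => cF'; exists (fun i x => -1 * F i x).
rewrite (_ : (fun x => mollifier b r x - _) = (fun x => -1 * (mollifier a r x - mollifier b r x))).
  by apply: (carries_weaken cF') => // f _; rewrite mulr0.
by apply/funext => x; rewrite mulN1r opprB.
Qed.

Lemma linked_trans a b c : linked a b -> linked b c -> linked a c.
Proof.
move=> [r1 [K1 [r10 K10 H1]]] [r2 [K2 [r20 K20 H2]]].
exists (Num.min r1 r2), (K1 + K2); split => [||r rp]; [by rewrite lt_min r10|exact: addr_ge0|].
rewrite le_min => /andP[rr1 rr2].
have [F1 c1] := H1 r rp rr1; have [F2 c2] := H2 r rp rr2.
exists (fun i x => F1 i x + F2 i x); have := carriesD n2 oO c1 c2 => c12.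
rewrite (_ : (fun x => mollifier a r x - _) = (fun x => (mollifier a r x - mollifier b r x) +
    (mollifier b r x - mollifier c r x))).
  by apply: (carries_weaken c12) => // f _; rewrite addr0.
by apply/funext => x; rewrite addrA subrK.
Qed.

Lemma linked_near a : Omega a -> exists2 s : R, 0 < s & eball a s `<=` linked a.
Proof.
move=> Oa; have [rho rho0 aO] := open_eballP oO Oa.
exists (rho / 4); first by rewrite divr_gt0.
move=> b ba; exists (rho / 4), 1; split => [|//|r rp rr]; first by rewrite divr_gt0.
 exact: (slide_carries aO rho0 ba rp rr).
Qed.

(** The relation is an equivalence with open classes. *)
Lemma linked_connected a b : connected Omega -> Omega a -> Omega b -> linked a b.
Proof.
move=> cO Oa Ob; pose B := Omega `&` linked a.
have BO : B = Omega.
  apply: cO.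
  - by exists a; split; [exact: Oa|exact: linked_refl].
  - exists B; last by rewrite /B setIA setIid.
    rewrite openE => x [Ox ax]; have [s s0 sx] := linked_near Ox.
    apply: (@filterS _ _ _ (Omega `&` eball x s)).
      move=> y [Oy /sx xy]; split; first exact: Oy.
      exact: linked_trans ax xy.
    apply: open_nbhs_nbhs; split; first by apply: openI => //; exact: open_eball.
    by split => //; exact: eball_center.
  (* The complement in Omega of the class is a union of classes, hence open. *)
  - exists (~` (Omega `\` linked a)).
      apply: open_closedC; rewrite openE => x [Ox ax]; have [s s0 sx] := linked_near Ox.
      apply: (@filterS _ _ _ (Omega `&` eball x s)).
        move=> y [Oy /sx xy]; split; first exact: Oy.
        move=> ay; apply: ax.
        exact: linked_trans ay (linked_sym xy).
      apply: open_nbhs_nbhs; split; first by apply: openI => //; exact: open_eball.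
      by split => //; exact: eball_center.
    apply/seteqP; split => x [Ox ax].
      by split; [exact: Ox|case].
    by split; [exact: Ox|apply: contrapT => nax; exact: ax].
have : B b by rewrite BO.
by case.
Qed.

End Charts.

(** * From charts to the whole boundary *)

Section Channels.
Context {R : realType}.
Variable n : nat.
Hypothesis n2 : (2 <= n)%N.
Variable Omega : set 'rV[R]_n.
Hypothesis oO : open Omega.
Implicit Types (nu : {finite_measure set 'rV[R]_n -> \bar R}) (A V : set 'rV[R]_n).
Implicit Types (f : 'rV[R]_n -> R).
Local Notation carries := (carries Omega).
Variable a0 : 'rV[R]_n.

(** Every finite measure on a Borel part A of V is the normal trace of a field
    of the required kind whose divergence, on a neighbourhood U of the closure
    of Omega, is the mass of A times a fixed bump around a0.  The constants
    depend on V only. *)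
Definition channel V := measurable V /\
  exists (C r1 : R) (U : set 'rV[R]_n), [/\ 0 <= C, 0 < r1, open U, closure Omega `<=` U &
  forall r, 0 < r -> r <= r1 -> forall nu A, measurable A -> A `<=` V ->
  exists F d, carries F d (fun f => \int[nu]_(y in A) f y) (C * fine (nu A)) /\
    forall x, U x -> d x = fine (nu A) * mollifier a0 r x].

Lemma channel0 : channel set0.
Proof.
split; first exact: measurable0.
exists 0, 1, setT; split; [by []|by []|exact: openT|by []|].
move=> r _ _ nu A mA; rewrite subset0 => ->.
exists (fun _ _ => 0), (fun=> 0); split; last by move=> x _; rewrite measure0 mul0r.
rewrite mul0r; apply: (carries_weaken (carries0 Omega)) => // f _.
by rewrite Rintegral_set0.
Qed.

(** Split a measurable subset of the union along V1. *)
Lemma channelU V1 V2 : channel V1 -> channel V2 -> channel (V1 `|` V2).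
Proof.
move=> [mV1 [C1 [r1 [U1 [C10 r10 oU1 cU1 H1]]]]] [mV2 [C2 [r2 [U2 [C20 r20 oU2 cU2 H2]]]]].
split; first exact: measurableU.
exists (C1 + C2), (Num.min r1 r2), (U1 `&` U2); split.
- exact: addr_ge0.
- by rewrite lt_min r10.
- exact: openI.
- by move=> x cx; split; [exact: cU1|exact: cU2].
move=> r rp; rewrite le_min => /andP[rr1 rr2] nu A mA AV.
have mA1 : measurable (A `&` V1) by exact: measurableI.
have mA2 : measurable (A `\` V1) by exact: measurableD.
have [|F1 [d1 [c1 e1]]] := H1 r rp rr1 nu _ mA1; first by move=> x [].
have [|F2 [d2 [c2 e2]]] := H2 r rp rr2 nu _ mA2.
  by move=> x [/AV[]].
have mE : fine (nu A) = fine (nu (A `&` V1)) + fine (nu (A `\` V1)).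
  by rewrite (measureDI nu mA mV1) fineD ?fin_num_measure// addrC.
exists (fun i x => F1 i x + F2 i x), (fun x => d1 x + d2 x); split; last first.
  by move=> x [U1x U2x]; rewrite e1// e2// mE mulrDl.
apply: (carries_weaken (carriesD n2 oO c1 c2)).
  move=> f bf; have [B [L [fB _ _]]] := bounded_lipschitzP bf.
  rewrite -Rintegral_setU//.
  - by rewrite setUIDK.
  - rewrite setUIDK; apply: (bounded_integrable nu mA _ fB); exact: bounded_lipschitz_measurable.
  - by apply/disj_set2P/seteqP; split => // x [[_ V1x] [_]].
have m1 := fine_measure_ge0 nu (A `&` V1); have m2 := fine_measure_ge0 nu (A `\` V1).
rewrite mE; nra.
Qed.

(** After the chart field, the mass at the inner point x0 + w is moved to a0
    inside Omega.  The bump at the outer point is supported off U. *)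
Lemma channel_local x0 : connected Omega -> lipschitz_boundary Omega -> Omega a0 ->
  boundary Omega x0 -> exists2 c : R, 0 < c & channel (boundary Omega `&` eball x0 c).
Proof.
move=> cO lb Oa bx0; have [c [w [c0 cone]]] := boundary_cone oO lb bx0.
exists c => //; have c20 : 0 < c / 2 by rewrite divr_gt0.
have mb : measurable (boundary Omega).
  apply: measurableD; last by apply: open_measurable_rV; exact: open_interior.
  rewrite -[closure _]setCK; apply: measurableC; apply: open_measurable_rV.
  by apply: closed_openC; exact: closed_closure.
split; first by apply: measurableI => //; apply: open_measurable_rV; exact: open_eball.
have [K1 K10 H1] := chart_carries n2 oO c0 cone bx0.
have [in1 out1] := cone_endpoints c0 bx0 cone.
have Ob : Omega (x0 + w) by apply: in1; exact: eball_center.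
have [r0 [K2 [r00 K20 H2]]] := linked_connected n2 oO cO Oa Ob.
exists (K1 + K2), (Num.min r0 (c / 2)), (~` [set x | enorm (x - (x0 - w)) <= c / 2]); split.
- exact: addr_ge0.
- by rewrite lt_min r00.
- by apply: closed_openC; exact: closed_eball.
- move=> x cx /= xc; have /seteqP[/(_ x) + _] := eball_disjoint_closure out1; apply.
  by split => //; rewrite /eball/= (le_lt_trans xc)//; lra.
move=> r rp; rewrite le_min => /andP[rr0 rc] nu A mA AV.
have [F c1] := H1 r rp rc nu A mA AV; have [G c2] := H2 r rp rr0.
pose m := fine (nu A); have m0 : 0 <= m by exact: fine_measure_ge0.
have c3 := carriesD n2 oO c1 (carriesZ n2 oO m c2).
exists (fun i x => F i x + m * G i x); eexists; split.
  apply: (carries_weaken c3); first by move=> f _; rewrite mulr0 addr0.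
  by rewrite ger0_norm// mulrDl [m * _]mulrC.
move=> x /= /negP; rewrite -ltNge => xc.
rewrite -mulrDr [mollifier (x0 - w) r x]mollifier_eq0//; last by rewrite ltW// (le_lt_trans rc).
by rewrite subr0 addrC subrK.
Qed.

Lemma boundary_compact : bounded_set Omega -> compact (boundary Omega).
Proof.
move=> bO; apply: bounded_closed_compact; last first.
  rewrite /boundary setDE; apply: closedI; first exact: closed_closure.
  by apply: open_closedC; exact: open_interior.
have [M [Mr HM]] := bO; exists M; split => // M' MM' x [cx _].
have HM' := HM _ MM'; rewrite /= leNgt; apply/negP => xM.
have e0 : 0 < `|x| - M' by rewrite subr_gt0.
have [y [Oy]] := cx _ (nbhsx_ballx x _ e0).
rewrite -ball_normE/= => xy; have /= yM := HM' y Oy.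
by have := ler_dist_dist x y; have := ler_norm (`|x| - `|y|); lra.
Qed.

Lemma channel_boundary : connected Omega -> lipschitz_boundary Omega -> bounded_set Omega ->
  Omega a0 -> channel (boundary Omega).
Proof.
move=> cO lb bO Oa.
have /choice[c cP] x : exists c : R, boundary Omega x ->
    0 < c /\ channel (boundary Omega `&` eball x c).
  have [bx|nbx] := pselect (boundary Omega x); last by exists 0.
  by have [c c0 cc] := channel_local cO lb Oa bx; exists c.
have := boundary_compact bO; rewrite compact_cover.
move=> /(_ _ (boundary Omega) (fun x => eball x (c x)) _ _)[].
- by move=> x _; exact: open_eball.
- by move=> x bx; exists x => //; apply: eball_center; exact: (cP x bx).1.
move=> D DO cov.
suff H (s : seq 'rV[R]_n) : {in s, forall x, boundary Omega x} ->
    channel (boundary Omega `&` \bigcup_(x in [set` s]) eball x (c x)).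
  have DO' : {in finmap.enum_fset D, forall x, boundary Omega x}.
    by move=> x /DO; rewrite inE.
  have := H _ DO'; rewrite (_ : _ `&` _ = boundary Omega)//.
  by apply/seteqP; split => [x []//|x bx]; split => //; exact: cov.
elim: s => [_|x s IH sO].
  rewrite (_ : _ `&` _ = set0); first exact: channel0.
  by apply/seteqP; split => // x [_ []].
have {}IH : channel (boundary Omega `&` \bigcup_(x in [set` s]) eball x (c x)).
  by apply: IH => y ys; apply: sO; rewrite inE ys orbT.
have cx := (cP x (sO x (mem_head _ _))).2.
have := channelU cx IH; rewrite -setIUr.
rewrite (_ : \bigcup_(y in [set` x :: s]) _ = eball x (c x) `|` \bigcup_(y in [set` s]) eball y (c y))//.
apply/seteqP; split => y.
  move=> [z /=]; rewrite inE => /orP[/eqP ->|zs yz]; first by left.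
  by right; exists z.
by move=> [xy|[z /= zs yz]]; [exists x => //=; rewrite mem_head|exists z => //=; rewrite inE zs orbT].
Qed.

End Channels.

(** * Charges, vector fields and test functions *)

Section Density.
Context d (T : measurableType d) (R : realType) (mu : {sigma_finite_measure set T -> \bar R}).

(** Such an m is absolutely continuous, and its Radon-Nikodym derivative is g
    almost everywhere. *)
Lemma Rintegral_density (m : {finite_measure set T -> \bar R}) (g f : T -> R) (B : R) (D : set T) :
  mu.-integrable setT (EFin \o g) ->
  (forall A, measurable A -> m A = (\int[mu]_(x in A) (g x)%:E)%E) ->
  measurable_fun setT f -> (forall x, `|f x| <= B) -> measurable D ->
  \int[m]_(x in D) f x = \int[mu]_(x in D) (f x * g x).
Proof.
move=> ig mE mf fB mD; have mg : measurable_fun setT (EFin \o g) by have /integrableP[] := ig.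
have dom : m `<< mu.
  apply/null_content_dominatesP => A mA muA; rewrite mE//.
  by apply: null_set_integral => //; exact: measurable_funTS.
have im : m.-integrable D (EFin \o f) by exact: (bounded_integrable m mD mf fB).
rewrite /Rintegral -(Radon_Nikodym_change_of_variables dom mD im); congr fine.
have iRN := Radon_Nikodym_integrable (nu := charge_of_finite_measure m) dom.
have RNE : ae_eq mu D (Radon_Nikodym (charge_of_finite_measure m) mu) (EFin \o g).
  apply: integral_ae_eq => //.
  - exact: (integrableS measurableT).
  - exact: measurable_funTS.
  - move=> A AD mA; rewrite -Radon_Nikodym_integral//; exact: mE.
apply: ae_eq_integral => //.
- apply: emeasurable_funM; first by have /integrableP[] := im.
  by apply: measurable_funTS; have /integrableP[] := iRN.
- under eq_fun do rewrite EFinM.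
  apply: emeasurable_funM; first by have /integrableP[] := im.
  exact: measurable_funTS.
apply: ae_sub RNE => x /= H Dx; by rewrite (H Dx) EFinM.
Qed.

Variable g : T -> R.
Hypothesis ig : mu.-integrable setT (EFin \o g).

(** On a Hahn decomposition (P, N) the two Jordan parts have the densities
    1_P g and - 1_N g. *)
Lemma charge_integral_density (f : T -> R) (B : R) (D : set T) :
  measurable_fun setT f -> (forall x, `|f x| <= B) -> measurable D ->
  charge_integral (induced_charge ig) D f = \int[mu]_(x in D) (f x * g x).
Proof.
move=> mf fB mD; rewrite /charge_integral.
set nu := induced_charge ig.
have [[mP _] [mN _] PN PN0] := hahnP nu.
set P := hahn_pos nu in mP PN PN0 *; set N := hahn_neg nu in mN PN PN0 *.
have ind E : measurable E -> measurable_fun setT (\1_E : T -> R).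
  by move=> mE; exact: measurable_indic.
have mg : measurable_fun setT g by apply/measurable_EFinP; have /integrableP[] := ig.
have igE a (E : set T) : measurable E -> mu.-integrable setT (EFin \o (fun x => a * (\1_E x * g x))).
  move=> mE; apply: RintegrableZ => //.
  apply: (@le_integrable _ _ _ _ _ measurableT _ (EFin \o g)) => //.
  - apply/measurable_EFinP; apply: measurable_funM => //; exact: ind.
  - move=> x _; rewrite /= lee_fin normrM ler_piMl// indicE.
    by case: (_ \in _); rewrite ?normr1 ?normr0.
have intE (E A : set T) : measurable E -> measurable A ->
    nu (A `&` E) = (\int[mu]_(x in A) (\1_E x * g x)%:E)%E.
  move=> mE mA; rewrite [LHS]integral_mkcondr; apply: eq_integral => x _.
  by rewrite patchE indicE; case: (x \in E); rewrite ?mul1r ?mul0r.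
rewrite (@Rintegral_density _ (fun x => 1 * (\1_P x * g x)) f B D (igE 1 P mP))//; last first.
  move=> A mA; rewrite -[LHS]/(jordan_pos (hahnP nu) A) jordan_posE cjordan_posE /crestr0 mem_set// /crestr/=.
  apply: (etrans (intE P A mP mA)).
  by apply: eq_integral => x _; rewrite mul1r.
rewrite (@Rintegral_density _ (fun x => -1 * (\1_N x * g x)) f B D (igE (-1) N mN))//; last first.
  move=> A mA; rewrite -[LHS]/(jordan_neg (hahnP nu) A) jordan_negE cjordan_negE /crestr0 mem_set// /crestr/=.
  rewrite -[induced_charge ig _]/(nu (A `&` N)) (intE N A mN mA).
  under [RHS]eq_integral do rewrite mulN1r EFinN.
  rewrite integralN// integrable_add_def//.
  apply: (integrableS measurableT) => //.
  by have := igE 1 N mN; under [X in EFin \o X]eq_fun do rewrite mul1r.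
have iM a (E : set T) : measurable E ->
    mu.-integrable D (EFin \o (fun x => f x * (a * (\1_E x * g x)))).
  move=> mE; apply: (integrableS measurableT) => //.
  apply: (@le_integrable _ _ _ _ _ measurableT _ (EFin \o (fun x => B * (a * (\1_E x * g x))))).
  - apply/measurable_EFinP; apply: measurable_funM => //; apply: measurable_funM => //.
    by apply: measurable_funM => //; exact: ind.
  - move=> x _; rewrite /= lee_fin normrM [leRHS]normrM ler_wpM2r// (le_trans (fB x))//.
    exact: ler_norm.
  - by apply: RintegrableZ => //; exact: igE.
rewrite -RintegralB//; do ?exact: iM.
apply: eq_Rintegral => x _; rewrite mul1r mulN1r mulrN opprK -mulrDr; congr (_ * _).
rewrite -mulrDl !indicE.
have : (P `|` N) x by rewrite PN.
case: (boolP (x \in P)); case: (boolP (x \in N)) => /=.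
- rewrite !inE => Nx Px; suff : (P `&` N) x by rewrite PN0.
  by split.
- by move=> _ _ _; rewrite addr0 mul1r.
- by move=> _ _ _; rewrite add0r mul1r.
- by rewrite !notin_setE => nN nP [].
Qed.

End Density.

Section VectorFields.
Context {R : realType}.

(** The Borel sets of R^n.+1 are reached from the product through cons_rV, so the
    coordinates are added one by one. *)
Lemma measurable_row d (T : measurableType d) m (F : 'I_m -> T -> R) :
  (forall i, measurable_fun setT (F i)) ->
  measurable_fun setT (fun x => \row_i F i x : 'rV[R]_m).
Proof.
elim: m F => [|m IH] F mF.
  rewrite (_ : (fun x => _) = cst (0 : 'rV[R]_0)); first exact: measurable_cst.
  by apply/funext => x; apply/rowP => -[].
rewrite (_ : (fun x => _) = @cons_rV R m \o (fun x => (F ord0 x, \row_i F (lift ord0 i) x))).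
  apply: measurableT_comp; first exact: measurable_cons_rV.
  by apply: measurable_fun_pair => //; apply: IH.
apply/funext => x; apply/rowP => i /=; rewrite mxE; case: (unliftP ord0 i) => [j ->|->].
  by rewrite cons_rV_tail mxE.
by rewrite cons_rV_head.
Qed.

Variable n : nat.
Local Notation mu := (@lebesgueN R n).

Lemma enorm_le_sum (x : 'rV[R]_n) : enorm x <= \sum_i `|x 0 i|.
Proof.
have s0 : 0 <= \sum_i `|x 0 i| by apply: sumr_ge0.
rewrite -(ler_pXn2r (ltn0Sn 1)) ?nnegrE ?enorm_ge0//.
rewrite sqr_enorm expr2 mulr_suml; apply: ler_sum => i _.
rewrite -[leLHS]ger0_norm -?expr2 ?sqr_ge0// normrX expr2 ler_wpM2l//.
by rewrite (bigD1 i)//= lerDl sumr_ge0.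
Qed.

Lemma Lfun_abs (g : 'rV[R]_n -> R) (q : R) : g \in Lfun mu q%:E ->
  (fun x => `|g x|) \in Lfun mu q%:E.
Proof.
rewrite !inE => /andP[]; rewrite !inE => mg fg; apply/andP; split; rewrite inE.
  exact: (measurableT_comp (@normr_measurable R setT) mg).
move: fg; rewrite /= /finite_norm; congr (_ < _)%E.
rewrite unlock; congr poweR; apply: eq_integral => x _ /=.
by rewrite normr_id.
Qed.

(** The Euclidean norm is at most the sum of the absolute values of the
    coordinates. *)
Lemma vector_LpP (F : 'I_n -> 'rV[R]_n -> R) (q : R) : 1 <= q ->
  (forall i, F i \in Lfun mu q%:E) -> vector_Lp q (fun x => \row_i F i x).
Proof.
move=> q1 FL; have q0 : 0 < q := lt_le_trans ltr01 q1.
have q1' : (1 <= q%:E)%E by rewrite lee_fin.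
have mF i : measurable_fun setT (F i).
  by have := FL i; rewrite inE => /andP[]; rewrite inE.
have mrow := measurable_row mF.
split=> //.
have [H0 H] := Lfun_submod_closed mu q1'.
have sL : (fun x => \sum_i `|F i x|) \in Lfun mu q%:E.
  elim: (index_enum 'I_n) => [|i s IH].
    by rewrite (_ : (fun x => _) = 0)//; apply/funext => x; rewrite big_nil.
  rewrite (_ : (fun x => _) = 1 *: (fun x => `|F i x|) + (fun x => \sum_(j <- s) `|F j x|)).
    by apply: H => //; exact: Lfun_abs.
  by apply/funext => x; rewrite big_cons scale1r.
move: sL; rewrite inE => /andP[_]; rewrite inE /= /finite_norm.
apply: le_lt_trans; rewrite unlock.
have ms : measurable_fun setT (fun x => \sum_i `|F i x|).
  by apply: measurable_sum => i; apply: measurableT_comp.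
apply: gt0_ler_poweR.
- by rewrite invr_ge0 ltW.
- by rewrite in_itv/= leey andbT; apply: integral_ge0 => x _; rewrite lee_fin powR_ge0.
- by rewrite in_itv/= leey andbT; apply: integral_ge0 => x _; rewrite lee_fin powR_ge0.
apply: ge0_le_integral => //.
- by move=> x _; rewrite /= lee_fin powR_ge0.
- apply/measurable_EFinP; apply: (measurableT_comp (measurable_powR _)).
  apply: measurableT_comp => //; apply: (measurableT_comp _ mrow).
  have := @continuous_enorm R n 0; under eq_fun do rewrite subr0.
  exact: Defs.continuous_measurable_fun.
- apply/measurable_EFinP; apply: (measurableT_comp (measurable_powR _)).
  exact: measurableT_comp.
move=> x _; rewrite /= lee_fin ge0_ler_powR ?nnegrE ?(ltW q0)//.
rewrite ger0_norm ?enorm_ge0// ger0_norm ?sumr_ge0//.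
by rewrite (le_trans (enorm_le_sum _))//; apply: ler_sum => i _; rewrite mxE.
Qed.

Lemma compact_density_Lfun (g : 'rV[R]_n -> R) (q : R) : 1 <= q -> compact_density g ->
  g \in Lfun mu q%:E.
Proof.
move=> q1 [mg [M [r [gM gr]]]]; have q0 : 0 < q := lt_le_trans ltr01 q1.
rewrite inE; apply/andP; split; rewrite inE//.
rewrite /= /finite_norm unlock; apply: poweR_lty.
have ig : mu.-integrable setT (EFin \o (fun x => `|g x| `^ q)).
  apply: (@bounded_supp_integrable _ _ _ (M `^ q) r).
  - apply: (measurableT_comp (measurable_powR _)); exact: measurableT_comp.
  - move=> x; rewrite ger0_norm ?powR_ge0// ge0_ler_powR ?nnegrE ?(ltW q0)//.
    exact: le_trans (gM x).
  - by move=> x /gr ->; rewrite normr0 powR0// lt0r_neq0.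
have /integrableP[_] := ig; apply: le_lt_trans; rewrite le_eqVlt; apply/orP; left; apply/eqP.
by apply: eq_integral => x _; rewrite /= [in RHS]ger0_norm// powR_ge0.
Qed.

(** Continuous functions with compact support are bounded; applied to the partial
    derivatives this gives a Lipschitz constant. *)
Lemma test_function_bounded_lipschitz U (f : 'rV[R]_n -> R) : test_function U f -> bounded_lipschitz f.
Proof.
move=> [sf cs _]; set K := closure _ in cs.
have [cf df] := sf [::].
have fK x : ~ K x -> f x = 0.
  by move=> nK; apply: contrapT => fx; apply: nK; apply: subset_closure; apply/eqP.
have bd (h : 'rV[R]_n -> R) : continuous h -> (forall x, ~ K x -> h x = 0) ->
    exists2 M : R, 0 <= M & forall x, `|h x| <= M.
  move=> ch hK; have : compact (h @` K).
    by apply: continuous_compact => //; exact: continuous_subspaceT.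
  move=> /compact_bounded[M [Mr HM]]; exists (`|M| + 1); first by rewrite addr_ge0.
  move=> x; have [Kx|nKx] := pselect (K x); last by rewrite hK// normr0 addr_ge0.
  apply: (HM (`|M| + 1)); last by exists x.
  by rewrite (le_lt_trans (ler_norm M))// ltrDl.
have [Bf Bf0 fB] := bd f cf fK.
have pM i : exists M : R, 0 <= M /\ forall x, `|partial i f x| <= M.
  have [ci _] := sf [:: i]; have [|M M0 HM] := bd _ ci; last by exists M.
  move=> x nK; have oK : open (~` K) by apply: closed_openC; exact: closed_closure.
  have /nbhs_ballP[e /= e0 eK] : nbhs x (~` K) by exact: open_nbhs_nbhs.
  transitivity ('D_(delta_mx 0 i) (cst (0 : R) : 'rV[R]_n -> R) x); last by rewrite derive_cst.
  apply: near_eq_derive; apply/nbhs_ballP; exists e => // y /eK nKy.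
  exact: fK.
have /choice[M HM] := pM.
have [Mm Mm0 HMm] : exists2 Mm, 0 <= Mm & forall i, M i <= Mm.
  exists (\sum_i M i); first by apply: sumr_ge0 => i _; exact: (HM i).1.
  by move=> i; rewrite (bigD1 i)//= lerDl sumr_ge0// => j _; exact: (HM j).1.
split.
  exists Bf; split; first exact: num_real.
  by move=> M' BM' x _; rewrite /= (le_trans (fB x))// ltW.
exists (n%:R * Mm); split; first exact: num_real.
move=> M' MM' [x y] _ /=; apply: (@le_trans _ _ (n%:R * Mm * `|x - y|)).
  apply: bounded_partials_lip => [j z|j z]; first exact: df.
  exact: le_trans ((HM j).2 z) (HMm j).
by rewrite ler_wpM2r// ltW.
Qed.

End VectorFields.

(** * Proof of the theorem *)

Section Assembly.
Context {R : realType}.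
Variable n : nat.
Hypothesis n2 : (2 <= n)%N.
Local Notation mu := (@lebesgueN R n).
Variable Omega : set 'rV[R]_n.
Hypothesis oO : open Omega.

Let mO : measurable Omega. Proof. exact: open_measurable_rV. Qed.

Variables (F : 'I_n -> 'rV[R]_n -> R) (d : 'rV[R]_n -> R).
Definition field_of (x : 'rV[R]_n) : 'rV[R]_n := \row_i F i x.

Lemma integral_dotv D f : measurable D -> bounded_lipschitz f -> good_field F ->
  \int[mu]_(x in D) dotv (field_of x) (grad f x) = flux D f F.
Proof.
move=> mD bf gF.
rewrite /flux; have [_ ->] := Rintegral_sum mD (fun i => good_integrable_partial n2 i bf gF mD).
apply: eq_Rintegral => x _; apply: eq_bigr => i _.
by rewrite !mxE mulrC.
Qed.

Lemma integrable_compact : compact_density d -> mu.-integrable setT (EFin \o d).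
Proof.
by move=> [md [M [r [dM dr]]]]; exact: (@bounded_supp_integrable _ _ _ M r).
Qed.

(** The factor 2 comes from the normalisation 1 / (2 e), and n from bounding the
    Euclidean norm by the sum over the coordinates. *)
Lemma carries_realises (lam : ('rV[R]_n -> R) -> R) (K C : R)
    (sigma : {charge set 'rV[R]_n -> \bar R}) :
  carries Omega F d lam K ->
  (forall f, bounded_lipschitz f -> lam f = charge_integral sigma (boundary Omega) f) ->
  Defs.total_variation sigma (boundary Omega) \is a fin_num ->
  n%:R * K = 2 * (C * fine (Defs.total_variation sigma (boundary Omega))) ->
  realises_normal_trace Omega sigma C field_of.
Proof.
move=> [gF cd z l k] lE tvf KC.
have id_ := integrable_compact cd; have [md _] := cd.
have ciE D f : measurable D -> bounded_lipschitz f ->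
    charge_integral (induced_charge id_) D f = \int[mu]_(x in D) (f x * d x).
  move=> mD bf; have [B [L [fB _ _]]] := bounded_lipschitzP bf.
  exact: (charge_integral_density id_ (bounded_lipschitz_measurable bf) fB mD).
exists (induced_charge id_); split.
- move=> f tf; have bf := test_function_bounded_lipschitz tf.
  rewrite ciE// integral_dotv//; apply/eqP; rewrite -addr_eq0 addrC; apply/eqP; exact: z.
- move=> p p1 pn; split; first by apply: vector_LpP => // i; exact: gF.
  by exists d; first exact: compact_density_Lfun.
- set tv := Defs.total_variation _ _ in tvf KC *.
  have mT e : measurable (tube e (boundary Omega)) by exact: measurable_tube.
  have mF i : measurable_fun setT (F i).
    by have := good_integrable n2 i gF; move=> /integrableP[/measurable_EFinP].
  have bnd (e : R) : 0 < e ->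
      (\int[mu]_(x in tube e (boundary Omega)) (enorm (field_of x))%:E <= (n%:R * (K * e))%:E)%E.
    move=> e0.
    apply: (@le_trans _ _ (\int[mu]_(x in tube e (boundary Omega)) (\sum_i (`|F i x|)%:E))%E).
      apply: ge0_le_integral => //.
      - by move=> x _; rewrite lee_fin enorm_ge0.
      - apply/measurable_EFinP; apply: measurable_funTS.
        apply: (measurableT_comp _ (measurable_row mF)).
        have := @continuous_enorm R n 0; under eq_fun do rewrite subr0.
        exact: Defs.continuous_measurable_fun.
      - apply: emeasurable_sum => i; apply/measurable_EFinP.
        by apply: measurableT_comp => //; exact: measurable_funTS.
      - move=> x _; rewrite sumEFin lee_fin (le_trans (enorm_le_sum _))//.
        by apply: ler_sum => i _; rewrite mxE.
    rewrite ge0_integral_sum//; last first.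
      by move=> i; apply/measurable_EFinP; apply: measurableT_comp => //; exact: measurable_funTS.
    apply: (@le_trans _ _ (\sum_(i < n) (K * e)%:E)%E).
      by apply: lee_sum => i _; exact: k.
    by rewrite sumEFin sumr_const card_ord mulr_natl.
  rewrite /limf_esup; pose h (e : R) := (((2 * e)^-1)%:E *
    \int[mu]_(x in tube e (boundary Omega)) (enorm (field_of x))%:E)%E.
  apply: (@le_trans _ _ (ereal_sup (h @` [set e | 0 < e]))).
    by apply: ereal_inf_lbound; exists [set e | 0 < e] => //; exact: nbhs_right_gt.
  apply: ge_ereal_sup => _ [e /= e0 <-]; rewrite /h.
  have e2 : 0 <= (2 * e)^-1 by rewrite invr_ge0 mulr_ge0// ltW.
  apply: (@le_trans _ _ (((2 * e)^-1)%:E * (n%:R * (K * e))%:E)%E).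
    by rewrite lee_wpmul2l ?lee_fin// bnd.
  rewrite -(fineK tvf) -!EFinM lee_fin mulrA KC.
  rewrite le_eqVlt; apply/orP; left; apply/eqP; field.
  by rewrite lt0r_neq0.
- by rewrite -(fineK tvf) -EFinM ltry.
- by move=> f bf; rewrite /normal_trace ciE// integral_dotv// addrC l// lE.
Qed.

Lemma carries_divergence_free (lam : ('rV[R]_n -> R) -> R) (K : R) U :
  carries Omega F d lam K -> (forall x, U x -> d x = 0) -> divergence_free_on U field_of.
Proof.
move=> [gF cd z _ _] dU f tf; have bf := test_function_bounded_lipschitz tf.
have [_ _ fU] := tf.
rewrite integral_dotv//; have := z f bf.
rewrite [X in _ + X = _ -> _](_ : _ = 0) ?addr0//.
rewrite (_ : (fun x => _) = cst 0) ?Rintegral_cst ?mul0r//.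
apply/funext => x /=; have [fx|/eqP fx] := eqVneq (f x) 0; first by rewrite fx mul0r.
by rewrite dU ?mulr0//; apply: fU; apply: subset_closure; exact/eqP.
Qed.

End Assembly.

Theorem theorem4p1 (R : realType) (n : nat) (hn : (2 <= n)%N)
    (Omega : set 'rV[R]_n) (hOmega : bounded_lipschitz_domain Omega) :
  exists C : R,
    forall sigma : {charge set 'rV[R]_n -> \bar R},
      concentrated_on (boundary Omega) sigma ->
      (exists F : 'rV[R]_n -> 'rV[R]_n, realises_normal_trace Omega sigma C F) /\
      (charge_integral sigma (boundary Omega) (fun=> 1) = 0 ->
       exists2 F : 'rV[R]_n -> 'rV[R]_n,
         realises_normal_trace Omega sigma C F &
         exists U : set 'rV[R]_n,
           [/\ open U, closure Omega `<=` U & divergence_free_on U F]).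
Proof.
have [[a0 Oa0] oO cO bO lb] := hOmega.
have [mb [C [r [U [C0 r0 oU cU ch]]]]] := channel_boundary hn oO cO lb bO Oa0.
exists (n%:R * C / 2) => sigma _.
set P := hahn_pos sigma; set N := hahn_neg sigma.
pose mp : {finite_measure set 'rV[R]_n -> \bar R} := jordan_pos (hahnP sigma).
pose mn : {finite_measure set 'rV[R]_n -> \bar R} := jordan_neg (hahnP sigma).
have [F1 [d1 [c1 e1]]] := ch r r0 (lexx r) mp _ mb (@subset_refl _ _).
have [F2 [d2 [c2 e2]]] := ch r r0 (lexx r) mn _ mb (@subset_refl _ _).
have c12 := carriesD hn oO c1 (carriesZ hn oO (-1) c2).
have pf : mp (boundary Omega) \is a fin_num by exact: fin_num_measure.
have nf : mn (boundary Omega) \is a fin_num by exact: fin_num_measure.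
have tvE : Defs.total_variation sigma (boundary Omega) =
    (mp (boundary Omega) + mn (boundary Omega))%E by [].
have rz : realises_normal_trace Omega sigma (n%:R * C / 2)
    (field_of (fun i x => F1 i x + -1 * F2 i x)).
  apply: (carries_realises hn oO c12).
  - by move=> f bf; rewrite mulN1r.
  - by rewrite tvE fin_numD pf nf.
  - rewrite tvE fineD// normrN1 mul1r -mulrDr; by field.
split; first by eexists; exact: rz.
move=> s0; eexists; first exact: rz.
exists U; split => //.
apply: (carries_divergence_free hn c12) => x Ux.
rewrite e1// e2// mulN1r -mulrBl.
suff -> : fine (mp (boundary Omega)) - fine (mn (boundary Omega)) = 0 by rewrite mul0r.
move: s0; rewrite /charge_integral !Rintegral_cst// !mul1r.
by [].
Qed.
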